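(* Let $n \geq 2$, $r,R\in(0,1)$, and suppose $f \colon \mathbb{A}_{n,r} \to \mathbb{A}_{N,R}$ is a proper rational map of degree 2 such that $N_f = N$. Write $b=\frac{1-R^2}{1-r^2}$. For constants $a$ and $Q$, consider the map $$\begin{aligned} (\ast)\quad \Biggl( & \frac{\sqrt{1-b+Qr^2} + \frac{(1-b)a}{\sqrt{1-b+Qr^2}}z_1}{1+az_1} , \ \frac{\sqrt{ba^2+Q}\,z_1^2 + \frac{ba}{\sqrt{ba^2+Q}}z_1}{1+az_1} , \\ & \frac{\sqrt{b-Q(1+r^2)} + \frac{ba}{\sqrt{b-Q(1+r^2)}} z_1}{1+az_1} \otimes (z_2,\ldots,z_n) , \\ & \frac{\sqrt{ba^2+2Q-\frac{b^2a^2}{b-Q(1+r^2)}} \, z_1}{1+az_1} \otimes (z_2,\ldots,z_n) , \ \frac{\sqrt{Q}}{1+az_1} H'_2(z_2,\ldots,z_n) \Biggr) \end{aligned}$$ and the two values $$(\ast\ast)\quad Q= \frac{ -a^2br^4+(2(1-a^2)b+a^2-1)r^2+b-1 \ \pm\ \sqrt{ a^4r^4(br^2+1)^2 -2a^2r^2\bigl(br^2(r^2+b-1)+1+r^2-b\bigr) +(1+r^2-b)^2 } }{ 2(r^4+r^2) } .$$ Then $R \geq r^2$ and: (i) If $R = r^2$, then $N = \binom{n+1}{2}$ and $f$ is unitarily equivalent to $H_2$. (ii) If $r^2 < R < r$ and $f$ is polynomial, then $N=\binom{n+1}{2}+n$ and $f$ is unitarily equivalent to the juxtaposition $\sqrt{1-t}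 \, H_1 \oplus \sqrt{t} \, H_2$ for exactly one $t \in (0,1)$. (iii) If $r^2 < R < r$ and $f$ is not polynomial, then $N=\binom{n+1}{2}+n$ and $f$ is unitarily equivalent to a map of the form $(\ast)$ for exactly one pair $a$ and $Q$, where $a > 0$, $$a \leq \sqrt{ \frac{ br^4+(b^2-b+1)r^2-b+1 -2r\sqrt{(b-1)b(1+r^2)(br^2-b+1)} }{ b^2r^6+2br^4+r^2 } }$$ and $Q$ is either one of the two values $(\ast\ast)$. Moreover, for each such pair $a$ and $Q$, a map exists. (iv) If $R = r$, then $N=\binom{n+1}{2}+n$ and $f$ is unitarily equivalent to a map of the form $(\ast)$ for exactly one $a \in \left(0,\frac{1}{\sqrt{1+r^2}}\right)$ and $Q=\frac{1}{1+r^2}-a^2$. Moreover, for each such $a$, a map exists. (v) If $r < R < 1$, then $N=\binom{n+1}{2}+n$ and $f$ is unitarily equivalent to a map of the form $(\ast)$ for exactly one $a \in (0,1)$, where $Q$ is the larger of the two values $(\ast\ast)$. Moreover, for each such $a$, a map exists.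
   Context: For $0<r<1$, $\mathbb{A}_{n,r} = \{ z \in \mathbb{C}^n : r < \|z\| < 1 \}$. The degree of a rational map $f=p/q$ in lowest terms ($p$ a vector of polynomials, $q$ a polynomial) is the maximum of the degrees of $q$ and the components of $p$. Two maps $f,g \colon \mathbb{A}_{n,r} \to \mathbb{A}_{N,R}$ are unitarily equivalent if there exist unitary matrices $V \in U(n)$ and $W \in U(N)$ with $f = W g V$, i.e. $f(z)=W\,g(Vz)$. The embedding dimension $N_f$ is the complex dimension of the smallest complex affine subspace of $\mathbb{C}^N$ containing $f(\mathbb{A}_{n,r})$. For an integer $d\ge 1$, $H_d \colon \mathbb{C}^n \to \mathbb{C}^{\binom{n+d-1}{d}}$ is the map whose components are $\sqrt{\tfrac{d!}{\alpha!}}\, z^\alpha$ over all multi-indices $\alpha$ with $|\alpha|=d$ (so $H_1(z)=z$). $H'_2(z_2,\ldots,z_n)$ is the analogous degree 2 map in the variables $z_2,\ldots,z_n$, i.e. $H_2'(z_2,\dots,z_n)=(z_2^2,\sqrt2 z_2z_3,\ldots,\sqrt2 z_2z_n,z_3^2,\ldots,z_n^2)$, with $H_2'(z_2)=z_2^2$ if $n=2$. $\oplus$ is concatenation of components; a scalar function $\otimes\,(z_2,\ldots,z_n)$ denotes the $n-1$ components obtained by multiplying the scalar function by each of $z_2,\dots,z_n$. ''A map exists'' means that for such parameters, $(\ast)$ is a proper rational map $\mathbb{A}_{n,r}\to\mathbb{A}_{N,R}$ of degree 2 with $N_f=N$, of the kind described in that item. *)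

(* Defs.v *)
From HB Require Import structures.
From mathcomp Require Import all_boot all_order all_algebra.
From mathcomp Require Import zify complex.
From mathcomp Require Import boolp classical_sets reals topology normedtype.
From mathcomp.multinomials Require mpoly.
Import -(notations) mpoly.

Set Implicit Arguments.
Unset Strict Implicit.
Unset Printing Implicit Defensive.

Import Order.TTheory GRing.Theory Num.Theory.
Import numFieldNormedType.Exports.

Local Open Scope classical_set_scope.
Local Open Scope ring_scope.
Local Open Scope complex_scope.

Section NormedColumns.
(* Stated over an abstract [K] because the norm topology is declared on a
   generic [numClosedFieldType] and is not found on [R[i]] directly; these
   definitions are used at [K := R[i]], where ['cV[K]_n] is C^n. *)
Variable K : numClosedFieldType.

Definition proper_map n N (A : set 'cV[K]_n) (B : set 'cV[K]_N)
    (f : 'cV[K]_n -> 'cV[K]_N) : Prop :=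
  [/\ {within A, continuous f},
      f @` A `<=` B
    & forall L : set 'cV[K]_N,
        L `<=` B -> compact L -> compact (A `&` f @^-1` L)].

Definition peval n (p : mpoly n K) (z : 'cV[K]_n) : K :=
  meval (fun i => z i 0) p.

Definition polynomial_on n N (A : set 'cV[K]_n) (f : 'cV[K]_n -> 'cV[K]_N)
    : Prop :=
  exists p : 'I_N -> mpoly n K,
    forall z, A z -> forall j, f z j 0 = peval (p j) z.

Definition lowest_terms n N (p : 'I_N -> mpoly n K) (q : mpoly n K) : Prop :=
  q != 0 /\
  forall (d q' : mpoly n K) (p' : 'I_N -> mpoly n K),
    q = d * q' -> (forall j, p j = d * p' j) -> (msize d <= 1)%N.

(* [msize] is one more than the total degree, and is 0 on the zero
   polynomial.  Where p/q is in lowest terms, a holomorphic map given by it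
   has no pole, hence the condition that q does not vanish on A. *)
Definition rational_of_degree n N (A : set 'cV[K]_n)
    (f : 'cV[K]_n -> 'cV[K]_N) (d : nat) : Prop :=
  exists (p : 'I_N -> mpoly n K) (q : mpoly n K),
    [/\ lowest_terms p q,
        forall z, A z -> peval q z != 0 /\
          forall j, f z j 0 = peval (p j) z / peval q z
      & d = maxn (msize q).-1 (\max_(j < N) (msize (p j)).-1)].

Definition affine_subspace N (v : 'cV[K]_N) (U : {vspace 'cV[K]_N})
    : set 'cV[K]_N := [set w | w - v \in U].

Definition embedding_dim n N (A : set 'cV[K]_n) (f : 'cV[K]_n -> 'cV[K]_N)
    (k : nat) : Prop :=
  exists (v : 'cV[K]_N) (U : {vspace 'cV[K]_N}),
    [/\ f @` A `<=` affine_subspace v U,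
        forall v' U', f @` A `<=` affine_subspace v' U' ->
          affine_subspace v U `<=` affine_subspace v' U'
      & \dim U = k].

Definition unitarily_equivalent n N (A : set 'cV[K]_n)
    (f g : 'cV[K]_n -> 'cV[K]_N) : Prop :=
  exists (V : 'M[K]_n) (W : 'M[K]_N),
    [/\ V \is unitarymx, W \is unitarymx
      & forall z, A z -> f z = W *m g (V *m z)].

Definition coords n (z : 'cV[K]_n) : seq K := [seq z i 0 | i <- enum 'I_n].

(* Maps into C^N are described below by their lists of components; the size
   lemmas show that N is the length of the list wherever this is used. *)
Definition col_of_seq N (s : seq K) : 'cV[K]_N := \col_(j < N) nth 0 s j.

End NormedColumns.

Section Annuli.
Variable R : realType.
Local Notation C := R[i].

Definition enorm n (z : 'cV[C]_n) : R :=
  Num.sqrt (\sum_(i < n) Normc.normc (z i 0) ^+ 2).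

Definition annulus n (r : R) : set 'cV[C]_n := [set z | r < enorm z < 1].

Definition multi_index k d : {set k.-tuple 'I_d.+1} :=
  [set alpha : k.-tuple 'I_d.+1 | (\sum_(i <- alpha) i)%N == d]%SET.

(* The components of H_d at the point with coordinates xs, in the enumeration
   order of the multi-indices; another order gives a unitarily equivalent map
   (for d = 1 the components are a permutation of xs). *)
Definition Hseq d (xs : seq C) : seq C :=
  [seq (Num.sqrt (d`!%:R / (\prod_(i <- alpha) i`!)%N%:R))%:C *
       \prod_(i < size xs) xs`_i ^+ tnth alpha i
  | alpha : (size xs).-tuple 'I_d.+1 <- enum (multi_index (size xs) d)].

Definition Hmap n N d (z : 'cV[C]_n) : 'cV[C]_N :=
  col_of_seq N (Hseq d (coords z)).

Definition juxtaposition_seq (t : R) (zs : seq C) : seq C :=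
  [seq (Num.sqrt (1 - t))%:C * w | w <- Hseq 1 zs] ++
  [seq (Num.sqrt t)%:C * w | w <- Hseq 2 zs].

Definition juxtaposition n N (t : R) (z : 'cV[C]_n) : 'cV[C]_N :=
  col_of_seq N (juxtaposition_seq t (coords z)).

(* The list zs is (z_1, ..., z_n), so that [head 0 zs] is z_1 and [behead zs]
   is (z_2, ..., z_n). *)
Definition star_seq (r b a Q : R) (zs : seq C) : seq C :=
  let z1 := head 0 zs in
  let z' := behead zs in
  let al := 1 - b + Q * r ^+ 2 in
  let be := b * a ^+ 2 + Q in
  let ga := b - Q * (1 + r ^+ 2) in
  let de := b * a ^+ 2 + 2 * Q - b ^+ 2 * a ^+ 2 / ga in
  let q := 1 + a%:C * z1 in
  [:: ((Num.sqrt al)%:C + ((1 - b) * a / Num.sqrt al)%:C * z1) / q;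
      ((Num.sqrt be)%:C * z1 ^+ 2 + (b * a / Num.sqrt be)%:C * z1) / q]
  ++ [seq ((Num.sqrt ga)%:C + (b * a / Num.sqrt ga)%:C * z1) / q * w | w <- z']
  ++ [seq (Num.sqrt de)%:C * z1 / q * w | w <- z']
  ++ [seq (Num.sqrt Q)%:C / q * w | w <- Hseq 2 z'].

Definition star_map n N (r b a Q : R) (z : 'cV[C]_n) : 'cV[C]_N :=
  col_of_seq N (star_seq r b a Q (coords z)).

(* [Num.sqrt] is 0 on negative numbers and [x / 0 = 0]: these inequalities
   say that every root and quotient in [star_seq] is a genuine one. *)
Definition star_defined (r b a Q : R) : Prop :=
  [/\ 0 < 1 - b + Q * r ^+ 2,
      0 < b * a ^+ 2 + Q,
      0 < b - Q * (1 + r ^+ 2),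
      0 <= b * a ^+ 2 + 2 * Q - b ^+ 2 * a ^+ 2 / (b - Q * (1 + r ^+ 2))
    & 0 <= Q].

Definition Q_disc (r b a : R) : R :=
  a ^+ 4 * r ^+ 4 * (b * r ^+ 2 + 1) ^+ 2
  - 2 * a ^+ 2 * r ^+ 2 *
      (b * r ^+ 2 * (r ^+ 2 + b - 1) + 1 + r ^+ 2 - b)
  + (1 + r ^+ 2 - b) ^+ 2.

Definition Q_lin (r b a : R) : R :=
  - (a ^+ 2 * b * r ^+ 4)
  + (2 * (1 - a ^+ 2) * b + a ^+ 2 - 1) * r ^+ 2 + b - 1.

Definition Q_plus (r b a : R) : R :=
  (Q_lin r b a + Num.sqrt (Q_disc r b a)) / (2 * (r ^+ 4 + r ^+ 2)).

Definition Q_minus (r b a : R) : R :=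
  (Q_lin r b a - Num.sqrt (Q_disc r b a)) / (2 * (r ^+ 4 + r ^+ 2)).

Definition a_max (r b : R) : R :=
  Num.sqrt
    ((b * r ^+ 4 + (b ^+ 2 - b + 1) * r ^+ 2 - b + 1
      - 2 * r * Num.sqrt
          ((b - 1) * b * (1 + r ^+ 2) * (b * r ^+ 2 - b + 1)))
     / (b ^+ 2 * r ^+ 6 + 2 * b * r ^+ 4 + r ^+ 2)).

Definition proper_rational_deg2 n N (r rho : R) (f : 'cV[C]_n -> 'cV[C]_N)
    : Prop :=
  [/\ proper_map (annulus r) (annulus rho) f,
      rational_of_degree (annulus r) f 2
    & embedding_dim (annulus r) f N].

Lemma size_Hseq d (xs : seq C) : (0 < size xs)%N ->
  size (Hseq d xs) = 'C((size xs).-1 + d, d).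
Proof.
rewrite size_map -cardE /multi_index.
case: (size xs) => // m _.
by rewrite card_ord_partitions -bin_sub ?leq_addr // addKn.
Qed.

Lemma size_coords n (z : 'cV[C]_n) : size (coords z) = n.
Proof. by rewrite size_map size_enum_ord. Qed.

Lemma size_juxtaposition_seq (t : R) (zs : seq C) : (0 < size zs)%N ->
  size (juxtaposition_seq t zs) = ('C((size zs).+1, 2) + size zs)%N.
Proof.
move=> zs0; rewrite size_cat (size_map _ (Hseq 1 _)) (size_map _ (Hseq 2 _)).
by rewrite !size_Hseq // bin1 addn1 addn2 prednK // addnC.
Qed.

Lemma size_star_seq (r b a Q : R) (zs : seq C) : (2 <= size zs)%N ->
  size (star_seq r b a Q zs) = ('C((size zs).+1, 2) + size zs)%N.
Proof.
case: zs => [|z1 [|z2 zs]] // _.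
rewrite /star_seq [behead _]/= !size_cat.
rewrite !(size_map _ (z2 :: zs)).
rewrite (size_map _ (Hseq 2 _)) size_Hseq //= addn2.
by rewrite [in RHS]binS bin1; lia.
Qed.

End Annuli.

(* Main.v *)
(* Write x = |z|^2 and b = (1 - rho^2) / (1 - r^2).  A proper rational map f = p/q
   of degree 2 sends each boundary sphere of the annulus into the boundary of the
   target; restricting to circles rationally parametrized in the spheres shows that
   a whole sphere goes to one boundary component.  Comparing Fourier coefficients
   along unit vectors then forces q to be affine, q = 1 + l, and yields
     |p|^2 = (1 - b + b x) |q|^2 + Q (1 - x) (r^2 - x)
   for some Q > 0.  Polarized, this identity gives all inner products <p z, p w>, so
   by the uniqueness of a vector-valued map with given Gram kernel and spanning image
   f is determined up to a unitary by l and Q, that is, by a = |l| and Q.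
   If a = 0, minimality of the target dimension kills p(0), which fixes Q and f is
   H_2 or a juxtaposition.  If a > 0, minimality makes the Gram determinant of the
   coefficients of 1, z_1, z_1^2 vanish: this is the quadratic equation for Q whose
   roots are the two given values, and a case study on b locates the roots for which
   the coefficients of the star map are real.  Its squared norm is again the identity
   above, so it is proper and is the model for f.  Averaging the norm identity over z
   and -z recovers Q and a from f. *)

(* Nothing prevents q from vanishing on the boundary, so every boundary relation is kept in the
   homogeneous form |p|^2 = c |q|^2. A boundary point yields only c = 1 or c = rho^2, that is, a
   vanishing product of two defects; one factor vanishes on the whole sphere because the defects
   become polynomials along a rational circle and polynomials in one variable form a domain. The
   hypothesis n >= 2 supplies unit vectors killed by the linear or by the quadratic part of q. At
   such a vector some coefficients of the identity become squared norms, and their signs show that c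
   differs on the two spheres, that c = 1 on the outer one, and that Q >= 0. Degree exactly 2 makes
   Q positive: for Q = 0 the vector p would be q times an affine map. The parameter ranges of the
   three nonpolynomial cases are all instances of one predicate, [admissible], and are unfolded only
   at the end according to b > 1, b = 1 or b < 1. *)
Require Import Defs.
From mathcomp Require Import all_boot all_order all_algebra.
From mathcomp Require Import zify ring lra complex.
From mathcomp Require Import boolp classical_sets reals topology normedtype derive.
From mathcomp.multinomials Require mpoly.
Import -(notations) mpoly.

Set Implicit Arguments.
Unset Strict Implicit.
Unset Printing Implicit Defensive.

Import Order.TTheory GRing.Theory Num.Theory.
Import numFieldNormedType.Exports.

Local Open Scope ring_scope.

(** * Hermitian forms and quadratic maps *)

Section HermitianForm.
Variable K : numClosedFieldType.

Definition dot m (u v : 'cV[K]_m) : K := \sum_i u i 0 * (v i 0)^*.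

Lemma dotDl m (u v w : 'cV[K]_m) : dot (u + v) w = dot u w + dot v w.
Proof.
by rewrite /dot -big_split; apply: eq_bigr => i _; rewrite mxE mulrDl.
Qed.

Lemma dotZl m a (u w : 'cV[K]_m) : dot (a *: u) w = a * dot u w.
Proof. by rewrite /dot mulr_sumr; apply: eq_bigr => i _; rewrite mxE mulrA. Qed.

Lemma dotC m (u v : 'cV[K]_m) : dot v u = (dot u v)^*.
Proof.
rewrite /dot rmorph_sum; apply: eq_bigr => i _.
by rewrite rmorphM /= conjCK mulrC.
Qed.

Lemma dotDr m (u v w : 'cV[K]_m) : dot w (u + v) = dot w u + dot w v.
Proof. by rewrite dotC dotDl rmorphD /= -!dotC. Qed.

Lemma dotZr m a (u w : 'cV[K]_m) : dot w (a *: u) = a^* * dot w u.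
Proof. by rewrite dotC dotZl rmorphM /= -dotC. Qed.

Lemma dot0l m (w : 'cV[K]_m) : dot 0 w = 0.
Proof. by rewrite -(scale0r 0) dotZl mul0r. Qed.

Lemma dot0r m (w : 'cV[K]_m) : dot w 0 = 0.
Proof. by rewrite dotC dot0l rmorph0. Qed.

Lemma dotNl m (u w : 'cV[K]_m) : dot (- u) w = - dot u w.
Proof. by rewrite -scaleN1r dotZl mulN1r. Qed.

Lemma dotNr m (u w : 'cV[K]_m) : dot w (- u) = - dot w u.
Proof. by rewrite dotC dotNl rmorphN /= -dotC. Qed.

Lemma dotBl m (u v w : 'cV[K]_m) : dot (u - v) w = dot u w - dot v w.
Proof. by rewrite dotDl dotNl. Qed.

Lemma dotBr m (u v w : 'cV[K]_m) : dot w (u - v) = dot w u - dot w v.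
Proof. by rewrite dotDr dotNr. Qed.

Lemma dot_ge0 m (u : 'cV[K]_m) : 0 <= dot u u.
Proof. by apply: sumr_ge0 => i _; rewrite mul_conjC_ge0. Qed.

Lemma dot_eq0 m (u : 'cV[K]_m) : (dot u u == 0) = (u == 0).
Proof.
apply/idP/eqP => [|->]; last by rewrite dot0l.
rewrite psumr_eq0; last by move=> i _; rewrite mul_conjC_ge0.
move=> /allP u0; apply/matrixP => i j; rewrite ord1 mxE.
by have := u0 i (mem_index_enum i); rewrite mul_conjC_eq0 => /eqP.
Qed.

Lemma dot_conj m (u : 'cV[K]_m) : (dot u u)^* = dot u u.
Proof. by rewrite -dotC. Qed.

Lemma dot_mulmx m (u v : 'cV[K]_m) : dot u v = (u^T *m map_mx Num.conj v) 0 0.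
Proof. by rewrite mxE; apply: eq_bigr => i _; rewrite !mxE. Qed.

Lemma dot_unitary m (W : 'M[K]_m) (u v : 'cV[K]_m) :
  W \is unitarymx -> dot (W *m u) (W *m v) = dot u v.
Proof.
rewrite -trmx_unitary => /unitarymxP; rewrite trmxK => WW.
rewrite !dot_mulmx trmx_mul map_mxM /= -mulmxA (mulmxA W^T).
by rewrite WW mul1mx.
Qed.


(* five points of the circle suffice: [±1], [±'i] and [(3 + 4 'i) / 5] *)
Lemma trig2_eq0 (c0 c1 c2 c3 c4 : K) :
  (forall w : K, w * w^* = 1 ->
     c0 + c1 * w + c2 * w ^+ 2 + c3 * w ^+ 3 + c4 * w ^+ 4 = 0) ->
  [/\ c0 = 0, c1 = 0, c2 = 0, c3 = 0 & c4 = 0].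
Proof.
move=> H.
have ii : 'i ^+ 2 = -1 :> K by rewrite sqrCi.
have i0 : 'i != 0 :> K by rewrite neq0Ci.
have n0 k : (k.+1%:R : K) != 0 by rewrite pnatr_eq0.
have n2 := n0 1%N; have n5 := n0 4.
have e1 : c0 + c1 + c2 + c3 + c4 = 0.
  by rewrite -[RHS](H 1) ?rmorph1 ?mulr1 //; ring.
have e2 : c0 - c1 + c2 - c3 + c4 = 0.
  by rewrite -[RHS](H (-1)) ?rmorphN ?rmorph1 ?mulrNN ?mulr1 //; ring.
have e3 : c0 + c1 * 'i - c2 - c3 * 'i + c4 = 0.
  rewrite -[RHS](H 'i) ?conjCi; first by ring: ii.
  by rewrite mulrN -expr2 ii opprK.
have e4 : c0 - c1 * 'i - c2 + c3 * 'i + c4 = 0.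
  rewrite -[RHS](H (- 'i)) ?rmorphN /= ?conjCi; first by ring: ii.
  by rewrite mulrNN mulrN -expr2 ii opprK.
have c2E : c2 = 0.
  apply: (mulfI (n0 3)).
  transitivity ((c0 + c1 + c2 + c3 + c4) + (c0 - c1 + c2 - c3 + c4)
    - (c0 + c1 * 'i - c2 - c3 * 'i + c4)
    - (c0 - c1 * 'i - c2 + c3 * 'i + c4)); first by ring.
  by rewrite e1 e2 e3 e4; ring.
have c13 : c1 + c3 = 0.
  apply: (mulfI n2).
  transitivity ((c0 + c1 + c2 + c3 + c4) - (c0 - c1 + c2 - c3 + c4)).
    by ring.
  by rewrite e1 e2; ring.
have c13' : c1 - c3 = 0.
  apply: (mulfI n2); apply: (mulfI i0).
  transitivity ((c0 + c1 * 'i - c2 - c3 * 'i + c4)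
    - (c0 - c1 * 'i - c2 + c3 * 'i + c4)); first by ring.
  by rewrite e3 e4; ring.
have c1E : c1 = 0.
  apply: (mulfI n2); transitivity ((c1 + c3) + (c1 - c3)); first by ring.
  by rewrite c13 c13'; ring.
have c3E : c3 = 0 by move: c13; rewrite c1E add0r.
have c4E : c4 = - c0.
  by move/eqP: e1; rewrite c1E c2E c3E !addr0 addrC addr_eq0 => /eqP.
(* The fourth roots of unity see exponents only modulo 4 and cannot separate [c0] from [c4]. At w =
   (3 + 4i)/5 what is left is [c0] (1 - w^4), and 625 (1 - w^4) = 1152 + 336i. *)
have e5 : c0 * (1152 + 336 * 'i) = 0.
  transitivity (625 * (c0 + c1 * ((3 + 4 * 'i) / 5) + c2 * ((3 + 4 * 'i) / 5) ^+ 2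
     + c3 * ((3 + 4 * 'i) / 5) ^+ 3 + c4 * ((3 + 4 * 'i) / 5) ^+ 4)).
    by rewrite c1E c2E c3E c4E; field: ii.
  rewrite H ?mulr0 // fmorph_div rmorphD rmorphM /= conjCi !rmorph_nat.
  by field: ii.
have c0E : c0 = 0.
  move/eqP: e5; rewrite mulf_eq0 => /orP[/eqP//|/eqP e5].
  have : (1152 ^+ 2 + 336 ^+ 2 : K) = 0.
    transitivity ((1152 + 336 * 'i) * (1152 - 336 * 'i) : K); first by ring: ii.
    by rewrite e5 mul0r.
  by move/eqP; rewrite -!natrX -natrD pnatr_eq0.
by rewrite c4E c0E oppr0.
Qed.
End HermitianForm.

Section Polarization.
Variables (K : numClosedFieldType) (n : nat).

(** Degree at most 2, recorded through restrictions to complex lines: polarization needs nothing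
    more, and auxiliary maps such as z multiplied by 1 + l z satisfy it without a choice of
    coefficients. *)
Definition quadratic_on_lines m (F : 'cV[K]_n -> 'cV[K]_m) :=
  forall z v, exists A0 A1 A2, forall t,
    F (z + t *: v) = A0 + t *: A1 + t ^+ 2 *: A2.

(** Bidegree (2, 2) in s and the conjugate of t. The two parameters are independent, yet the
    diagonal s = t still involves all nine coefficients. *)
Definition kernel_on_lines (H : 'cV[K]_n -> 'cV[K]_n -> K) :=
  forall z v, exists c : nat -> nat -> K, forall s t,
    H (z + s *: v) (z + t *: v) =
    \sum_(i < 3) \sum_(j < 3) c i j * s ^+ i * t^* ^+ j.

Lemma kernel_on_lines_dot m (F G : 'cV[K]_n -> 'cV[K]_m) :
  quadratic_on_lines F -> quadratic_on_lines G ->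
  kernel_on_lines (fun z w => dot (F z) (G w)).
Proof.
move=> hF hG z v.
have [A0 [A1 [A2 FE]]] := hF z v; have [B0 [B1 [B2 GE]]] := hG z v.
pose A i := nth 0 [:: A0; A1; A2] i; pose B i := nth 0 [:: B0; B1; B2] i.
exists (fun i j => dot (A i) (B j)) => s t.
rewrite FE GE !big_ord_recr !big_ord0 /= /A /B /=.
rewrite !(dotDl, dotDr, dotZl, dotZr) !rmorphXn /=.
by ring.
Qed.

Lemma kernel_on_linesD H1 H2 : kernel_on_lines H1 -> kernel_on_lines H2 ->
  kernel_on_lines (fun z w => H1 z w + H2 z w).
Proof.
move=> h1 h2 z v; have [c1 E1] := h1 z v; have [c2 E2] := h2 z v.
exists (fun i j => c1 i j + c2 i j) => s t; rewrite E1 E2 -big_split.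
apply: eq_bigr => i _; rewrite -big_split; apply: eq_bigr => j _ /=; ring.
Qed.

Lemma kernel_on_linesZ a H : kernel_on_lines H ->
  kernel_on_lines (fun z w => a * H z w).
Proof.
move=> h z v; have [c E] := h z v.
exists (fun i j => a * c i j) => s t; rewrite E mulr_sumr.
apply: eq_bigr => i _; rewrite mulr_sumr; apply: eq_bigr => j _ /=; ring.
Qed.

(** On the line from z to w the wanted value is the one at s = 0, t = 1, so only the coefficients
    [c 0 j] matter. On the diagonal, a circle of fixed radius separates the differences i - j by
    [trig2_eq0], and the radii 1 and 2 separate [c 0 1] from [c 1 2]. *)
Lemma polarization H : kernel_on_lines H -> (forall z, H z z = 0) ->
  forall z w, H z w = 0.
Proof.
move=> hH H0 z w; have [c E] := hH z (w - z).
have EP : forall s, \sum_(i < 3) \sum_(j < 3) c i j * s ^+ i * s^* ^+ j = 0.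
  by move=> s; rewrite -E.
have n0 k : (k.+1%:R : K) != 0 by rewrite pnatr_eq0.
have trig (s : K) : s^* = s -> s != 0 ->
    c 0 2 = 0 /\ c 0 1 + s ^+ 2 * c 1 2 = 0.
  move=> sR s0.
  have [] := @trig2_eq0 K (s ^+ 2 * c 0 2) (s * c 0 1 + s ^+ 3 * c 1 2)
    (c 0 0 + s ^+ 2 * c 1 1 + s ^+ 4 * c 2 2) (s * c 1 0 + s ^+ 3 * c 2 1)
    (s ^+ 2 * c 2 0).
    move=> x x1; have := EP (s * x); rewrite rmorphM /= sR.
    move=> /(congr1 (fun y => x ^+ 2 * y)); rewrite mulr0 => <-.
    rewrite !big_ord_recr !big_ord0 /=.
    by ring: x1.
  move=> a1 a2 _ _ _; split.
    by apply/eqP; move/eqP: a1; rewrite mulf_eq0 expf_eq0 /= (negPf s0).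
  by apply: (mulfI s0); rewrite mulr0 -[RHS]a2; ring.
have [c02 c01a] := trig 1 (rmorph1 _) (oner_neq0 _).
have [_ c01b] := trig 2 (rmorph_nat _ 2) (n0 1%N).
have c01 : c 0 1 = 0.
  apply: (mulfI (n0 2)).
  transitivity (4 * (c 0%N 1%N + 1 ^+ 2 * c 1%N 2%N) - (c 0%N 1%N + 2 ^+ 2 * c 1%N 2%N)).
    by ring.
  by rewrite c01a c01b; ring.
have c00 : c 0 0 = 0.
  have := EP 0; rewrite !big_ord_recr !big_ord0 /= rmorph0 => h.
  by rewrite -[RHS]h; ring.
have := E 0 1; rewrite scale0r addr0 scale1r addrC subrK => ->.
rewrite !big_ord_recr !big_ord0 /= c00 c01 c02; ring.
Qed.

End Polarization.

Section QuadraticMaps.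
Variables (K : numClosedFieldType) (n : nat).

Record quadmap m := QuadMap
  { qcst : 'cV[K]_m; qlin : 'M[K]_(m, n); qform : 'I_m -> 'M[K]_n }.

Definition qhom2 m (F : quadmap m) (z : 'cV[K]_n) : 'cV[K]_m :=
  \col_j (z^T *m qform F j *m z) 0 0.

Definition qeval m (F : quadmap m) (z : 'cV[K]_n) : 'cV[K]_m :=
  qcst F + qlin F *m z + qhom2 F z.

Definition qhom2_polar m (F : quadmap m) (z v : 'cV[K]_n) : 'cV[K]_m :=
  \col_j (z^T *m qform F j *m v + v^T *m qform F j *m z) 0 0.

Lemma qhom2D m (F : quadmap m) (z v : 'cV[K]_n) t :
  qhom2 F (z + t *: v) = qhom2 F z + t *: qhom2_polar F z v + t ^+ 2 *: qhom2 F v.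
Proof.
have tr : (z + t *: v)^T = z^T + t *: v^T by apply/matrixP => i j; rewrite !mxE.
apply/matrixP => i j; rewrite [LHS]mxE tr !(mulmxDl, mulmxDr).
rewrite -!(scalemxAl, scalemxAr) !mxE; ring.
Qed.

Lemma qhom2Z m (F : quadmap m) (z : 'cV[K]_n) t : qhom2 F (t *: z) = t ^+ 2 *: qhom2 F z.
Proof.
have tr : (t *: z)^T = t *: z^T by apply/matrixP => i j; rewrite !mxE.
apply/matrixP => i j; rewrite [LHS]mxE tr -!(scalemxAl, scalemxAr).
by rewrite !mxE; ring.
Qed.

Lemma qevalZ m (F : quadmap m) (z : 'cV[K]_n) t :
  qeval F (t *: z) = qcst F + t *: (qlin F *m z) + t ^+ 2 *: qhom2 F z.
Proof. by rewrite /qeval qhom2Z scalemxAr. Qed.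

Lemma qeval_on_lines m (F : quadmap m) : quadratic_on_lines (qeval F).
Proof.
move=> z v; exists (qeval F z), (qlin F *m v + qhom2_polar F z v), (qhom2 F v).
move=> t; rewrite /qeval qhom2D mulmxDr -scalemxAr.
by apply/matrixP => i j; rewrite !mxE; ring.
Qed.

Lemma qhom2_on_lines m (F : quadmap m) : quadratic_on_lines (qhom2 F).
Proof. by move=> z v; eexists; eexists; eexists => t; apply: qhom2D. Qed.

Lemma normalize (z : 'cV[K]_n) : z != 0 ->
  exists s u, [/\ 0 < s, s ^+ 2 = dot z z, z = s *: u & dot u u = 1].
Proof.
move=> z0; have zz0 : 0 < dot z z by rewrite lt_def dot_eq0 z0 dot_ge0.
have s0 : 0 < sqrtC (dot z z) by rewrite sqrtC_gt0.
have sn := lt0r_neq0 s0.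
exists (sqrtC (dot z z)), ((sqrtC (dot z z))^-1 *: z); split=> //.
- by rewrite sqrtCK.
- by rewrite scalerA divff // scale1r.
have sR : (sqrtC (dot z z))^* = sqrtC (dot z z).
  by apply/CrealP/ger0_real/ltW.
rewrite dotZl dotZr fmorphV /= sR mulrA -invfM -expr2 sqrtCK mulVf //.
by rewrite dot_eq0.
Qed.

Lemma homogeneous_unit0 (h : 'cV[K]_n -> K) d :
  (forall s z, h (s *: z) = s ^+ d * h z) -> forall z, z != 0 -> h z = 0 ->
  exists2 u, dot u u = 1 & h u = 0.
Proof.
move=> hZ z z0 hz; have [s [u [s0 _ zE u1]]] := normalize z0.
exists u => //; move: hz; rewrite zE hZ => /eqP; rewrite mulf_eq0.
by rewrite expf_eq0 (gt_eqF s0) andbF /= => /eqP.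
Qed.

Lemma linear_unit0 (l : 'M[K]_(1, n)) : (2 <= n)%N ->
  exists2 u : 'cV[K]_n, dot u u = 1 & l *m u = 0.
Proof.
move=> n2; have : \rank (kermx l^T) != 0%N.
  rewrite mxrank_ker -lt0n subn_gt0; apply: leq_trans n2.
  by rewrite mxrank_tr ltnS rank_leq_row.
rewrite mxrank_eq0 => /rowV0Pn[v /sub_kermxP vl v0].
have hZ s (z : 'cV[K]_n) : (l *m (s *: z)) 0 0 = s ^+ 1 * (l *m z) 0 0.
  by rewrite -scalemxAr [LHS]mxE expr1.
have vT0 : v^T != 0.
  by apply: contra_neq v0 => /(congr1 trmx); rewrite trmxK trmx0.
have lv0 : (l *m v^T) 0 0 = 0 by rewrite -[l]trmxK -trmx_mul vl trmx0 mxE.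
have [u u1 hu] := homogeneous_unit0 hZ vT0 lv0.
exists u => //; apply/matrixP => i j; rewrite !ord1 hu mxE.
by [].
Qed.

End QuadraticMaps.

(** On the plane of the first two basis vectors the form is a binary quadratic, and the quadratic
    formula finds an isotropic vector. *)
Lemma quadratic_unit0 (K : numClosedFieldType) n (F : quadmap K n 1) : (2 <= n)%N ->
  exists2 u : 'cV[K]_n, dot u u = 1 & qhom2 F u = 0.
Proof.
case: n F => [|[|n']] // F _.
pose e1 : 'cV[K]_n'.+2 := delta_mx 0 0; pose e2 : 'cV[K]_n'.+2 := delta_mx 1 0.
suff [z z0 hz] : exists2 z, z != 0 & qhom2 F z 0 0 = 0.
  have hZ s (x : 'cV[K]_n'.+2) : qhom2 F (s *: x) 0 0 = s ^+ 2 * qhom2 F x 0 0.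
    by rewrite qhom2Z [LHS]mxE.
  have [u u1 hu] := homogeneous_unit0 hZ z0 hz.
  by exists u => //; apply/matrixP => i j; rewrite !ord1 hu mxE.
pose a := qhom2 F e1 0 0; pose b := qhom2_polar F e2 e1 0 0; pose c := qhom2 F e2 0 0.
have [a0|a0] := eqVneq a 0.
  exists e1 => //; apply/eqP => /matrixP/(_ 0 0)/eqP.
  by rewrite !mxE /= oner_eq0.
pose t := (- b + sqrtC (b ^+ 2 - 4 * a * c)) / (2 * a).
exists (e2 + t *: e1).
  apply/eqP => /matrixP/(_ 1 0)/eqP.
  by rewrite !mxE /= mulr0 addr0 oner_eq0.
rewrite qhom2D 2!mxE [X in _ + X + _]mxE [X in _ + X]mxE -/a -/b -/c /t.
have := sqrtCK (b ^+ 2 - 4 * a * c); set d := sqrtC _ => dE.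
by field: dE.
Qed.

(** * Maps sending spheres to spheres *)

Section SphereIdentities.
Variables (K : numClosedFieldType) (n : nat).
Implicit Types (u z : 'cV[K]_n).

Lemma dot_qevalZ m (F : quadmap K n m) t u : dot (qeval F (t *: u)) (qeval F (t *: u)) =
  dot (qcst F) (qcst F) + t * dot (qlin F *m u) (qcst F)
  + t^* * (dot (qlin F *m u) (qcst F))^*
  + t * t^* * dot (qlin F *m u) (qlin F *m u)
  + t ^+ 2 * dot (qhom2 F u) (qcst F)
  + t^* ^+ 2 * (dot (qhom2 F u) (qcst F))^*
  + t ^+ 2 * t^* * dot (qhom2 F u) (qlin F *m u)
  + t * t^* ^+ 2 * (dot (qhom2 F u) (qlin F *m u))^*
  + t ^+ 2 * t^* ^+ 2 * dot (qhom2 F u) (qhom2 F u).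
Proof. by rewrite qevalZ !(dotDl, dotDr, dotZl, dotZr) -!dotC rmorphXn /=; ring. Qed.

Variables (N : nat) (p : quadmap K n N) (q : quadmap K n 1).

(** The circle of the points s w u with |w| = 1 stays on the sphere of radius s. Along it the
    identity is a trigonometric polynomial of degree 2 in w; the conclusions are its coefficients at
    w^2, w and 1, the other two being their conjugates. *)
Lemma sphere_fourier (c s : K) u : s^* = s -> s != 0 -> c^* = c -> dot u u = 1 ->
  (forall v, dot v v = 1 ->
     dot (qeval p (s *: v)) (qeval p (s *: v)) =
     c * dot (qeval q (s *: v)) (qeval q (s *: v))) ->
  [/\ dot (qhom2 p u) (qcst p) = c * dot (qhom2 q u) (qcst q),
      dot (qlin p *m u) (qcst p) + s ^+ 2 * dot (qhom2 p u) (qlin p *m u) =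
      c * (dot (qlin q *m u) (qcst q) + s ^+ 2 * dot (qhom2 q u) (qlin q *m u))
    & dot (qcst p) (qcst p) + s ^+ 2 * dot (qlin p *m u) (qlin p *m u)
      + s ^+ 4 * dot (qhom2 p u) (qhom2 p u) =
      c * (dot (qcst q) (qcst q) + s ^+ 2 * dot (qlin q *m u) (qlin q *m u)
      + s ^+ 4 * dot (qhom2 q u) (qhom2 q u))].
Proof.
move=> sR s0 cR u1 H.
have H' w : w * w^* = 1 -> dot (qeval p ((s * w) *: u)) (qeval p ((s * w) *: u)) =
     c * dot (qeval q ((s * w) *: u)) (qeval q ((s * w) *: u)).
  by move=> w1; rewrite -scalerA H // dotZl dotZr u1 mulr1.
move: H'.
pose X20 := dot (qhom2 p u) (qcst p) - c * dot (qhom2 q u) (qcst q).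
pose X10 := dot (qlin p *m u) (qcst p) - c * dot (qlin q *m u) (qcst q).
pose X21 := dot (qhom2 p u) (qlin p *m u) - c * dot (qhom2 q u) (qlin q *m u).
pose X00 := dot (qcst p) (qcst p) - c * dot (qcst q) (qcst q).
pose X11 := dot (qlin p *m u) (qlin p *m u) - c * dot (qlin q *m u) (qlin q *m u).
pose X22 := dot (qhom2 p u) (qhom2 p u) - c * dot (qhom2 q u) (qhom2 q u).
move=> H'.
have [] := @trig2_eq0 K (s ^+ 2 * X20^*) (s * X10^* + s ^+ 3 * X21^*)
    (X00 + s ^+ 2 * X11 + s ^+ 4 * X22) (s * X10 + s ^+ 3 * X21) (s ^+ 2 * X20).
  move=> w w1; have := H' w w1; rewrite !dot_qevalZ rmorphM /= sR => /eqP.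
  rewrite -subr_eq0 => /eqP /(congr1 (fun y => w ^+ 2 * y)); rewrite mulr0 => <-.
  rewrite /X20 /X10 /X21 /X00 /X11 /X22 !(rmorphB, rmorphM) /= cR.
  by ring: w1.
move=> _ _ e0 e1 e2; split; apply/eqP; rewrite -subr_eq0; apply/eqP.
- by apply: (mulfI (expf_neq0 2 s0)); rewrite mulr0 -[RHS]e2 /X20; ring.
- by apply: (mulfI s0); rewrite mulr0 -[RHS]e1 /X10 /X21; ring.
- by rewrite -[RHS]e0 /X00 /X11 /X22; ring.
Qed.

Lemma dot1_eq0 (a b : 'cV[K]_1) : dot a b = 0 -> a = 0 \/ b = 0.
Proof.
rewrite /dot big_ord1 => /eqP; rewrite mulf_eq0 conjC_eq0 => /orP[] /eqP h.
  by left; apply/matrixP => i j; rewrite !ord1 h mxE.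
by right; apply/matrixP => i j; rewrite !ord1 h mxE.
Qed.

Lemma homogeneous_eq (g h : 'cV[K]_n -> K) d :
  (forall s z, s^* = s -> g (s *: z) = s ^+ d * g z) ->
  (forall s z, s^* = s -> h (s *: z) = s ^+ d * h z) ->
  (forall u, dot u u = 1 -> g u = h u) -> (0 < d)%N -> forall z, g z = h z.
Proof.
move=> gZ hZ gh d0 z; have [->|/normalize[s [u [s0 _ -> u1]]]] := eqVneq z 0.
  rewrite -(scale0r 0) gZ ?hZ ?rmorph0 //.
  by rewrite !expr0n eqn0Ngt d0 /= !mul0r.
have sR : s^* = s by apply/CrealP/ger0_real/ltW.
by rewrite gZ // hZ // gh.
Qed.

Variables (r rho2 : K).
Hypotheses (n2 : (2 <= n)%N) (r01 : 0 < r < 1) (rho01 : 0 < rho2 < 1).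

Let r0 : r != 0. Proof. by apply: lt0r_neq0; case/andP: r01. Qed.
Let rR : r^* = r. Proof. by apply/CrealP/ger0_real/ltW; case/andP: r01. Qed.
Let r2_lt1 : r ^+ 2 < 1.
Proof. by case/andP: r01 => ra rb; rewrite expr_lt1 ?rb ?ltW. Qed.
Let r21 : 1 - r ^+ 2 != 0.
Proof. by rewrite subr_eq0 eq_sym lt_eqF. Qed.

Lemma real_conj (c : K) : c = 1 \/ c = rho2 -> c^* = c.
Proof.
case=> ->; first by rewrite rmorph1.
by apply/CrealP/ger0_real/ltW; case/andP: rho01.
Qed.

Let s := (1 + r) / 2.
Let s_lt : r < s < 1.
Proof.
case/andP: r01 => ra rb; rewrite /s ltr_pdivlMr ?ltr0n // ltr_pdivrMr ?ltr0n //.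
by rewrite mul1r mulr_natr mulr2n ltrD2r rb mulr2n ltrD2l.
Qed.
Let s_real : s^* = s.
Proof. by rewrite /s fmorph_div rmorphD rmorph1 /= rR rmorph_nat. Qed.
Let s_ann u : dot u u = 1 -> r ^+ 2 < dot (s *: u) (s *: u) < 1.
Proof.
move=> u1; rewrite dotZl dotZr u1 s_real mulr1 -expr2.
case/andP: r01 => ra rb; case/andP: s_lt => sa sb.
have s0 : 0 <= s by apply/ltW/(lt_trans ra).
by rewrite expr_lt1 ?sb ?s0 // andbT ltrXn2r ?sa ?(ltW ra).
Qed.

Variables (c1 cr : K).
Hypotheses (c1E : c1 = 1 \/ c1 = rho2) (crE : cr = 1 \/ cr = rho2).
Hypothesis outer : forall v, dot v v = 1 ->
  dot (qeval p v) (qeval p v) = c1 * dot (qeval q v) (qeval q v).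
Hypothesis inner : forall v, dot v v = 1 ->
  dot (qeval p (r *: v)) (qeval p (r *: v)) =
  cr * dot (qeval q (r *: v)) (qeval q (r *: v)).

Let fourier1 u (u1 : dot u u = 1) :=
  @sphere_fourier c1 1 u (rmorph1 _) (oner_neq0 _) (real_conj c1E) u1
  (fun v v1 => eq_ind_r (fun z => dot (qeval p z) (qeval p z) =
     c1 * dot (qeval q z) (qeval q z)) (outer v1) (scale1r v)).
Let fourierr u (u1 : dot u u = 1) :=
  @sphere_fourier cr r u rR r0 (real_conj crE) u1 inner.

(** If the constants agree, the zero frequencies at radii 1 and r express the defects of the
    quadratic and linear parts as [X0] / r^2 and - (1 + r^2) [X0] / r^2. At a unit vector where the
    quadratic part of q vanishes the first is a squared norm, and where the linear part vanishes so
    is the second; hence [X0] = 0. Then all coefficients along u vanish, and |p|^2 = c1 |q|^2 also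
    holds at a point inside the annulus, against the strict inequalities. *)
Lemma sphere_constants_neq :
  (forall z, r ^+ 2 < dot z z < 1 ->
     rho2 * dot (qeval q z) (qeval q z) < dot (qeval p z) (qeval p z)
     < dot (qeval q z) (qeval q z)) -> c1 != cr.
Proof.
move=> hne; apply/eqP => c1r.
pose X0 := dot (qcst p) (qcst p) - c1 * dot (qcst q) (qcst q).
have key u : dot u u = 1 ->
    r ^+ 2 * (dot (qhom2 p u) (qhom2 p u) - c1 * dot (qhom2 q u) (qhom2 q u)) = X0 /\
    r ^+ 2 * (dot (qlin p *m u) (qlin p *m u) - c1 * dot (qlin q *m u) (qlin q *m u))
      = - (1 + r ^+ 2) * X0.
  move=> u1; have [_ _ a] := fourier1 u1; have [_ _ b] := fourierr u1.
  rewrite -c1r in b; rewrite !expr1n !mul1r in a.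
  have h : r ^+ 2 * (dot (qhom2 p u) (qhom2 p u) - c1 * dot (qhom2 q u) (qhom2 q u)) = X0.
    apply: (mulfI r21); apply/eqP; rewrite -subr_eq0; apply/eqP.
    transitivity (r ^+ 2 * (dot (qcst p) (qcst p) + dot (qlin p *m u) (qlin p *m u)
      + dot (qhom2 p u) (qhom2 p u)) - (dot (qcst p) (qcst p)
      + r ^+ 2 * dot (qlin p *m u) (qlin p *m u)
      + r ^+ 4 * dot (qhom2 p u) (qhom2 p u))
      - (r ^+ 2 * (c1 * (dot (qcst q) (qcst q) + dot (qlin q *m u) (qlin q *m u)
      + dot (qhom2 q u) (qhom2 q u))) - c1 * (dot (qcst q) (qcst q)
      + r ^+ 2 * dot (qlin q *m u) (qlin q *m u)
      + r ^+ 4 * dot (qhom2 q u) (qhom2 q u)))); first by rewrite /X0; ring.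
    by rewrite a b; ring.
  split=> //.
  transitivity (r ^+ 2 * ((dot (qcst p) (qcst p) + dot (qlin p *m u) (qlin p *m u)
      + dot (qhom2 p u) (qhom2 p u)) - (c1 * (dot (qcst q) (qcst q) + dot (qlin q *m u) (qlin q *m u)
      + dot (qhom2 q u) (qhom2 q u)))) - r ^+ 2 * X0 -
    r ^+ 2 * (dot (qhom2 p u) (qhom2 p u) - c1 * dot (qhom2 q u) (qhom2 q u))).
    by rewrite /X0; ring.
  by rewrite a h; ring.
have rr0 : 0 < r ^+ 2 by rewrite exprn_gt0 //; case/andP: r01.
have X0R : X0 \is Num.real.
  rewrite rpredB // ?rpredM ?ger0_real ?dot_ge0 //.
  by case: c1E => -> //; apply: ltW; case/andP: rho01.
case: (real_ltgt0P X0R) => [X0p|X0n|X00].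
- have [u u1 hu] := linear_unit0 (qlin q) n2; have [_] := key u u1.
  rewrite hu dot0l mulr0 subr0 => h.
  have pos : 0 < (1 + r ^+ 2) * X0 by rewrite mulr_gt0 // addr_gt0.
  have : 0 <= - (1 + r ^+ 2) * X0 by rewrite -h mulr_ge0 ?dot_ge0 // ltW.
  by rewrite mulNr oppr_ge0 => /(lt_le_trans pos); rewrite ltxx.
- have [u u1 hu] := quadratic_unit0 q n2; have [h _] := key u u1.
  rewrite hu dot0l mulr0 subr0 in h.
  have : 0 <= X0 by rewrite -h mulr_ge0 ?dot_ge0 // ltW.
  by move=> /le_lt_trans/(_ X0n); rewrite ltxx.
have [u u1 _] := linear_unit0 (0 : 'M[K]_(1, n)) n2.
have [e2 e1 _] := fourier1 u1; have [_ e1' _] := fourierr u1.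
have [h2 h1] := key u u1; rewrite X00 in h2 h1.
have h2' : dot (qhom2 p u) (qhom2 p u) = c1 * dot (qhom2 q u) (qhom2 q u).
  by apply/eqP; rewrite -subr_eq0; apply/eqP/(mulfI (lt0r_neq0 rr0)); rewrite h2 mulr0.
have h1' : dot (qlin p *m u) (qlin p *m u) = c1 * dot (qlin q *m u) (qlin q *m u).
  by apply/eqP; rewrite -subr_eq0; apply/eqP/(mulfI (lt0r_neq0 rr0)); rewrite h1 !mulr0.
have h0' : dot (qcst p) (qcst p) = c1 * dot (qcst q) (qcst q).
  by apply/eqP; rewrite -subr_eq0; apply/eqP.
rewrite -c1r in e1'; rewrite !expr1n !mul1r in e1.
have h21 : dot (qhom2 p u) (qlin p *m u) = c1 * dot (qhom2 q u) (qlin q *m u).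
  apply: (mulfI r21); apply/eqP; rewrite -subr_eq0; apply/eqP.
  transitivity ((dot (qlin p *m u) (qcst p) + dot (qhom2 p u) (qlin p *m u))
   - (dot (qlin p *m u) (qcst p) + r ^+ 2 * dot (qhom2 p u) (qlin p *m u))
   - (c1 * (dot (qlin q *m u) (qcst q) + dot (qhom2 q u) (qlin q *m u)) -
      c1 * (dot (qlin q *m u) (qcst q) + r ^+ 2 * dot (qhom2 q u) (qlin q *m u)))).
    by ring.
  by rewrite e1 e1'; ring.
have h10 : dot (qlin p *m u) (qcst p) = c1 * dot (qlin q *m u) (qcst q).
  by move/eqP: e1; rewrite h21 mulrDr (inj_eq (addIr _)) => /eqP.
have E : dot (qeval p (s *: u)) (qeval p (s *: u)) = c1 * dot (qeval q (s *: u)) (qeval q (s *: u)).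
  rewrite !dot_qevalZ h0' h10 h1' e2 h21 h2' !rmorphM /= (real_conj c1E); ring.
have := hne _ (s_ann u1); rewrite E.
by case: c1E => ->; rewrite ?mul1r ltxx ?andbF.
Qed.

Hypothesis hneq : c1 != cr.

Let nz : c1 - cr != 0. Proof. by rewrite subr_eq0. Qed.

(** If q(0) = 0, eliminating the pairing of the quadratic and linear parts of p from the
    frequency-one relations at the two radii gives a cubic identity. Polarized, it reads <q2 z, q1
    w> = k <p1 z, p0> <z, w>, where the indices denote homogeneous parts. It produces a unit vector
    killed by q1 and q2, so q vanishes on a line that meets the annulus. Once q(0) is nonzero, the
    frequency-two relations give (c1 - cr) <q2 u, q0> = 0, which kills q2. *)
Lemma sphere_denominator :
  (forall z, r ^+ 2 < dot z z < 1 -> qeval q z != 0) ->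
  qcst q != 0 /\ forall z, qhom2 q z = 0.
Proof.
move=> hq.
have n00 : qcst q != 0.
  apply/eqP => q0.
  pose k := (r ^+ 2 - 1) / (r ^+ 2 * (c1 - cr)).
  have k0 : k != 0 by rewrite mulf_neq0 ?invr_eq0 ?mulf_neq0 ?expf_neq0 // -oppr_eq0 opprB.
  have E u : dot u u = 1 ->
      dot (qhom2 q u) (qlin q *m u) = k * (dot u u * dot (qlin p *m u) (qcst p)).
    move=> u1; have [_ a _] := fourier1 u1; have [_ b _] := fourierr u1.
    rewrite q0 !dot0r !add0r !expr1n !mul1r in a b; rewrite u1 mul1r /k.
    set Z := dot (qhom2 q u) _ in a b *; set Y := dot (qlin p *m u) (qcst p) in a b *.
    set T := dot (qhom2 p u) _ in a b.
    suff -> : Z = ((r ^+ 2 - 1) * Y) / (r ^+ 2 * (c1 - cr)) by rewrite mulrAC.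
    apply: (canRL (mulfK _)); first by rewrite mulf_neq0 ?expf_neq0.
    apply/eqP; rewrite -subr_eq0; apply/eqP.
    transitivity ((Y + r ^+ 2 * T - cr * (r ^+ 2 * Z)) - r ^+ 2 * (Y + T - c1 * Z)).
      by ring.
    by rewrite a b; ring.
  have E' z : dot (qhom2 q z) (qlin q *m z) - k * dot (dot (qlin p *m z) (qcst p) *: z) z = 0.
    apply/eqP; rewrite subr_eq0 dotZl; apply/eqP.
    rewrite [X in _ = _ * X]mulrC.
    apply: (@homogeneous_eq (fun z => dot (qhom2 q z) (qlin q *m z))
      (fun z => k * (dot z z * dot (qlin p *m z) (qcst p))) 3) => //.
      move=> t x tR; rewrite qhom2Z -scalemxAr dotZl dotZr tR; ring.
    by move=> t x tR; rewrite -scalemxAr !(dotZl, dotZr) tR; ring.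
  have hl m (A : 'M[K]_(m, n)) : quadratic_on_lines (fun z => A *m z).
    move=> z v; exists (A *m z), (A *m v), 0 => t.
    by rewrite mulmxDr -scalemxAr scaler0 addr0.
  have := @polarization K n (fun z w => dot (qhom2 q z) (qlin q *m w)
     - k * dot (dot (qlin p *m z) (qcst p) *: z) w).
  move=> /(_ _ E') P.
  have {}P : forall z w, dot (qhom2 q z) (qlin q *m w)
     - k * dot (dot (qlin p *m z) (qcst p) *: z) w = 0.
    apply: P => z v.
    have hF : quadratic_on_lines (fun z => dot (qlin p *m z) (qcst p) *: z).
      move=> x y; exists (dot (qlin p *m x) (qcst p) *: x),
        (dot (qlin p *m x) (qcst p) *: y + dot (qlin p *m y) (qcst p) *: x),
        (dot (qlin p *m y) (qcst p) *: y) => t.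
      rewrite mulmxDr -scalemxAr dotDl dotZl.
      by apply/matrixP => i j; rewrite !mxE; ring.
    have hid : quadratic_on_lines (fun z : 'cV[K]_n => z).
      by move=> x y; exists x, y, 0 => t; rewrite scaler0 addr0.
    have := kernel_on_linesD (kernel_on_lines_dot (@qhom2_on_lines _ _ _ q) (hl _ (qlin q)))
      (kernel_on_linesZ (- k) (kernel_on_lines_dot hF hid)).
    move=> /(_ z v)[c Ec]; exists c => x y; rewrite -Ec; ring.
  have [u u1 hu] := linear_unit0 (qlin q) n2.
  have hp : dot (qlin p *m u) (qcst p) = 0.
    have := P u u; rewrite hu dot0r dotZl u1 mulr1 add0r => /eqP.
    by rewrite oppr_eq0 mulf_eq0 (negPf k0) /= => /eqP.
  have [v v1 [hv1 hv2]] : exists2 v, dot v v = 1 & qlin q *m v = 0 /\ qhom2 q v = 0.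
    have [h2|h2] := eqVneq (qhom2 q u) 0; first by exists u.
    have l0 (w : 'cV[K]_n) : qlin q *m w = 0.
      have := P u w; rewrite hp scale0r dot0l mulr0 subr0 => /dot1_eq0[] // h.
      by rewrite h eqxx in h2.
    by have [v v1 hv] := quadratic_unit0 q n2; exists v.
  have := hq _ (s_ann v1).
  by rewrite qevalZ q0 hv1 hv2 !scaler0 !addr0 eqxx.
split=> // z.
have E z' : dot (qhom2 q z') (qcst q) = 0.
  apply: (@homogeneous_eq (fun z => dot (qhom2 q z) (qcst q)) (fun=> 0) 2) => //.
  - by move=> t x _; rewrite qhom2Z dotZl.
  - by move=> *; rewrite mulr0.
  move=> u u1; have [a _ _] := fourier1 u1; have [b _ _] := fourierr u1.
  by apply: (mulfI nz); rewrite mulr0 mulrBl -a -b subrr.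
by case: (dot1_eq0 (E z)) => // h; rewrite h eqxx in n00.
Qed.

Hypotheses (q01 : qcst q = const_mx 1) (q20 : forall z, qhom2 q z = 0).

Lemma dot_scalar (a b : K) : dot (const_mx a : 'cV_1) (const_mx b) = a * b^*.
Proof. by rewrite /dot big_ord1 !mxE. Qed.

(** Before c1 = 1 is known, b has to be taken as (c1 - cr) / (1 - r^2), and Q is read off from
    |p(0)|^2. At a unit vector killed by l the squared norm of the quadratic part of p is Q and that
    of the linear part is b - Q (1 + r^2); so Q >= 0, then b >= 0, and cr <= c1 leaves only the pair
    (1, [rho2]). *)
Lemma sphere_normal_form : c1 = 1 /\
  let b := (1 - rho2) / (1 - r ^+ 2) in
  exists Q : K, 0 <= Q /\ forall z, dot (qeval p z) (qeval p z) =
    (1 - b + b * dot z z) * dot (qeval q z) (qeval q z)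
    + Q * (1 - dot z z) * (r ^+ 2 - dot z z).
Proof.
have rr0 : r ^+ 2 != 0 by rewrite expf_neq0.
pose l z := (qlin q *m z) 0 0.
have qlE z : qlin q *m z = const_mx (l z) by apply/matrixP => i j; rewrite !ord1 [RHS]mxE.
pose b := (c1 - cr) / (1 - r ^+ 2).
pose P0 := dot (qcst p) (qcst p).
pose Q := (b - c1 + P0) / r ^+ 2.
have bE : c1 - cr = b * (1 - r ^+ 2) by rewrite divfK.
have crE' : cr = c1 - b * (1 - r ^+ 2) by rewrite -bE; ring.
have P0E : P0 = c1 - b + Q * r ^+ 2 by rewrite /Q divfK //; ring.
have rel u : dot u u = 1 ->
  [/\ dot (qhom2 p u) (qcst p) = 0,
      dot (qhom2 p u) (qlin p *m u) = b * l u,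
      dot (qlin p *m u) (qcst p) = (c1 - b) * l u,
      dot (qhom2 p u) (qhom2 p u) = b * (l u * (l u)^*) + Q
    & dot (qlin p *m u) (qlin p *m u) =
      (c1 - b) * (l u * (l u)^*) + b - Q * (1 + r ^+ 2)].
  move=> u1; have [a2 a1 a0] := fourier1 u1; have [_ b1 b0] := fourierr u1.
  rewrite !q20 !dot0l ?mulr0 ?addr0 in a2 a1 a0 b1 b0.
  rewrite !q01 !qlE !dot_scalar !rmorph1 ?expr1n ?mul1r ?mulr1 in a2 a1 a0 b1 b0.
  rewrite -/P0 in a0 b0.
  have e21 : dot (qhom2 p u) (qlin p *m u) = b * l u.
    apply: (mulfI r21).
    transitivity ((dot (qlin p *m u) (qcst p) + dot (qhom2 p u) (qlin p *m u)) -
      (dot (qlin p *m u) (qcst p) + r ^+ 2 * dot (qhom2 p u) (qlin p *m u))).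
      by ring.
    by rewrite a1 b1 crE'; ring.
  have e22 : dot (qhom2 p u) (qhom2 p u) = b * (l u * (l u)^*) + Q.
    apply: (mulfI (mulf_neq0 rr0 r21)).
    transitivity (r ^+ 2 * (P0 + dot (qlin p *m u) (qlin p *m u) + dot (qhom2 p u) (qhom2 p u))
      - (P0 + r ^+ 2 * dot (qlin p *m u) (qlin p *m u) + r ^+ 4 * dot (qhom2 p u) (qhom2 p u))
      + (1 - r ^+ 2) * P0); first by ring.
    by rewrite a0 b0 P0E crE'; ring.
  split=> //.
    by apply/eqP; rewrite -(inj_eq (addIr (b * l u))) -{1}e21 a1; apply/eqP; ring.
  apply/eqP; rewrite -(inj_eq (addrI P0)) -(inj_eq (addIr (dot (qhom2 p u) (qhom2 p u)))).
  by rewrite a0 e22 P0E; apply/eqP; ring.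
have [u u1 hu] := linear_unit0 (qlin q) n2.
have lu : l u = 0 by rewrite /l hu mxE.
have [_ _ _ h2 h1] := rel u u1.
rewrite lu mul0r mulr0 add0r in h2; rewrite lu mul0r mulr0 add0r in h1.
have Q0 : 0 <= Q by rewrite -h2 dot_ge0.
have b0 : 0 <= b.
  have : 0 <= b - Q * (1 + r ^+ 2) by rewrite -h1 dot_ge0.
  rewrite subr_ge0; apply: le_trans; rewrite mulr_ge0 // addr_ge0 // exprn_ge0 //.
  by apply: ltW; case/andP: r01.
have r2p : 0 < 1 - r ^+ 2 by rewrite subr_gt0.
have c1r : cr <= c1.
  by move: b0; rewrite /b pmulr_lge0 ?invr_gt0 // subr_ge0.
have [c1E' crE1] : c1 = 1 /\ cr = rho2.
  case/andP: rho01 => _ rho1.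
  case: c1E crE c1r hneq => [->|->] [->|->] //; rewrite ?eqxx // => h _.
  by have := le_lt_trans h rho1; rewrite ltxx.
split=> //; rewrite -crE1 -[X in (X - cr) / _]c1E' -/b.
exists Q; split=> // z.
have main t v : t^* = t -> dot v v = 1 ->
    dot (qeval p (t *: v)) (qeval p (t *: v)) =
    (1 - b + b * dot (t *: v) (t *: v)) * dot (qeval q (t *: v)) (qeval q (t *: v))
    + Q * (1 - dot (t *: v) (t *: v)) * (r ^+ 2 - dot (t *: v) (t *: v)).
  move=> tR v1; have [e20 e21 e10 e22 e11] := rel v v1.
  rewrite !dot_qevalZ !q20 dotZl dotZr v1 !dot0l !rmorph0 e20 e21 e10 e22 e11.
  have bR : b^* = b by apply/CrealP/ger0_real.
  have cj1 : (b * l v)^* = b * (l v)^* by rewrite rmorphM /= bR.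
  have cj2 : ((c1 - b) * l v)^* = (c1 - b) * (l v)^*.
    by rewrite rmorphM rmorphB /= bR (real_conj c1E).
  rewrite cj1 cj2 !q01 !qlE !dot_scalar tR !mul1r !rmorph1.
  by rewrite -/P0 P0E c1E'; ring.
have [->|/normalize[t [v [t0 _ -> v1]]]] := eqVneq z 0.
  by rewrite -(scale0r u) main ?rmorph0.
by rewrite main //; apply/CrealP/ger0_real/ltW.
Qed.

End SphereIdentities.

Lemma poly_inj_eq0 (K : idomainType) (f : nat -> K) (P : {poly K}) : injective f ->
  (forall k : nat, P.[f k] = 0) -> P = 0.
Proof.
move=> finj H; apply/eqP/negP => /negP P0.
pose rs := [seq f k | k <- iota 0 (size P)].
have rsP : all (root P) rs by apply/allP => x /mapP[k _ ->]; rewrite /root H.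
have rsU : uniq rs by rewrite map_inj_uniq ?iota_uniq.
by have := max_poly_roots P0 rsP rsU; rewrite size_map size_iota ltnn.
Qed.

Lemma poly_nat_eq0 (K : numDomainType) (P : {poly K}) :
  (forall k : nat, P.[k%:R] = 0) -> P = 0.
Proof. by apply: poly_inj_eq0 => i j /eqP; rewrite eqr_nat => /eqP. Qed.

(** * Polynomials in a real parameter and irreducibility of the sphere *)

Section RealPolynomialFunctions.
Variable K : numClosedFieldType.

(** Agreement is asked only at real t, where conjugating the value amounts to conjugating the
    coefficients; Hermitian products of polynomial curves thereby stay polynomial. *)
Definition realpoly (g : K -> K) := exists P : {poly K}, forall t, t^* = t -> g t = P.[t].

Lemma realpoly_cst a : realpoly (fun=> a).
Proof. by exists a%:P => t _; rewrite hornerC. Qed.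

Lemma realpoly_id : realpoly id.
Proof. by exists 'X => t _; rewrite hornerX. Qed.

Lemma realpolyD g h : realpoly g -> realpoly h -> realpoly (fun t => g t + h t).
Proof.
by move=> [P gP] [Q hQ]; exists (P + Q) => t tR; rewrite hornerD gP ?hQ.
Qed.

Lemma realpolyM g h : realpoly g -> realpoly h -> realpoly (fun t => g t * h t).
Proof.
by move=> [P gP] [Q hQ]; exists (P * Q) => t tR; rewrite hornerM gP ?hQ.
Qed.

Lemma realpolyN g : realpoly g -> realpoly (fun t => - g t).
Proof. by move=> [P gP]; exists (- P) => t tR; rewrite hornerN gP. Qed.

Lemma realpolyJ g : realpoly g -> realpoly (fun t => (g t)^*).
Proof.
move=> [P gP]; exists (map_poly Num.conj P) => t tR.
by rewrite gP // -[in RHS]tR horner_map.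
Qed.

Lemma realpoly_sum (I : finType) (g : I -> K -> K) :
  (forall i, realpoly (g i)) -> realpoly (fun t => \sum_i g i t).
Proof.
move=> /fin_all_exists[P gP]; exists (\sum_i P i) => t tR.
by rewrite horner_sum; apply: eq_bigr => i _; apply: gP.
Qed.

Lemma realpoly_mul_eq0 g h : realpoly g -> realpoly h ->
  (forall t, t^* = t -> g t * h t = 0) ->
  (forall t, t^* = t -> g t = 0) \/ (forall t, t^* = t -> h t = 0).
Proof.
move=> [P gP] [Q hQ] H.
have : P * Q = 0.
  apply: poly_nat_eq0 => k; rewrite hornerM -gP ?rmorph_nat // -hQ ?rmorph_nat //.
  by rewrite H ?rmorph_nat.
move/eqP; rewrite mulf_eq0 => /orP[] /eqP E; [left|right] => t tR.
  by rewrite gP // E horner0.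
by rewrite hQ // E horner0.
Qed.

End RealPolynomialFunctions.

Section SphereIrreducible.
Variables (K : numClosedFieldType) (n : nat).

Definition homogenized m (F : quadmap K n m) (s : K) (z : 'cV[K]_n) : 'cV[K]_m :=
  s ^+ 2 *: qcst F + s *: (qlin F *m z) + qhom2 F z.

Lemma homogenizedE m (F : quadmap K n m) s z : s != 0 ->
  homogenized F s z = s ^+ 2 *: qeval F (s^-1 *: z).
Proof.
move=> s0; rewrite qevalZ /homogenized; apply/matrixP => i j; rewrite !mxE.
by field.
Qed.

Lemma realpoly_homogenized m (F : quadmap K n m) (s : K -> K) (z : K -> 'cV[K]_n) :
  realpoly s -> (forall i, realpoly (fun t => z t i 0)) ->
  forall j, realpoly (fun t => homogenized F (s t) (z t) j 0).
Proof.
move=> hs hz j.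
have -> : (fun t => homogenized F (s t) (z t) j 0) =
  fun t => s t * s t * qcst F j 0 + s t * (\sum_i qlin F j i * z t i 0)
  + \sum_i (\sum_k z t k 0 * qform F j k i) * z t i 0.
  apply/funext => t; rewrite !mxE -expr2; congr (_ + _ + _).
  apply: eq_bigr => i _; rewrite !mxE; congr (_ * _).
  by apply: eq_bigr => k _; rewrite !mxE.
apply: realpolyD; first apply: realpolyD.
- by apply: realpolyM (realpoly_cst _); apply: realpolyM.
- apply: realpolyM => //; apply: realpoly_sum => i.
  by apply: realpolyM (hz i); apply: realpoly_cst.
apply: realpoly_sum => i; apply: realpolyM (hz i); apply: realpoly_sum => k.
by apply: realpolyM (realpoly_cst _).
Qed.

Lemma realpoly_dot m (F G : K -> 'cV[K]_m) :
  (forall i, realpoly (fun t => F t i 0)) -> (forall i, realpoly (fun t => G t i 0)) ->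
  realpoly (fun t => dot (F t) (G t)).
Proof.
move=> hF hG; apply: realpoly_sum => i; apply: realpolyM (hF i) _.
exact: realpolyJ.
Qed.

Variables (N : nat) (p : quadmap K n N) (q : quadmap K n 1) (c1 c2 : K).

Let defect c z := dot (qeval p z) (qeval p z) - c * dot (qeval q z) (qeval q z).

Hypothesis defects : forall u, dot u u = 1 -> defect c1 u * defect c2 u = 0.

(* The reflection of [u] across the line of [u + t e] parametrizes a circle of
   the sphere rationally in [t]; clearing denominators turns the defects along
   it into polynomials with zero product. *)
Let defects_on_circle (u v e : 'cV[K]_n) : dot u u = 1 ->
  let d := u + e in
  dot d d != 0 -> (dot u d + dot d u) *: d - dot d d *: u = dot d d *: v ->
  defect c1 u = 0 \/ defect c2 v = 0.
Proof.
move=> u1 d d0 dv.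
pose D (t : K) := u + t *: e; pose M t := dot (D t) (D t).
pose S t := dot u (D t) + dot (D t) u.
pose Z t := S t *: D t - M t *: u.
pose g c t := dot (homogenized p (M t) (Z t)) (homogenized p (M t) (Z t))
  - c * dot (homogenized q (M t) (Z t)) (homogenized q (M t) (Z t)).
have MR t : (M t)^* = M t by rewrite /M dot_conj.
have SR t : (S t)^* = S t by rewrite /S rmorphD /= -!dotC addrC.
have ZZ t : dot (Z t) (Z t) = M t ^+ 2.
  rewrite /Z !(dotBl, dotBr, dotZl, dotZr) u1 MR SR.
  by rewrite -/(M t) /S; ring.
have gE c t : M t != 0 -> g c t = M t ^+ 4 * defect c ((M t)^-1 *: Z t).
  move=> M0; rewrite /g !homogenizedE // !dotZl !dotZr rmorphXn /= MR /defect.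
  ring.
have Dp i : realpoly (fun t => D t i 0).
  have -> : (fun t => D t i 0) = (fun t => u i 0 + t * e i 0).
    by apply/funext => t; rewrite !mxE.
  apply: realpolyD; first exact: realpoly_cst.
  by apply: realpolyM (realpoly_cst _); apply: realpoly_id.
have Mp : realpoly M by apply: realpoly_dot.
have Sp : realpoly S.
  by apply: realpolyD; apply: realpoly_dot => // i; apply: realpoly_cst.
have Zp i : realpoly (fun t => Z t i 0).
  have -> : (fun t => Z t i 0) = (fun t => S t * D t i 0 + - (M t * u i 0)).
    by apply/funext => t; rewrite !mxE.
  apply: realpolyD; first exact: realpolyM.
  by apply: realpolyN; apply: realpolyM (realpoly_cst _).
have gp c : realpoly (g c).
  apply: realpolyD; first by apply: realpoly_dot; apply: realpoly_homogenized.
  apply: realpolyN; apply: realpolyM (realpoly_cst _) _.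
  by apply: realpoly_dot; apply: realpoly_homogenized.
have [t _|g1|g2] := realpoly_mul_eq0 (gp c1) (gp c2).
(* Where the denominator M vanishes so does Z, and the homogenized maps are zero there. *)
- have [M0|M0] := eqVneq (M t) 0.
    suff -> : g c1 t = 0 by rewrite mul0r.
    have Z0 : Z t = 0 by apply/eqP; rewrite -dot_eq0 ZZ M0 expr0n.
    have h0 m (F : quadmap K n m) : homogenized F (M t) (Z t) = 0.
      rewrite /homogenized Z0 M0 expr0n !scale0r !add0r.
      by rewrite -(scale0r 0) qhom2Z expr0n scale0r.
    by rewrite /g !h0 !dot0l mulr0 subr0.
  rewrite !gE // mulrACA defects ?mulr0 // dotZl dotZr ZZ fmorphV /= MR.
  by field.
- left; have := g1 0 (rmorph0 _).
  have M0 : M 0 = 1 by rewrite /M /D scale0r addr0.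
  have Z0 : Z 0 = u.
    rewrite /Z M0 /S /D scale0r addr0 u1.
    by apply/matrixP => i j; rewrite !mxE; ring.
  by rewrite gE M0 ?oner_eq0 // Z0 invr1 scale1r expr1n mul1r.
right; have := g2 1 (rmorph1 _).
have D1 : D 1 = d by rewrite /D scale1r.
have Z1 : Z 1 = M 1 *: v by rewrite /Z /S /M D1.
have M0 : M 1 != 0 by rewrite /M D1.
rewrite gE // Z1 scalerA mulVf // scale1r => /eqP.
by rewrite mulf_eq0 expf_eq0 (negPf M0) /= => /eqP.
Qed.

(** It suffices to treat two points u and v at a time: if the first defect is nonzero at one u, then
    the second vanishes at every v. The curve through u and v carries both defects as polynomials
    with product zero. *)
Lemma sphere_defect : (forall u, dot u u = 1 -> defect c1 u = 0) \/
  (forall u, dot u u = 1 -> defect c2 u = 0).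
Proof.
suff H u v : dot u u = 1 -> dot v v = 1 -> defect c1 u = 0 \/ defect c2 v = 0.
  have [h|h] := pselect (forall u, dot u u = 1 -> defect c1 u = 0); first by left.
  right => v v1; apply: contrapT => hv; apply: h => u u1.
  by have [] := H u v u1 v1.
move=> u1 v1; have [vE|vE] := eqVneq v (- u).
  (* For v = - u the direction u + v degenerates. The curve is sent through i u instead: the real
     part of <u, i u> is zero, so reflecting u across that line gives - u. *)
  apply: (@defects_on_circle u v ('i *: u - u)) => //=.
    by rewrite addrC subrK dotZl dotZr u1 conjCi mulr1 mulrN -expr2 sqrCi opprK oner_neq0.
  rewrite [u + _]addrC subrK !dotZl !dotZr u1 conjCi !mulr1 mulrN -expr2 sqrCi opprK.
  by rewrite addNr scale0r sub0r !scale1r vE.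
(* Two unit vectors are exchanged by the reflection across the line of their sum. *)
apply: (@defects_on_circle u v v) => //=.
  by rewrite dot_eq0 addrC addr_eq0.
rewrite !dotDl !dotDr u1 v1.
by apply/matrixP => i j; rewrite !mxE; ring.
Qed.

End SphereIrreducible.

(** * Unitary congruence and the embedding dimension *)

Section Isometry.
Local Open Scope sesquilinear_scope.
Variable K : numClosedFieldType.

Lemma row_free_col_mx m k (x : 'rV[K]_m) (B : 'M[K]_(k, m)) (v : 'cV[K]_m) c :
  row_free B -> B *m v = 0 -> x *m v = c%:M -> c != 0 -> row_free (col_mx x B).
Proof.
move=> Bf Bv xv c0; rewrite -kermx_eq0; apply/rowV0P => u /sub_kermxP.
rewrite -[u]hsubmxK mul_row_col => E.
have E1 : lsubmx u = 0.
  have := congr1 (mulmx^~ v) E; rewrite mulmxDl -!mulmxA Bv mulmx0 addr0 mul0mx.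
  by rewrite xv mul_mx_scalar => /eqP; rewrite scaler_eq0 (negPf c0) => /eqP.
rewrite E1 mul0mx add0r in E; rewrite E1.
suff -> : rsubmx u = 0 by rewrite row_mx0.
by apply: (row_free_inj Bf); rewrite mul0mx.
Qed.

Definition spanning T m (g : T -> 'cV[K]_m) :=
  forall w, (forall t, dot (g t) w = 0) -> w = 0.

Definition rowsmx T m k (g : T -> 'cV[K]_m) (t : 'I_k -> T) : 'M[K]_(k, m) :=
  \matrix_(i, j) g (t i) j 0.

(** While k < m, some nonzero vector is orthogonal to the k values already chosen; since the values
    span, one of them is not orthogonal to it and can be added. *)
Lemma spanning_free T m (g : T -> 'cV[K]_m) k : spanning g -> (k <= m)%N ->
  exists t : 'I_k -> T, row_free (rowsmx g t).
Proof.
move=> gs; elim: k => [|k IH] km.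
  exists (fun i : 'I_0 => match i with Ordinal _ lt => False_rect T (notF lt) end).
  by rewrite /row_free eqn_leq rank_leq_row leq0n.
have [t Bf] := IH (ltnW km); set B := rowsmx g t in Bf.
have : \rank (kermx B^T) != 0%N.
  by rewrite mxrank_ker mxrank_tr -lt0n subn_gt0 (leq_ltn_trans (rank_leq_row _)).
rewrite mxrank_eq0 => /rowV0Pn[v /sub_kermxP vB v0].
have Bv : B *m v^T = 0 by rewrite -[B]trmxK -trmx_mul vB trmx0.
pose w := map_mx Num.conj v^T.
have [[s sw]|/forallNP ns] := pselect (exists s, dot (g s) w != 0); last first.
  case/eqP: v0; apply: trmx_inj; apply: (can_inj (@map_mxCK _ _ _)).
  rewrite -/w !raddf0; apply: gs => s; apply/eqP; have := ns s.
  by move/negP; rewrite negbK.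
pose t' (i : 'I_(1 + k)) := if split i is inr j then t j else s.
exists t'; have -> : rowsmx g t' = col_mx (g s)^T B.
  apply/matrixP => i j; rewrite !mxE /t'; case: splitP => i' _; rewrite !mxE //.
  by rewrite ord1.
apply: row_free_col_mx Bf Bv _ sw.
by apply/matrixP => i j; rewrite !ord1 dot_mulmx map_mxCK !mxE eqxx mulr1n.
Qed.

Lemma gram_rowsmx T m k (g : T -> 'cV[K]_m) (t : 'I_k -> T) :
  rowsmx g t *m (rowsmx g t) ^t* = \matrix_(i, j) dot (g (t i)) (g (t j)).
Proof.
by apply/matrixP => i j; rewrite !mxE; apply: eq_bigr => l _; rewrite !mxE.
Qed.

(** N independent values of g have an invertible Gram matrix, and the equal Gram matrix of h has
    rank at most M. *)
Lemma isometric_spanning_le T N M (g : T -> 'cV[K]_N) (h : T -> 'cV[K]_M) :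
  spanning g -> (forall s t, dot (g s) (g t) = dot (h s) (h t)) -> (N <= M)%N.
Proof.
move=> gs gh; have [t Bf] := spanning_free gs (leqnn N).
have Bu : rowsmx g t \in unitmx by rewrite -row_free_unit.
have Gu : rowsmx g t *m (rowsmx g t) ^t* \in unitmx.
  by rewrite unitmx_mul Bu map_unitmx unitmx_tr.
have GE : rowsmx g t *m (rowsmx g t) ^t* = rowsmx h t *m (rowsmx h t) ^t*.
  by rewrite !gram_rowsmx; apply/matrixP => i j; rewrite !mxE gh.
rewrite GE in Gu; rewrite -(mxrank_unit Gu).
exact: leq_trans (mxrankM_maxl _ _) (rank_leq_col _).
Qed.

(** With N independent values of g as the rows of B and those of h as the rows of H, the equality of
    Gram matrices makes H invertible and H^-1 B unitary. At any other point the error is orthogonal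
    to all rows of B, hence zero. The transpose appears because values are stored as rows. *)
Lemma isometric_unitary T N (g h : T -> 'cV[K]_N) :
  spanning g -> (forall s t, dot (g s) (g t) = dot (h s) (h t)) ->
  exists2 W : 'M[K]_N, W \is unitarymx & forall t, g t = W *m h t.
Proof.
move=> gs gh; have [t Bf] := spanning_free gs (leqnn N).
set B := rowsmx g t in Bf; pose H := rowsmx h t.
have Bu : B \in unitmx by rewrite -row_free_unit.
have GE : B *m B ^t* = H *m H ^t*.
  by rewrite !gram_rowsmx; apply/matrixP => i j; rewrite !mxE gh.
have Hu : H \in unitmx.
  have : H *m H ^t* \in unitmx by rewrite -GE unitmx_mul Bu map_unitmx unitmx_tr.
  by rewrite unitmx_mul => /andP[].
pose V := invmx H *m B.
have Vu : V \is unitarymx.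
  apply/unitarymxP; rewrite /V trmx_mul map_mxM /= -mulmxA (mulmxA B) GE.
  rewrite -mulmxA (mulmxA (invmx H)) mulVmx // mul1mx.
  by rewrite -map_mxM -trmx_mul mulVmx // trmx1 map_mx1.
have Vt : V^T \is unitarymx by rewrite trmx_unitary.
exists V^T => // s.
have Wt i : g (t i) = V^T *m h (t i).
  apply: trmx_inj; rewrite trmx_mul trmxK /V mulmxA.
  have -> : (h (t i))^T = row i H by apply/matrixP => a b; rewrite !mxE ord1.
  have -> : (g (t i))^T = row i B by apply/matrixP => a b; rewrite !mxE ord1.
  by rewrite -row_mul mulmxV // row1 -rowE.
apply/eqP; rewrite -subr_eq0; apply/eqP.
set x := g s - _.
have Bx : B *m map_mx Num.conj x = 0.
  apply/matrixP => i j; rewrite !ord1 [RHS]mxE.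
  transitivity (dot (g (t i)) x).
    by rewrite mxE; apply: eq_bigr => l _; rewrite !mxE.
  by rewrite /x dotBr gh Wt dot_unitary // subrr.
apply: (can_inj (@map_mxCK _ _ _)); rewrite raddf0.
by rewrite -[LHS](mulKmx Bu) Bx mulmx0.
Qed.

End Isometry.

Section EmbeddingDimension.
Local Open Scope sesquilinear_scope.
Variables (K : numClosedFieldType) (n N : nat) (A : set 'cV[K]_n).
Variable f : 'cV[K]_n -> 'cV[K]_N.

Lemma hyperplane_vspace (w : 'cV[K]_N) :
  exists U : {vspace 'cV[K]_N}, forall x, (x \in U) = (dot x w == 0).
Proof.
pose l : 'M[K]_(1, N) := map_mx Num.conj w^T.
exists (lker (linfun (mulmx l : 'cV[K]_N -> 'cV[K]_1))) => x.
rewrite memv_ker lfunE /=; apply/eqP/eqP => [/matrixP/(_ 0 0)|lx].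
  by rewrite !mxE => <-; apply: eq_bigr => i _; rewrite !mxE mulrC.
apply/matrixP => i j; rewrite !ord1 !mxE -[RHS]lx.
by apply: eq_bigr => k _; rewrite !mxE mulrC.
Qed.

(** The smallest affine subspace is the whole space, so it lies in the hyperplane of equation <x, w>
    = c; moving from a point of that hyperplane by w itself stays in it, whence <w, w> = 0. *)
Lemma embedding_dim_hyperplane : (exists z, A z) -> embedding_dim A f N ->
  forall w c, (forall z, A z -> dot (f z) w = c) -> w = 0.
Proof.
move=> [z0 Az0] [v [U [_ Umin UN]]] w c fw.
have [H HE] := hyperplane_vspace w.
have := Umin (f z0) H; have -> : U = fullv.
  by apply/eqP; rewrite eqEdim subvf /= dimvf /dim /= muln1 UN.
have fA : (f @` A `<=` affine_subspace (f z0) H)%classic.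
  by move=> _ [z Az <-]; rewrite /affine_subspace /= HE dotBl !fw // subrr.
move=> /(_ fA)/(_ (f z0 + w)); rewrite /affine_subspace /= memvf => /(_ isT).
by rewrite HE addrC addKr dot_eq0 => /eqP.
Qed.

Lemma embedding_dim_full :
  (forall w c, (forall z, A z -> dot (f z) w = c) -> w = 0) -> embedding_dim A f N.
Proof.
move=> H; exists 0, fullv; split; last by rewrite dimvf /dim /= muln1.
  by move=> _ [z _ <-]; rewrite /affine_subspace /= memvf.
move=> v U fU x _; rewrite /affine_subspace /=.
suff -> : U = fullv by rewrite memvf.
apply/eqP; rewrite eqEsubv subvf; apply/subvP => y _; apply/eqP.
rewrite -[_ == true]negbK; apply/negP => /eqP; apply.
have pE a : projv U a = a -> a \in U by move=> <-; rewrite memv_proj.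
apply: pE; apply/matrixP => i j; rewrite !ord1.
(* The vector w represents the functional a -> (a - proj_U a)_i. It kills U, so it is constant on
   the affine subspace v + U and in particular on the image. *)
pose w : 'cV[K]_N := \col_k ((delta_mx k 0 - projv U (delta_mx k 0)) i 0)^*.
have wE (a : 'cV[K]_N) : dot a w = (a - projv U a) i 0.
  rewrite {2 3}[a](@matrix_sum_delta _ N 1) linear_sum /= -sumrB summxE.
  apply: eq_bigr => k _; rewrite big_ord1 mxE conjCK linearZ /=.
  by rewrite -scalerBr [RHS]mxE.
have w0 : w = 0.
  apply: (H _ (dot v w)) => z Az; apply/eqP; rewrite -subr_eq0 -dotBl wE.
  by rewrite projv_id ?subrr ?mxE //; apply: fU; exists z.
by have := wE y; rewrite w0 dot0r !mxE => /eqP; rewrite eq_sym subr_eq0 => /eqP.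
Qed.

End EmbeddingDimension.

(** * Polynomials and the maps H_d *)

Lemma digits_inj (B n : nat) (a b : 'I_n -> nat) :
  (forall i, a i < B)%N -> (forall i, b i < B)%N ->
  (\sum_i a i * B ^ i = \sum_i b i * B ^ i)%N -> a =1 b.
Proof.
elim: n a b => [|n IH] a b aB bB; first by move=> _ [].
rewrite !big_ord_recl /= !expn0 !muln1.
have shift c : (\sum_(i < n) c (lift ord0 i) * B ^ bump 0 i =
  (\sum_(i < n) c (lift ord0 i) * B ^ i) * B)%N.
  by rewrite big_distrl; apply: eq_bigr => i _ /=; rewrite expnSr mulnA.
rewrite !shift => E.
have B0 : (0 < B)%N by apply: leq_ltn_trans (aB ord0).
have e0 : a ord0 = b ord0.
  have := congr1 (modn^~ B) E.
  by rewrite /= ![(_ + _ * B)%N]addnC !modnMDl !modn_small.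
move: E; rewrite e0 => /addnI/eqP; rewrite eqn_pmul2r // => /eqP E i.
have [->|] := eqVneq i ord0; first exact: e0.
rewrite eq_sym => /unlift_some[j -> _].
exact: (IH (fun j => a (lift ord0 j)) (fun j => b (lift ord0 j))).
Qed.

Section MpolyFacts.
Variables (K : numFieldType) (n : nat).

(* Kronecker substitution [z_i = t ^ (B ^ i)]: distinct monomials with
   exponents below [B] become distinct powers of [t]. *)
Lemma meval_eq0 (p : mpoly n K) : (forall v, meval v p = 0) -> p = 0.
Proof.
move=> p0; pose B := msize p.
pose code (m : multinom n) := (\sum_i m i * B ^ i)%N.
have mB (m : multinom n) i : m \in msupp p -> (m i < B)%N.
  move=> /msize_mdeg_lt; apply: leq_ltn_trans.
  by rewrite mdegE (bigD1 i) //= leq_addr.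
pose P : {poly K} := \sum_(m <- msupp p) mcoeff m p *: 'X^(code m).
have PE : P = 0.
  apply: poly_nat_eq0 => k; rewrite -[RHS](p0 (fun i => k%:R ^+ (B ^ i))) mevalE.
  rewrite /P horner_sum; apply: eq_bigr => m _.
  rewrite hornerZ hornerXn /code -prodrXr; congr (_ * _).
  by apply: eq_bigr => i _; rewrite mulnC exprM.
apply/mpolyP => m; rewrite mcoeff0.
have [mp|] := boolP (m \in msupp p); last first.
  by rewrite -mcoeff_eq0 => /eqP.
have := congr1 (fun q : {poly K} => q`_(code m)) PE.
rewrite coef0 /P coef_sum (bigD1_seq m) ?msupp_uniq //= coefZ coefXn eqxx mulr1.
rewrite big_seq_cond big1 ?addr0 // => m' /andP[m'p m'm].
rewrite coefZ coefXn; case: eqP => [E|_]; last by rewrite mulr0.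
case/eqP: m'm; apply/mnmP; apply: (@digits_inj B) => //; first by move=> i; apply: mB.
by move=> i; apply: mB.
Qed.

Lemma peval_line (p : mpoly n K) (z v : 'cV[K]_n) :
  exists P : {poly K}, forall t, meval (fun i => (z + t *: v) i 0) p = P.[t].
Proof.
exists (\sum_(m <- msupp p) mcoeff m p *:
  \prod_i ((z i 0)%:P + v i 0 *: 'X) ^+ m i) => t.
rewrite mevalE horner_sum; apply: eq_bigr => m _.
rewrite hornerZ horner_prod; congr (_ * _); apply: eq_bigr => i _.
by rewrite horner_exp hornerD hornerC hornerZ hornerX !mxE mulrC.
Qed.

Definition quadratic_form_fun (g : 'cV[K]_n -> K) :=
  exists (c : K) (l : 'rV[K]_n) (A : 'M[K]_n), forall z,
    g z = c + (l *m z) 0 0 + (z^T *m A *m z) 0 0.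

Lemma quadratic_form_funD g h : quadratic_form_fun g -> quadratic_form_fun h ->
  quadratic_form_fun (fun z => g z + h z).
Proof.
move=> [c [l [A gE]]] [c' [l' [A' hE]]].
exists (c + c'), (l + l'), (A + A') => z; rewrite gE hE.
have -> : ((l + l') *m z) 0 0 = (l *m z) 0 0 + (l' *m z) 0 0.
  by rewrite mulmxDl [LHS]mxE.
have -> : (z^T *m (A + A') *m z) 0 0 = (z^T *m A *m z) 0 0 + (z^T *m A' *m z) 0 0.
  by rewrite mulmxDr mulmxDl [LHS]mxE.
by ring.
Qed.

Lemma quadratic_form_funZ a g : quadratic_form_fun g ->
  quadratic_form_fun (fun z => a * g z).
Proof.
move=> [c [l [A gE]]]; exists (a * c), (a *: l), (a *: A) => z; rewrite gE.
have -> : ((a *: l) *m z) 0 0 = a * (l *m z) 0 0 by rewrite -scalemxAl [LHS]mxE.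
have -> : (z^T *m (a *: A) *m z) 0 0 = a * (z^T *m A *m z) 0 0.
  by rewrite -scalemxAr -scalemxAl [LHS]mxE.
by ring.
Qed.

Lemma quadratic_form_mpoly (p : mpoly n K) : (msize p <= 3)%N ->
  quadratic_form_fun (fun z => meval (fun i => z i 0) p).
Proof.
move=> p3.
have lin0 (z : 'cV[K]_n) : ((0 : 'rV[K]_n) *m z) 0 0 = 0 by rewrite mul0mx mxE.
have quad0 (z : 'cV[K]_n) : (z^T *m 0 *m z) 0 0 = 0 by rewrite mulmx0 mul0mx mxE.
have cst c : quadratic_form_fun (fun=> c).
  by exists c, 0, 0 => z; rewrite lin0 quad0 !addr0.
have mul0 m : m != mnm0 -> exists i, exists m',
    m = mnm_add (mnm1 i) m' /\ mdeg m = (mdeg m').+1.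
  move=> m0; have [i mi] : exists i, m i != 0%N.
    apply/existsP; apply: contraNT m0; rewrite negb_exists => /forallP mi.
    apply/eqP/mnmP => i; rewrite mnm0E; apply/eqP; move: (mi i).
    by rewrite negbK.
  have mE : m = mnm_add (mnm1 i) (mnm_sub m (mnm1 i)).
    rewrite addmC submK //; apply/mnm_lepP => j; rewrite mnm1E.
    by case: eqP => [<-|//]; rewrite lt0n.
  by exists i, (mnm_sub m (mnm1 i)); split=> //; rewrite {1}mE mdegD mdeg1.
have mono m : (mdeg m <= 2)%N ->
    quadratic_form_fun (fun z => meval (fun i => z i 0) (mpolyX K m)).
  move=> m2; have [->|/mul0[i [m' [mE dm]]]] := eqVneq m mnm0.
    by rewrite mpolyX0; under eq_fun do rewrite meval1; apply: cst.
  rewrite mE; under eq_fun do rewrite mpolyXD mevalM mevalXU.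
  have [->|/mul0[j [m'' [E dm']]]] := eqVneq m' mnm0.
    rewrite mpolyX0; under eq_fun do rewrite meval1 mulr1.
    exists 0, (delta_mx 0 i), 0 => z; rewrite quad0 add0r addr0.
    by rewrite -rowE mxE.
  have m''0 : m'' = mnm0.
    by apply/eqP; rewrite -mdeg_eq0 -leqn0; move: m2; rewrite dm dm'.
  rewrite E m''0 mpolyXD mpolyX0 mulr1; under eq_fun do rewrite mevalXU.
  exists 0, 0, (delta_mx i j) => z; rewrite lin0 !add0r.
  rewrite mxE (bigD1 j) //= mxE (bigD1 i) //= !mxE !eqxx mulr1.
  rewrite big1 ?addr0 => [|k /negPf ki]; last by rewrite !mxE ki mulr0.
  rewrite big1 ?addr0 // => k /negPf kj; rewrite mxE big1 ?mul0r // => a _.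
  by rewrite !mxE kj andbF mulr0.
suff H (s : seq (multinom n)) : all (fun m => mdeg m <= 2)%N s ->
    quadratic_form_fun (fun z => \sum_(m <- s) mcoeff m p * meval (fun i => z i 0) (mpolyX K m)).
  have := H (msupp p); have -> : all (fun m => mdeg m <= 2)%N (msupp p).
    by apply/allP => m mp; rewrite -ltnS; apply: leq_trans p3; apply: msize_mdeg_lt.
  move=> /(_ isT); congr quadratic_form_fun; apply/funext => z.
  by rewrite mevalE; apply: eq_bigr => m _; rewrite mevalX.
elim: s => [_|m s IH /= /andP[m2 /IH hs]].
  by under eq_fun do rewrite big_nil; apply: cst.
under eq_fun do rewrite big_cons; apply: quadratic_form_funD hs.
exact/quadratic_form_funZ/mono.
Qed.

End MpolyFacts.

Lemma quadmap_mpoly (K : numClosedFieldType) n N (p : 'I_N -> mpoly n K) :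
  (forall j, msize (p j) <= 3)%N ->
  exists F : quadmap K n N, forall z, qeval F z = \col_j peval (p j) z.
Proof.
move=> p3; have := fin_all_exists (fun j => quadratic_form_mpoly (p3 j)).
move=> [c /fin_all_exists[l /fin_all_exists[A E]]].
exists (QuadMap (\col_j c j) (\matrix_(j, i) l j 0 i) A) => z.
apply/matrixP => j k; rewrite !ord1 ![in LHS]mxE [RHS]mxE /peval E.
rewrite /qhom2 /=; congr (_ + _ + _); rewrite ?mxE //.
by apply: eq_bigr => i _; rewrite !mxE.
Qed.

Local Open Scope classical_set_scope.
Local Open Scope ring_scope.
Local Open Scope complex_scope.

(** The multinomial theorem. The bound d on the exponents is kept apart from the total e, because
    the induction on the list lowers e while the type of the exponents must not change. *)
Lemma sum_multinomial (F : numFieldType) d e (ys : seq F) : (e <= d)%N ->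
  \sum_(al : (size ys).-tuple 'I_d.+1 | (\sum_(i <- al) i)%N == e)
    e`!%:R / (\prod_(i <- al) i`!)%N%:R *
    \prod_(i < size ys) ys`_i ^+ tnth al i = (\sum_(y <- ys) y) ^+ e.
Proof.
elim: ys e => [|y ys IH] e ed.
  rewrite big_nil (eq_bigl (fun=> 0%N == e)); last first.
    by move=> al; rewrite tuple0 /= big_nil.
  case: e ed => [|e] _; last by rewrite expr0n big_pred0.
  rewrite expr0 (big_pred1 [tuple]) /=; last first.
    by move=> al; transitivity true => //; apply/esym/eqP/val_inj; rewrite (tuple0 al).
  by rewrite big_nil big_ord0 fact0 divr1 mulr1.
pose f (x : 'I_d.+1 * (size ys).-tuple 'I_d.+1) : (size (y :: ys)).-tuple 'I_d.+1 :=
  [tuple of x.1 :: x.2].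
rewrite (reindex f) /=; last first.
  exists (fun t => (thead t, [tuple of behead t])) => [[a b] _|t _].
    by congr (_, _); apply: val_inj.
  by apply: val_inj; rewrite /= [in RHS](tuple_eta t).
rewrite -(pair_big_dep xpredT (fun (a : 'I_d.+1) (b : (size ys).-tuple 'I_d.+1) =>
   (\sum_(i <- a :: b) i)%N == e) (fun a b => e`!%:R / (\prod_(i <- a :: b) i`!)%N%:R *
    \prod_(i < (size ys).+1) (y :: ys)`_i ^+ tnth [tuple of a :: b] i)) /=.
rewrite big_cons addrC exprDn (big_ord_widen d.+1 (fun i => (\sum_(y <- ys) y) ^+ (e - i) *
  y ^+ i *+ 'C(e, i))) //.
rewrite [RHS]big_mkcond; apply: eq_bigr => a _; rewrite ltnS.
case: leqP => ae; last first.
  rewrite big_pred0 // => b; rewrite big_cons; apply/negbTE.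
  by rewrite neq_ltn (leq_trans ae) ?orbT // leq_addr.
rewrite -IH; last by rewrite (leq_trans (leq_subr _ _)).
rewrite mulr_suml -sumrMnl; apply: eq_big => [b|b _].
  by rewrite big_cons -{1}(subnKC ae) eqn_add2l.
rewrite big_cons big_ord_recl tnth0.
have -> : \prod_(i < size ys) (y :: ys)`_(lift ord0 i) ^+ tnth [tuple of a :: b] (lift ord0 i)
  = \prod_(i < size ys) ys`_i ^+ tnth b i.
  by apply: eq_bigr => i _; rewrite !(tnth_nth ord0).
rewrite /=.
rewrite natrM -(bin_fact ae) !natrM -mulr_natr invfM.
have a0 : (a`!%:R : F) != 0 by rewrite pnatr_eq0 -lt0n fact_gt0.
set P := (\prod_(i <- b) i`!)%N.
have P0 : (P%:R : F) != 0.
  by rewrite pnatr_eq0 -lt0n prodn_gt0 // => i; rewrite fact_gt0.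
by field; rewrite a0 P0.
Qed.

Section Veronese.
Variable R : realType.
Local Notation C := R[i].

Lemma prod_fact_gt0 k d (al : k.-tuple 'I_d.+1) : (0 < \prod_(i <- al) i`!)%N.
Proof. by rewrite prodn_gt0 // => i; rewrite fact_gt0. Qed.

Lemma Hseq_norm d (xs : seq C) :
  \sum_(w <- Hseq d xs) w * Num.conj w = (\sum_(x <- xs) x * Num.conj x) ^+ d.
Proof.
rewrite /Hseq big_map big_enum_cond /=.
have := @sum_multinomial C d d [seq x * Num.conj x | x <- xs] (leqnn d).
rewrite big_map => <-; rewrite size_map.
apply: eq_big => [al|al _]; first by rewrite !inE andbT.
rewrite rmorphM /= mulrACA; congr (_ * _).
  have -> : Num.conj (Num.sqrt (d`!%:R / (\prod_(i <- al) i`!)%N%:R : R))%:C =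
            (Num.sqrt (d`!%:R / (\prod_(i <- al) i`!)%N%:R))%:C.
    exact: conjc_real.
  rewrite -rmorphM /= -expr2 sqr_sqrtr ?divr_ge0 ?ler0n //.
  by rewrite fmorph_div !rmorph_nat.
rewrite rmorph_prod -big_split; apply: eq_bigr => i _ /=.
by rewrite (nth_map 0) // rmorphXn exprMn.
Qed.

(** The exponent tuples of [Hseq] have a length that depends on the list; here the length is a fixed
    k, so that different lists of the same size can be compared. *)
Lemma HseqE d k (xs : seq C) : size xs = k ->
  Hseq d xs = [seq (Num.sqrt (d`!%:R / (\prod_(i <- al) i`!)%N%:R))%:C *
       \prod_(i < k) xs`_i ^+ tnth al i | al : k.-tuple 'I_d.+1 <- enum (multi_index k d)].
Proof. by move=> <-. Qed.

(** The components are distinct monomials with positive coefficients, so a relation between them is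
    a polynomial that vanishes identically. *)
Lemma Hseq_independent d k (w : nat -> C) :
  (forall xs : seq C, size xs = k ->
     \sum_(j < size (Hseq d xs)) w j * (Hseq d xs)`_j = 0) ->
  forall j, (j < #|multi_index k d|)%N -> w j = 0.
Proof.
move=> H.
pose s := enum (multi_index k d).
pose m (al : k.-tuple 'I_d.+1) : multinom k := Multinom [tuple tnth al i : nat | i < k].
pose c (al : k.-tuple 'I_d.+1) : C := (Num.sqrt (d`!%:R / (\prod_(i <- al) i`!)%N%:R))%:C.
have mE al i : m al i = tnth al i :> nat by rewrite multinomE tnth_mktuple.
have minj : injective m.
  move=> a b ab; apply: eq_from_tnth => i; apply: val_inj => /=.
  by rewrite -!mE ab.
pose al0 : k.-tuple 'I_d.+1 := [tuple of nseq k ord0].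
pose P : mpoly k C := \sum_(j < size s) (w j * c (nth al0 s j)) *: mpolyX C (m (nth al0 s j)).
have P0 : P = 0.
  apply: meval_eq0 => v; pose xs := [seq v i | i <- enum 'I_k].
  have sz : size xs = k by rewrite size_map size_enum_ord.
  have vE (i : 'I_k) : xs`_i = v i.
    by rewrite (nth_map i) ?size_enum_ord // nth_ord_enum.
  rewrite -[RHS](H xs sz) (HseqE _ sz) size_map /P raddf_sum /=.
  apply: eq_bigr => j _; rewrite mevalZ mevalX (nth_map al0) // -mulrA.
  by congr (_ * (_ * _)); apply: eq_bigr => i _; rewrite vE mE.
move=> j jl; have js : (j < size s)%N by rewrite -cardE.
have := congr1 (mcoeff (m (nth al0 s j))) P0.
rewrite mcoeff0 /P raddf_sum /= (bigD1 (Ordinal js)) //= mcoeffZ mcoeffX eqxx mulr1.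
rewrite big1 ?addr0 => [/eqP|i ij].
  rewrite mulf_eq0 => /orP[/eqP//|/eqP/(@complexI _ _ 0)/eqP].
  by rewrite sqrtr_eq0 leNgt divr_gt0 // ltr0n ?fact_gt0 ?prod_fact_gt0.
rewrite mcoeffZ mcoeffX; case: eqP => [/minj/eqP|]; last by rewrite mulr0.
by rewrite nth_uniq ?enum_uniq // => /eqP ji; case/eqP: ij; apply: val_inj.
Qed.

End Veronese.

(** * Proper maps between annuli *)

Section MatrixTopology.

Lemma cvg_matrix (S : topologicalType) (z : S)
    (T : topologicalType) m n (f : S -> 'M[T]_(m, n)) (a : 'M[T]_(m, n)) :
  (forall i j, (f x i j) @[x --> z] --> a i j) -> f @ z --> a.
Proof.
move=> H A [P aP sPA]; rewrite /nbhs /=.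
have H' i : nbhs z [set x | forall j, P i j (f x i j)].
  by apply: (filter_forall (nbhs_filter z)) => j; apply: H; apply: aP.
have := filter_forall (nbhs_filter z) H'; apply: filterS => x Px; apply: sPA => i j.
exact: Px.
Qed.

Lemma cvg_coord (S : topologicalType) (z : S)
    (T : topologicalType) m n (f : S -> 'M[T]_(m, n)) (a : 'M[T]_(m, n)) i j :
  f @ z --> a -> (f x i j) @[x --> z] --> a i j.
Proof.
move=> H A aA; apply: (H [set M | A (M i j)]).
exists (fun i' j' => if (i' == i) && (j' == j) then A else setT).
  move=> i' j'; case: andP => [[/eqP -> /eqP ->] //|_]; exact: filterT.
by move=> M /(_ i j); rewrite !eqxx.
Qed.

Lemma continuous_coord (T : topologicalType) m n i j :
  continuous (fun M : 'M[T]_(m, n) => M i j).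
Proof. by move=> M; apply: (@cvg_coord _ M _ _ _ id). Qed.

Lemma cV_compact (T : ptopologicalType) n (A : 'I_n -> set T) :
  (forall i, compact (A i)) -> compact [set v : 'cV[T]_n | forall i, A i (v i 0)].
Proof.
move=> Ac; have := rV_compact Ac.
set B := [set v | _] => Bc.
suff -> : [set v : 'cV[T]_n | forall i, A i (v i 0)] = (fun v : 'rV[T]_n => v^T) @` B.
  apply: continuous_compact Bc; apply: continuous_subspaceT => v.
  apply: cvg_matrix => i j; rewrite mxE.
  have -> : (fun x : 'rV[T]_n => x^T i j) = (fun x => x j i).
    by apply/funext => x; rewrite mxE.
  exact: continuous_coord.
apply/seteqP; split => [v vA|_ [v vB <-] i] /=; last by rewrite mxE.
exists v^T; last by rewrite trmxK.
by move=> i; rewrite mxE.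
Qed.

Variable K : numFieldType.

Lemma cvg_bigsum (S : topologicalType) (z : S) (I : Type) (r : seq I)
    (f : I -> S -> K) (a : I -> K) :
  (forall i, f i @ z --> a i) ->
  (fun x => \sum_(i <- r) f i x) @ z --> \sum_(i <- r) a i.
Proof.
move=> fa; elim: r => [|i r IH].
  rewrite big_nil; have -> : (fun x => \sum_(i <- [::]) f i x) = (fun=> 0 : K).
    by apply/funext => x; rewrite big_nil.
  exact: cvg_cst.
rewrite big_cons; have -> : (fun x => \sum_(j <- i :: r) f j x) =
    (fun x => f i x + \sum_(j <- r) f j x).
  by apply/funext => x; rewrite big_cons.
exact: (@cvgD _ K^o).
Qed.

Lemma cvg_bigprod (S : topologicalType) (z : S) (I : Type) (r : seq I)
    (f : I -> S -> K) (a : I -> K) :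
  (forall i, f i @ z --> a i) ->
  (fun x => \prod_(i <- r) f i x) @ z --> \prod_(i <- r) a i.
Proof.
move=> fa; elim: r => [|i r IH].
  rewrite big_nil; have -> : (fun x => \prod_(i <- [::]) f i x) = (fun=> 1 : K).
    by apply/funext => x; rewrite big_nil.
  exact: cvg_cst.
rewrite big_cons; have -> : (fun x => \prod_(j <- i :: r) f j x) =
    (fun x => f i x * \prod_(j <- r) f j x).
  by apply/funext => x; rewrite big_cons.
exact: cvgM.
Qed.

Lemma cvg_expr (S : topologicalType) (z : S) (f : S -> K) (a : K) n :
  f @ z --> a -> (fun x => f x ^+ n) @ z --> a ^+ n.
Proof.
move=> fa; elim: n => [|n IH].
  have -> : (fun x => f x ^+ 0) = (fun=> 1 : K) by apply/funext => x; rewrite expr0.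
  by rewrite expr0; apply: cvg_cst.
have -> : (fun x => f x ^+ n.+1) = (fun x => f x * f x ^+ n).
  by apply/funext => x; rewrite exprS.
by rewrite exprS; apply: cvgM.
Qed.

Lemma cvg_mul (S : topologicalType) (z : S) (f g : S -> K) (a b : K) :
  f @ z --> a -> g @ z --> b -> (fun x => f x * g x) @ z --> a * b.
Proof. exact: cvgM. Qed.

Lemma continuous_meval n (p : mpoly n K) :
  continuous (fun z : 'cV[K]_n => meval (fun i => z i 0) p).
Proof.
move=> z.
have -> : (fun z : 'cV[K]_n => meval (fun i => z i 0) p) =
    (fun z => \sum_(m <- msupp p) mcoeff m p * \prod_i z i 0 ^+ m i).
  by apply/funext => x; rewrite mevalE.
apply: cvg_bigsum => m.
apply: (@cvg_mul _ z (fun=> mcoeff m p) (fun x : 'cV[K]_n => \prod_i x i 0 ^+ m i)).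
  by apply: cvg_cst; apply: nbhs_filter.
apply: (@cvg_bigprod _ z _ _ (fun i (x : 'cV[K]_n) => x i 0 ^+ m i) (fun i => z i 0 ^+ m i)) => i.
apply: (@cvg_expr _ z (fun x : 'cV[K]_n => x i 0)); exact: continuous_coord.
Qed.

End MatrixTopology.

Lemma continuous_peval (K : numClosedFieldType) n (p : mpoly n K) :
  continuous (peval p : 'cV[K]_n -> K).
Proof. exact: (@continuous_meval K). Qed.


Section ComplexTopology.
Variable R : realType.
Local Notation C := (R[i] : numClosedFieldType).

Lemma continuous_Re : continuous (@complex.Re R : C -> R).
Proof.
move=> z A /nbhs_ballP[e e0 eA]; apply/nbhs_ballP.
exists e%:C => /=; first by rewrite ltcR.
move=> w; rewrite /ball /= => H; apply: eA; rewrite /ball /=.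
rewrite -ltcR; apply: le_lt_trans H.
by rewrite -raddfB; apply: normc_ge_Re.
Qed.

Lemma continuous_Im : continuous (@complex.Im R : C -> R).
Proof.
move=> z A /nbhs_ballP[e e0 eA]; apply/nbhs_ballP.
exists e%:C => /=; first by rewrite ltcR.
move=> w; rewrite /ball /= => H; apply: eA; rewrite /ball /=.
rewrite -ltcR; apply: le_lt_trans H.
rewrite -raddfB -normrN -ReiNIm.
apply: le_trans (normc_ge_Re _) _.
by rewrite normrM complexiE normCi mulr1.
Qed.

Lemma continuous_Complex : continuous (fun x : R * R => Complex x.1 x.2 : C).
Proof.
move=> [x y] A /nbhs_ballP[e e0 eA]; apply/nbhs_ballP.
(* Radii of balls in [R[i]] are themselves complex; positivity forces the radius to be real. *)
have [eR epos] : e = (complex.Re e)%:C /\ 0 < complex.Re e.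
  move: e0 => /=; rewrite ltcE /= => /andP[/eqP e0 ->]; split=> //.
  by rewrite [LHS]complexE e0 mulr0 addr0.
exists (complex.Re e / 2) => /=; first by rewrite divr_gt0.
move=> [x' y'] [/=]; rewrite /ball /= => xx yy; apply: eA; rewrite /ball /= eR.
have -> : Complex x y - Complex x' y' = (x - x')%:C + 'i%C * (y - y')%:C :> R[i].
  by apply/eqP; rewrite eq_complex /=; apply/andP; split; apply/eqP; ring.
apply: le_lt_trans (ler_normD _ _) _.
rewrite normrM complexiE normCi mul1r.
have nR (a : R) : `|a%:C : R[i]| = `|a|%:C by rewrite normc_def /= expr0n addr0 sqrtr_sqr.
rewrite !nR -rmorphD ltcR [ltRHS]splitr; exact: ltrD.
Qed.

(** A real-valued version of [dot z z], for arguments about order and limits. *)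
Definition sqnorm n (z : 'cV[C]_n) : R :=
  \sum_i (complex.Re (z i 0) ^+ 2 + complex.Im (z i 0) ^+ 2).

Lemma continuous_sqnorm n : continuous (@sqnorm n).
Proof.
move=> z; apply: (@cvg_bigsum R _ z _ _ (fun i (z : 'cV[C]_n) => complex.Re (z i 0) ^+ 2 + complex.Im (z i 0) ^+ 2) (fun i => complex.Re (z i 0) ^+ 2 + complex.Im (z i 0) ^+ 2)) => i.
have c1 : (fun w : 'cV[C]_n => complex.Re (w i 0)) @ z --> complex.Re (z i 0).
  apply: (@continuous_comp _ _ _ (fun w : 'cV[C]_n => w i 0) (@complex.Re R : C -> R)).
    exact: continuous_coord.
  exact: continuous_Re.
have c2 : (fun w : 'cV[C]_n => complex.Im (w i 0)) @ z --> complex.Im (z i 0).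
  apply: (@continuous_comp _ _ _ (fun w : 'cV[C]_n => w i 0) (@complex.Im R : C -> R)).
    exact: continuous_coord.
  exact: continuous_Im.
by apply: (@cvgD _ R^o _ _ (nbhs_filter z)); apply: cvg_expr.
Qed.

Lemma dot_sqnorm n (z : 'cV[C]_n) : dot z z = (sqnorm z)%:C.
Proof.
rewrite /dot /sqnorm rmorph_sum; apply: eq_bigr => i _.
by rewrite -normCK -add_Re2_Im2.
Qed.

Lemma sqnorm_ge0 n (z : 'cV[C]_n) : 0 <= sqnorm z.
Proof. by apply: sumr_ge0 => i _; rewrite addr_ge0 ?sqr_ge0. Qed.

Lemma sqr_enorm n (z : 'cV[C]_n) : enorm z ^+ 2 = sqnorm z.
Proof.
rewrite /enorm sqr_sqrtr; last by apply: sumr_ge0 => i _; rewrite sqr_ge0.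
apply: eq_bigr => i _; case: (z i 0) => a b /=.
by rewrite sqr_sqrtr // addr_ge0 ?sqr_ge0.
Qed.

Lemma annulusE n r (z : 'cV[C]_n) : 0 < r -> annulus r z <-> r ^+ 2 < sqnorm z < 1.
Proof.
move=> r0; rewrite /annulus /= -sqr_enorm.
have e0 : 0 <= enorm z by apply: sqrtr_ge0.
by rewrite ltr_pXn2r ?qualifE /= ?(ltW r0) // expr_lt1.
Qed.

Lemma compact_shell n (s t : R) :
  compact [set z : 'cV[C]_n | s <= sqnorm z <= t].
Proof.
pose D : set C := (fun x : R * R => Complex x.1 x.2 : C) @` (`[- (t + 1), t + 1] `*` `[- (t + 1), t + 1]).
have Dc : compact D.
  apply: continuous_compact.
    by apply: continuous_subspaceT => x; apply: continuous_Complex.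
  by apply: compact_setX; apply: segment_compact.
apply: (@subclosed_compact _ _ [set v : 'cV[C]_n | forall i, D (v i 0)]).
- have -> : [set z : 'cV[C]_n | s <= sqnorm z <= t] = @sqnorm n @^-1` `[s, t].
    by apply/seteqP; split => z /=; rewrite in_itv.
  apply: closed_comp; last exact: interval_closed.
  by move=> x _; apply: continuous_sqnorm.
- exact: (@cV_compact _ n (fun=> D) (fun=> Dc)).
move=> z /= /andP[_ zt] i.
have h : complex.Re (z i 0) ^+ 2 + complex.Im (z i 0) ^+ 2 <= t.
  apply: le_trans zt; rewrite /sqnorm (bigD1 i) //= lerDl.
  by apply: sumr_ge0 => j _; rewrite addr_ge0 ?sqr_ge0.
exists (complex.Re (z i 0), complex.Im (z i 0)) => /=; last by case: (z i 0).
(* The side t + 1 of the square bounds the square root of t without introducing a root. *)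
have k (x : R) : x ^+ 2 <= t -> - (t + 1) <= x <= t + 1 by move=> xt; nra.
rewrite !in_itv /=; split; apply: k; apply: le_trans h.
  by rewrite lerDl sqr_ge0.
by rewrite lerDr sqr_ge0.
Qed.

End ComplexTopology.

Section ProperMaps.
Variable R : realType.
Local Notation C := (R[i] : numClosedFieldType).

Lemma sqnormZ n (a : C) (z : 'cV[C]_n) :
  sqnorm (a *: z) = (complex.Re a ^+ 2 + complex.Im a ^+ 2) * sqnorm z.
Proof.
rewrite /sqnorm mulr_sumr; apply: eq_bigr => i _; rewrite mxE.
by case: a (z i 0) => [a b] [c d] /=; ring.
Qed.

Lemma sqnorm_eq0 n (z : 'cV[C]_n) : (sqnorm z == 0) = (z == 0).
Proof. by rewrite -dot_eq0 dot_sqnorm -(inj_eq (@complexI R)). Qed.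

Lemma sqnorm_quotient n (a : 'cV[C]_1) (z : 'cV[C]_n) : a != 0 ->
  sqnorm ((a 0 0)^-1 *: z) = sqnorm z / sqnorm a.
Proof.
move=> a0; apply: (@complexI R).
rewrite rmorphM /= fmorphV /= -!dot_sqnorm dotZl dotZr fmorphV /=.
have aE : dot a a = a 0 0 * Num.conj (a 0 0) by rewrite /dot big_ord1.
by rewrite aE invfM; ring.
Qed.

(** In the limit rho^2 |q|^2 <= |p|^2 <= |q|^2 at u. If both inequalities were strict, q(u) would be
    nonzero and |f|^2 would stay near u in a closed interval inside (rho^2, 1). By properness the
    preimage of the corresponding shell is compact, hence closed, and u, a limit of its points,
    would belong to A. *)
Lemma boundary_values n N (A : set 'cV[C]_n) (rho : R) (f p : 'cV[C]_n -> 'cV[C]_N)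
    (q : 'cV[C]_n -> 'cV[C]_1) (u : 'cV[C]_n) :
  0 < rho < 1 -> p @ u --> p u -> q @ u --> q u ->
  proper_map A (annulus rho) f -> closure A u -> ~ A u ->
  (forall z, A z -> q z != 0 /\ f z = (q z 0 0)^-1 *: p z) ->
  sqnorm (p u) = rho ^+ 2 * sqnorm (q u) \/ sqnorm (p u) = sqnorm (q u).
Proof.
move=> /andP[rho0 rho1] pu qu [_ fAB fproper] clA nA fpq.
have Pc : (fun z => sqnorm (p z)) @ u --> sqnorm (p u).
  by apply: (@continuous_comp _ _ _ p (@sqnorm R N)) => //; apply: continuous_sqnorm.
have Qc : (fun z => sqnorm (q z)) @ u --> sqnorm (q u).
  by apply: (@continuous_comp _ _ _ q (@sqnorm R 1)) => //; apply: continuous_sqnorm.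
have nearlt a b : a * sqnorm (q u) < b * sqnorm (p u) ->
    nbhs u [set z | a * sqnorm (q z) < b * sqnorm (p z)].
  move=> ab.
  have h : (fun z => b * sqnorm (p z) - a * sqnorm (q z)) @ u -->
      b * sqnorm (p u) - a * sqnorm (q u).
    apply: (@cvgB _ R^o _ _ (nbhs_filter u));
      apply: cvg_mul => //; apply: cvg_cst; exact: nbhs_filter.
  have ab0 : 0 < b * sqnorm (p u) - a * sqnorm (q u) by rewrite subr_gt0.
  have hn := cvgr_gt _ h _ ab0; refine (@filterS _ _ (nbhs_filter u) _ _ _ (hn (nbhs_filter u))) => z /=.
  by rewrite subr_gt0.
have onA z : A z -> [/\ 0 < sqnorm (q z), rho ^+ 2 * sqnorm (q z) < sqnorm (p z),
    sqnorm (p z) < sqnorm (q z) & sqnorm (f z) = sqnorm (p z) / sqnorm (q z)].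
  move=> Az; have [q0 fE] := fpq z Az.
  have qp : 0 < sqnorm (q z) by rewrite lt_def sqnorm_eq0 q0 sqnorm_ge0.
  have fz : sqnorm (f z) = sqnorm (p z) / sqnorm (q z) by rewrite fE sqnorm_quotient.
  have /annulusE -/(_ rho0) : annulus rho (f z) by apply: fAB; exists z.
  by rewrite fz ltr_pdivlMr // ltr_pdivrMr // mul1r => /andP[].
have h1 : rho ^+ 2 * sqnorm (q u) <= sqnorm (p u).
  rewrite leNgt; apply/negP => h.
  have := nearlt (- rho ^+ 2) (- 1); rewrite !mulNr mul1r ltrN2 => /(_ h)/clA[z [Az /=]].
  by have [_ h' _ _] := onA z Az; rewrite !mulNr mul1r ltrN2 => /(lt_trans h'); rewrite ltxx.
have h2 : sqnorm (p u) <= sqnorm (q u).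
  rewrite leNgt; apply/negP => h.
  have := nearlt 1 1; rewrite !mul1r => /(_ h)/clA[z [Az /=]].
  by have [_ _ h' _] := onA z Az; rewrite !mul1r => /(lt_trans h'); rewrite ltxx.
move: h1 h2; rewrite !le_eqVlt => /orP[/eqP|h1]; first by left.
move=> /orP[/eqP|h2]; first by right.
case: nA.
have qp : 0 < sqnorm (q u) by apply: le_lt_trans h2; apply: sqnorm_ge0.
pose v := sqnorm (p u) / sqnorm (q u).
have v1 : rho ^+ 2 < v by rewrite ltr_pdivlMr.
have v2 : v < 1 by rewrite ltr_pdivrMr // mul1r.
have pv : sqnorm (p u) = v * sqnorm (q u) by rewrite divfK ?gt_eqF.
(* The limit v of |f|^2 lies strictly between these two midpoints, which themselves lie strictly
   between rho^2 and 1. *)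
pose al := (rho ^+ 2 + v) / 2; pose be := (1 + v) / 2.
pose L := [set w : 'cV[C]_N | al <= sqnorm w <= be].
have LB : L `<=` annulus rho.
  move=> w /andP[w1 w2]; apply/annulusE => //; apply/andP; split.
    by apply: lt_le_trans w1; rewrite /al; lra.
  by apply: le_lt_trans w2 _; rewrite /be; lra.
have Sc := fproper L LB (@compact_shell R N al be).
have : closed (A `&` f @^-1` L).
  by apply: compact_closed Sc; apply: norm_hausdorff.
rewrite closure_id => SE; suff : closure (A `&` f @^-1` L) u by rewrite -SE => -[].
move=> U Uu.
have n1 : nbhs u [set z | al * sqnorm (q z) < 1 * sqnorm (p z)].
  by apply: nearlt; rewrite mul1r pv ltr_pM2r // /al; lra.
have n2 : nbhs u [set z | (- be) * sqnorm (q z) < (-1) * sqnorm (p z)].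
  by apply: nearlt; rewrite !mulNr mul1r ltrN2 pv ltr_pM2r // /be; lra.
have [z [Az [[Uz /= z1] /= z2]]] := clA _ (filterI (filterI Uu n1) n2).
exists z; split=> //; split=> //=.
have [qz _ _ fz] := onA z Az; rewrite mul1r in z1; rewrite /L /= fz.
rewrite ler_pdivlMr // ler_pdivrMr // (ltW z1) /=.
by move: z2; rewrite !mulNr mul1r ltrN2 => /ltW.
Qed.

(** On a compact L the norm attains a minimum and a maximum, both strictly inside the target range,
    so the last hypothesis encloses the preimage of L in a compact shell inside the source. *)
Lemma proper_map_annuli n N (r rho : R) (f : 'cV[C]_n -> 'cV[C]_N) :
  0 < r -> 0 < rho -> (forall z : 'cV[C]_n, annulus r z -> f @ z --> f z) ->
  (forall z : 'cV[C]_n, annulus r z -> annulus rho (f z)) ->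
  (forall m1 m2, rho ^+ 2 < m1 -> m2 < 1 -> exists s t, [/\ r ^+ 2 < s, t < 1 &
     forall z : 'cV[C]_n, annulus r z -> m1 <= sqnorm (f z) <= m2 -> s <= sqnorm z <= t]) ->
  proper_map (annulus r) (annulus rho) f.
Proof.
move=> r0 rho0 fc fAB H; split.
- by apply: continuous_in_subspaceT => z /set_mem; apply: fc.
- by move=> _ [z Az <-]; apply: fAB.
move=> L LB Lc.
have [->|L0] := eqVneq L set0; first by rewrite preimage_set0 setI0; apply: compact0.
have /set0P L0' := L0.
have cont : {within L, continuous (@sqnorm R N)}.
  by apply: continuous_subspaceT => z; apply: continuous_sqnorm.
have [w1 /set_mem Lw1 min1] := compact_EVT_min L0' Lc cont.
have [w2 /set_mem Lw2 max2] := compact_EVT_max L0' Lc cont.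
have /annulusE -/(_ rho0)/andP[lt1 _] := LB _ Lw1.
have /annulusE -/(_ rho0)/andP[_ lt2] := LB _ Lw2.
have [s [t [rs t1 st]]] := H _ _ lt1 lt2.
move=> F FF FS.
have FE : F [set z : 'cV[C]_n | s <= sqnorm z <= t].
  apply: filterS FS => z [Az Lz]; apply: st => //.
  by rewrite min1 ?max2 //; apply/mem_set.
(* A cluster point exists in the shell; were f z outside the closed set L, continuity would keep a
   neighbourhood of z out of the preimage. *)
have [z [zE clz]] := @compact_shell R n s t F FF FE.
have Az : annulus r z.
  apply/annulusE => //; move: zE => /= /andP[z1 z2].
  by rewrite (lt_le_trans rs z1) (le_lt_trans z2 t1).
exists z; split=> //; split=> //=.
have Lcl : closed L by apply: compact_closed Lc; apply: norm_hausdorff.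
apply: contrapT => nLz.
have oL : nbhs (f z) (~` L) by apply: open_nbhs_nbhs; split=> //; apply: closed_openC.
by have [x [[_ Lx] /= nLx]] := clz _ _ FS (fc z Az _ oL).
Qed.

End ProperMaps.

(** * The parameters a and Q *)

Section StarParameters.
Variable R : realType.
Implicit Types r b a Q : R.

(* The determinant of the Gram matrix of the coefficients of 1, z_1 and z_1^2,
   divided by [Q]. *)
Definition star_det r b a Q :=
  (1 - b + Q * r ^+ 2) * (b - b * a ^+ 2 * (1 + r ^+ 2) - Q * (1 + r ^+ 2))
  + (1 - b) * a ^+ 2 * r ^+ 2 * (b * a ^+ 2 + Q).

(** What the analysis of a nonpolynomial map yields directly, and also what makes the star map work.
    The ranges for a and Q in the three cases are shown equivalent to it in [admissible_gt1],
    [admissible_eq1] and [admissible_lt1]. *)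
Definition admissible r b a Q : Prop :=
  [/\ 0 < a < 1, 0 < Q, 0 < 1 - b + Q * r ^+ 2 & star_det r b a Q = 0].

Lemma sqr_lt1 (x : R) : 0 < x -> x < 1 -> x ^+ 2 < 1.
Proof. by move=> x0 x1; rewrite expr2; nra. Qed.

(** As a polynomial in Q the determinant is a concave quadratic with discriminant [Q_disc]; hence
    its roots are [Q_plus] and [Q_minus]. *)
Lemma star_detE r b a Q : star_det r b a Q =
  - (r ^+ 4 + r ^+ 2) * Q ^+ 2 + Q_lin r b a * Q
  + (1 - b) * b * (1 - a ^+ 2) * (1 - a ^+ 2 * r ^+ 2).
Proof. by rewrite /star_det /Q_lin; ring. Qed.

Lemma Q_discE r b a : Q_disc r b a = Q_lin r b a ^+ 2
  + 4 * (r ^+ 4 + r ^+ 2) * ((1 - b) * b * (1 - a ^+ 2) * (1 - a ^+ 2 * r ^+ 2)).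
Proof. by rewrite /Q_disc /Q_lin; ring. Qed.

Lemma star_det_roots r b a Q : 0 < r -> star_det r b a Q = 0 ->
  0 <= Q_disc r b a /\ (Q = Q_plus r b a \/ Q = Q_minus r b a).
Proof.
move=> r0 E; have k0 : 0 < r ^+ 4 + r ^+ 2 by rewrite addr_gt0 ?exprn_gt0.
have dE : Q_disc r b a = (2 * (r ^+ 4 + r ^+ 2) * Q - Q_lin r b a) ^+ 2.
  apply/eqP; rewrite -subr_eq0; apply/eqP.
  transitivity (4 * (r ^+ 4 + r ^+ 2) * star_det r b a Q); last by rewrite E mulr0.
  by rewrite Q_discE star_detE; ring.
rewrite dE sqr_ge0 /Q_plus /Q_minus dE sqrtr_sqr; split=> //.
case: (ler0P (2 * (r ^+ 4 + r ^+ 2) * Q - Q_lin r b a)) => _; [right|left];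
  by field; rewrite gt_eqF.
Qed.

Lemma roots_star_det r b a Q : 0 < r -> 0 <= Q_disc r b a ->
  Q = Q_plus r b a \/ Q = Q_minus r b a -> star_det r b a Q = 0.
Proof.
move=> r0 d0; have k0 : 0 < r ^+ 4 + r ^+ 2 by rewrite addr_gt0 ?exprn_gt0.
have := sqr_sqrtr d0; rewrite {2}Q_discE star_detE /Q_plus /Q_minus.
move: (Num.sqrt _) (Q_lin _ _ _) => s L.
set k := r ^+ 4 + r ^+ 2 in k0 *; set c := (1 - b) * b * _ * _ => sE [] ->.
- transitivity ((L ^+ 2 + 4 * k * c - s ^+ 2) / (4 * k)).
    by field; rewrite gt_eqF.
  by rewrite sE subrr mul0r.
- transitivity ((L ^+ 2 + 4 * k * c - s ^+ 2) / (4 * k)).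
    by field; rewrite gt_eqF.
  by rewrite sE subrr mul0r.
Qed.

Lemma Q_plus_ge r b a : 0 < r -> Q_minus r b a <= Q_plus r b a.
Proof.
move=> r0; have k0 : 0 < r ^+ 4 + r ^+ 2 by rewrite addr_gt0 ?exprn_gt0.
rewrite /Q_plus /Q_minus ler_pM2r ?invr_gt0 ?mulr_gt0 //.
have := sqrtr_ge0 (Q_disc r b a); lra.
Qed.

Section Admissible.
Variables r b a Q : R.
Hypotheses (r01 : 0 < r < 1) (b0 : 0 < b) (adm : admissible r b a Q).

Let t := r ^+ 2.
Let A := a ^+ 2.
Let al := 1 - b + Q * t.
Let be := b * A + Q.
Let ga := b - Q * (1 + t).

Let t0 : 0 < t. Proof. by rewrite exprn_gt0 //; case/andP: r01. Qed.
Let t1 : t < 1.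
Proof. by case/andP: r01 => ra rb; apply: sqr_lt1. Qed.
Let A0 : 0 < A.
Proof. by case: adm => /andP[a0 _] *; rewrite exprn_gt0. Qed.
Let A1 : A < 1.
Proof. by case: adm => /andP[a0 a1] *; apply: sqr_lt1. Qed.
Let t10 : 0 < 1 + t. Proof. by apply: addr_gt0. Qed.
Let bA0 : 0 < b * A. Proof. by apply: mulr_gt0. Qed.
Let Q0 : 0 < Q. Proof. by case: adm. Qed.
Let al0 : 0 < al. Proof. by case: adm. Qed.
Let al_gt : 1 - b < al.
Proof. by have := mulr_gt0 Q0 t0; rewrite /al; lra. Qed.
Let be0 : 0 < be. Proof. by apply: addr_gt0 => //; apply: mulr_gt0. Qed.
Let E : al * (b - b * A * (1 + t) - Q * (1 + t)) + (1 - b) * A * t * be = 0.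
Proof. by case: adm. Qed.

Let T_ge0 : 1 <= b -> 0 <= b - b * A * (1 + t) - Q * (1 + t).
Proof.
move=> b1; rewrite -(pmulr_rge0 _ al0).
have -> : al * (b - b * A * (1 + t) - Q * (1 + t)) = (b - 1) * A * t * be.
  by rewrite -[LHS](addrK ((1 - b) * A * t * be)) E; ring.
by do 3 (apply: mulr_ge0; last exact: ltW); rewrite subr_ge0.
Qed.

(** For b >= 1 the determinant relation gives ga >= b A (1 + t). For b < 1, suppose g = - ga >= 0:
    the relation reads (1 - b) A t be = al (b A (1 + t) + g), but al > 1 - b while A t be <= b A (1
    + t) + g. *)
Lemma admissible_ga_gt0 : 0 < ga.
Proof.
have [b1|b1] := leP 1 b.
  have h := T_ge0 b1.
  have := mulr_gt0 bA0 t10.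
  by rewrite /ga; lra.
rewrite ltNge; apply/negP => g0; pose g := - ga.
have g0' : 0 <= g by rewrite oppr_ge0.
have lhs : (1 - b) * (b * A * (1 + t) + g) < al * (b * A * (1 + t) + g).
  by rewrite ltr_pM2r // (ltr_wpDr g0' (mulr_gt0 bA0 t10)).
have rhs : (1 - b) * A * t * be = al * (b * A * (1 + t) + g).
  by move/eqP: E; rewrite addrC addr_eq0 => /eqP ->; rewrite /g /ga; ring.
have : (1 - b) * A * t * be <= (1 - b) * (b * A * (1 + t) + g).
  have -> : (1 - b) * A * t * be = (1 - b) * (A * t * be) by ring.
  rewrite ler_pM2l ?subr_gt0 // -(ler_pM2r t10).
  have -> : A * t * be * (1 + t) = A * t * (b * A * (1 + t) + b + g).
    by rewrite /g /ga /be; ring.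
  have h1 : A * t <= 1 by rewrite mulr_ile1 ?ltW.
  have h2 : A * t * g <= 1 * g by rewrite ler_wpM2r.
  have h3 : A * t * (b * A * (1 + t)) <= t * (b * A * (1 + t)).
    by rewrite (ler_pM2r (mulr_gt0 bA0 t10)) ler_piMl // ltW.
  have h4 : 0 < b * A by rewrite mulr_gt0.
  have h5 : 0 <= t * g by rewrite mulr_ge0 // ltW.
  nra.
by rewrite rhs => /(lt_le_trans lhs); rewrite ltxx.
Qed.

(** Multiplied by ga the radicand is Q times the sum of ga and T, where T = ga - b A (1 + t) is the
    factor of al in the relation [E]. For b >= 1 one has ga > 0 and T >= 0; for b < 1 the
    contradiction found for ga repeats with h = - (ga + T) / 2. *)
Lemma admissible_de_gt0 : 0 < b * A + 2 * Q - b ^+ 2 * A / ga.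
Proof.
have g0 := admissible_ga_gt0.
suff h : 0 < 2 * b - b * A * (1 + t) - 2 * Q * (1 + t).
  rewrite subr_gt0 ltr_pdivrMr // -subr_gt0.
  have -> : (b * A + 2 * Q) * ga - b ^+ 2 * A = Q * (2 * b - b * A * (1 + t) - 2 * Q * (1 + t)).
    by rewrite /ga; ring.
  exact: mulr_gt0.
have [b1|b1] := leP 1 b.
  have h := T_ge0 b1.
  by move: g0; rewrite /ga; lra.
rewrite ltNge; apply/negP => h0.
pose h := Q * (1 + t) - b + b * A * (1 + t) / 2.
have h0' : 0 <= h by rewrite /h; lra.
have lhs : (1 - b) * (h + b * A * (1 + t) / 2) < al * (h + b * A * (1 + t) / 2).
  rewrite ltr_pM2r //; have := mulr_gt0 bA0 t10; lra.
have rhs : (1 - b) * A * t * be = al * (h + b * A * (1 + t) / 2).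
  by move/eqP: E; rewrite addrC addr_eq0 => /eqP ->; rewrite /h; field.
have : (1 - b) * A * t * be <= (1 - b) * (h + b * A * (1 + t) / 2).
  have -> : (1 - b) * A * t * be = (1 - b) * (A * t * be) by ring.
  rewrite ler_pM2l ?subr_gt0 // -(ler_pM2r t10).
  have -> : A * t * be * (1 + t) = A * t * (b * A * (1 + t) / 2 + b + h).
    by rewrite /h /be; field.
  have h1 : A * t <= 1 by rewrite mulr_ile1 ?ltW.
  have h2 : A * t * h <= 1 * h by rewrite ler_wpM2r.
  have h4 : 0 < b * A by rewrite mulr_gt0.
  have h3 : A * t * (b * A * (1 + t)) <= t * (b * A * (1 + t)).
    by rewrite (ler_pM2r (mulr_gt0 bA0 t10)) ler_piMl // ltW.
  have h5 : 0 <= t * h by rewrite mulr_ge0 // ltW.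
  have h6 : t * (b * A) <= 1 * (b * A) by rewrite ler_pM2r // ltW.
  nra.
by rewrite rhs => /(lt_le_trans lhs); rewrite ltxx.
Qed.

Lemma admissible_star_defined : star_defined r b a Q.
Proof.
split; rewrite -/t -/A //; first exact: admissible_ga_gt0; last exact: ltW.
exact/ltW/admissible_de_gt0.
Qed.

(* [b |1 + a z_1|^2 > Q (1 - |z|^2)] on the annulus, in terms of [Re z_1] *)
Lemma admissible_range u : 0 < b - Q + 2 * (a * b) * u + be * u ^+ 2.
Proof.
(* Completing the square leaves Q (b - b A - Q) / be as the minimum over u; its sign comes from the
   determinant relation in the form al (b - b A - Q) = t be (al - (1 - b) A). *)
have X0 : 0 < b - b * A - Q.
  rewrite -(pmulr_rgt0 _ al0).
  have -> : al * (b - b * A - Q) = t * be * (al - (1 - b) * A).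
    apply/eqP; rewrite -subr_eq0 -[X in _ == X]E; apply/eqP.
    by rewrite /be; ring.
  apply: mulr_gt0; first exact: mulr_gt0.
  rewrite subr_gt0; have [b1|b1] := leP 1 b.
    by apply: le_lt_trans al0; rewrite pmulr_lle0 // subr_le0.
  apply: (@lt_trans _ _ (1 - b)); first by rewrite gtr_pMr ?subr_gt0.
  by rewrite /al ltrDl mulr_gt0.
rewrite -(pmulr_rgt0 _ be0).
have -> : be * (b - Q + 2 * (a * b) * u + be * u ^+ 2) =
    (be * u + a * b) ^+ 2 + Q * (b - b * A - Q) by rewrite /be /A; ring.
by rewrite ltr_wpDl ?sqr_ge0 // mulr_gt0.
Qed.

End Admissible.

(** At b = 1 the determinant factors as Q r^2 (1 - a^2 (1 + r^2) - Q (1 + r^2)), and Q > 0 selects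
    the second factor. *)
Lemma admissible_eq1 r a Q : 0 < r < 1 ->
  admissible r 1 a Q <-> 0 < a < 1 / Num.sqrt (1 + r ^+ 2) /\ Q = 1 / (1 + r ^+ 2) - a ^+ 2.
Proof.
move=> /andP[r0 r1]; have t0 : 0 < r ^+ 2 by rewrite exprn_gt0.
have t10 : 0 < 1 + r ^+ 2 by rewrite addr_gt0.
have s0 : 0 < Num.sqrt (1 + r ^+ 2) by rewrite sqrtr_gt0.
have ltE : 0 < a -> (a < 1 / Num.sqrt (1 + r ^+ 2)) = (a ^+ 2 < 1 / (1 + r ^+ 2)).
  move=> a0; rewrite -{2}(sqr_sqrtr (ltW t10)) !div1r -exprVn.
  by rewrite ltr_pXn2r // ?qualifE /= ?invr_ge0 ltW.
split=> [[/andP[a0 a1] Q0 _ E]|[/andP[a0 aE] QE]].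
  have QE : Q = 1 / (1 + r ^+ 2) - a ^+ 2.
    have : Q * r ^+ 2 * (1 - a ^+ 2 * (1 + r ^+ 2) - Q * (1 + r ^+ 2)) = 0.
      by rewrite -[RHS]E /star_det; ring.
    move/eqP; rewrite mulf_eq0 (gt_eqF (mulr_gt0 Q0 t0)) /= => /eqP h.
    apply: (mulIf (lt0r_neq0 t10)); apply/eqP; rewrite -subr_eq0 -oppr_eq0.
    by apply/eqP; rewrite -[RHS]h; field; rewrite gt_eqF.
  by split=> //; rewrite a0 ltE // -subr_gt0 -QE.
move: aE; rewrite ltE // => aE.
have Q0 : 0 < Q by rewrite QE subr_gt0.
split=> //.
- rewrite a0 /=; rewrite -(@expr_lt1 _ 2) ?(ltW a0) //.
  by apply: lt_le_trans aE _; rewrite div1r invf_le1 // lerDl ltW.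
- by rewrite subrr add0r mulr_gt0.
by rewrite /star_det QE; field; rewrite gt_eqF.
Qed.

(** For 0 < a < 1 and b < 1 the leading coefficient of the quadratic in Q is negative and the
    constant term positive, so the roots have opposite signs and only the larger one is positive. *)
Lemma admissible_lt1 r b a Q : 0 < r < 1 -> 0 < b < 1 ->
  admissible r b a Q <-> 0 < a < 1 /\ Q = Num.max (Q_plus r b a) (Q_minus r b a).
Proof.
move=> /andP[r0 r1] /andP[b0 b1]; have t0 : 0 < r ^+ 2 by rewrite exprn_gt0.
have k0 : 0 < r ^+ 4 + r ^+ 2 by rewrite addr_gt0 ?exprn_gt0.
rewrite (max_idPl (Q_plus_ge b a r0)).
have key : 0 < a < 1 -> 0 <= Q_disc r b a /\ 0 < Q_plus r b a /\ Q_minus r b a < 0.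
  move=> /andP[a0 a1].
  have A1 : a ^+ 2 < 1 by apply: sqr_lt1.
  have rr1 : r ^+ 2 < 1 by apply: sqr_lt1.
  have c0 : 0 < (1 - b) * b * (1 - a ^+ 2) * (1 - a ^+ 2 * r ^+ 2).
    by rewrite !mulr_gt0 ?subr_gt0 //; apply: mulr_ilt1 => //; apply: exprn_ge0; apply: ltW.
  have dgt : Q_lin r b a ^+ 2 < Q_disc r b a.
    by rewrite Q_discE ltrDl mulr_gt0 // mulr_gt0.
  have d0 : 0 <= Q_disc r b a by apply: le_trans (ltW dgt); apply: sqr_ge0.
  have : `|Q_lin r b a| < Num.sqrt (Q_disc r b a).
    by rewrite -sqrtr_sqr ltr_sqrt //; apply: le_lt_trans dgt; apply: sqr_ge0.
  rewrite ltr_norml => /andP[l1 l2]; split=> //; rewrite /Q_plus /Q_minus; split.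
    by rewrite divr_gt0 ?mulr_gt0 // -ltrBlDr sub0r; lra.
  by rewrite pmulr_llt0 ?subr_lt0 // invr_gt0 mulr_gt0.
split=> [[a01 Q0 _ E]|[a01 ->]].
  have [d0 [Qp Qm]] := key a01; split=> //.
  by have [_ [//|QE]] := star_det_roots r0 E; move: Q0; rewrite QE ltNge (ltW Qm).
have [d0 [Qp Qm]] := key a01; split=> //.
  by rewrite addr_gt0 ?subr_gt0 // mulr_gt0.
by apply: roots_star_det => //; left.
Qed.


Section GreaterThanOne.
Variables r b a : R.
Hypotheses (r01 : 0 < r < 1) (b1 : 1 < b) (a0 : 0 < a).

Let t := r ^+ 2.
Let A := a ^+ 2.
Let r0 : 0 < r. Proof. by case/andP: r01. Qed.
Let t0 : 0 < t. Proof. by rewrite exprn_gt0. Qed.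
Let t10 : 0 < 1 + t. Proof. by apply: addr_gt0. Qed.
Let t1 : t < 1. Proof. by case/andP: r01 => ? ?; apply: sqr_lt1. Qed.
Let A0 : 0 < A. Proof. by rewrite exprn_gt0. Qed.
Let b0 : 0 < b. Proof. by apply: lt_trans b1. Qed.
Let m := (1 + t - b) - A * (t * (b * t + 2 * b - 1)).
Let c := (1 - b) * A * (b * A * t + (b - 1)).
Let c0 : c < 0.
Proof.
rewrite /c -mulrA nmulr_rlt0 ?subr_lt0 //.
by apply: mulr_gt0 => //; apply: addr_gt0; rewrite ?subr_gt0 // !mulr_gt0.
Qed.
Let w0 : 0 < t * (b * t + 2 * b - 1).
Proof. by apply: mulr_gt0 => //; have := mulr_gt0 b0 t0; have := b1; lra. Qed.

(* the substitution [Q = (b - 1) / r^2 + y] turns positivity of the first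
   radicand into [0 < y] *)
Let det_shift y : star_det r b a ((b - 1) / t + y) = - (t + t ^+ 2) * y ^+ 2 + m * y + c.
Proof. by rewrite /star_det /m /c -/t -/A; field; exact: lt0r_neq0. Qed.

Let disc_shift : Q_disc r b a = m ^+ 2 + 4 * (t + t ^+ 2) * c.
Proof. by rewrite /Q_disc /m /c /t /A; ring. Qed.

Let lin_shift : Q_lin r b a = m + 2 * (b - 1) * (1 + t).
Proof. by rewrite /Q_lin /m /t /A; ring. Qed.

(** In the shifted variable y > 0 the equation reads m y = (t + t^2) y^2 - c, with c < 0. *)
Lemma shift_m_gt0 Q : 0 < 1 - b + Q * r ^+ 2 -> star_det r b a Q = 0 -> 0 < m.
Proof.
move=> al0; pose y := Q - (b - 1) / t.
have bQ : b - 1 < Q * t by rewrite /t; lra.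
have y0 : 0 < y by rewrite subr_gt0 ltr_pdivrMr.
have -> : Q = (b - 1) / t + y by rewrite /y; ring.
rewrite det_shift => E; rewrite -(pmulr_lgt0 _ y0).
have : 0 <= (t + t ^+ 2) * y ^+ 2.
  by apply: mulr_ge0; [apply/ltW/addr_gt0; rewrite ?exprn_gt0|apply: sqr_ge0].
by move: E; have := c0; lra.
Qed.

(** The coefficient m decreases in a^2: it is below 1 + t - b everywhere and below 1 - b < 0 once a
    >= 1. *)
Lemma m_gt0_bounds : 0 < m -> b < 1 + t /\ a < 1.
Proof.
move=> m0; have Aw := mulr_gt0 A0 w0; split; first by move: m0; rewrite /m; lra.
rewrite ltNge; apply/negP => a1.
have A1 : 1 <= A by rewrite exprn_ege1.
have : t * (b * t + 2 * b - 1) <= A * (t * (b * t + 2 * b - 1)) by rewrite ler_peMl // ltW.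
have : t * 1 < t * (b * t + 2 * b - 1).
  by rewrite ltr_pM2l //; have := mulr_gt0 b0 t0; have := b1; lra.
by have := b1; move: m0; rewrite /m; lra.
Qed.

Let NN := b * r ^+ 4 + (b ^+ 2 - b + 1) * t - b + 1.
Let k := b * t + 1.
Let S := (b - 1) * b * (1 + t) * (b * t - b + 1).

(** The discriminant is quadratic in A = a^2. Completing the square shows that its smaller root in A
    is (NN - 2 r sqrt S) / (t k^2), the quantity under the outer root of [a_max]. *)
Let disc_k : k ^+ 2 * Q_disc r b a = (NN - t * k ^+ 2 * A) ^+ 2 - 4 * t * S.
Proof. by rewrite /Q_disc /NN /k /S /t /A; ring. Qed.

Hypotheses (bt : 0 < b * t - b + 1) (b_lt : b < 1 + t).

Let k0 : 0 < k. Proof. by have := mulr_gt0 b0 t0; rewrite /k; lra. Qed.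
Let S0 : 0 < S.
Proof. by do 3 (apply: mulr_gt0 => //); rewrite ?subr_gt0 ?addr_gt0. Qed.
Let rS : 2 * r * Num.sqrt S = Num.sqrt (4 * t * S).
Proof.
have -> : 4 * t * S = (2 * r) ^+ 2 * S by rewrite /t; ring.
rewrite [in RHS]sqrtrM; last exact: sqr_ge0.
by rewrite sqrtr_sqr ger0_norm //; apply: mulr_ge0 => //; apply: ltW.
Qed.

Let a_max_le : (a <= a_max r b) = (2 * r * Num.sqrt S <= NN - t * k ^+ 2 * A).
Proof.
have d0 : 0 < t * k ^+ 2 by rewrite mulr_gt0 ?exprn_gt0.
have dE : b ^+ 2 * r ^+ 6 + 2 * b * r ^+ 4 + r ^+ 2 = t * k ^+ 2 by rewrite /k /t; ring.
rewrite /a_max dE -/t -/NN -/S.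
set X := NN - _.
have -> : (2 * r * Num.sqrt S <= NN - t * k ^+ 2 * A) = (A <= X / (t * k ^+ 2)).
  rewrite ler_pdivlMr // /X; apply/idP/idP; lra.
apply/idP/idP => [h|h].
  have X0 : 0 <= X / (t * k ^+ 2).
    by rewrite leNgt; apply/negP => /ltW/ler0_sqrtr X0; move: h; rewrite X0 leNgt a0.
  by rewrite /A -(sqr_sqrtr X0) ler_pXn2r // ?qualifE /= ?sqrtr_ge0 // ltW.
rewrite -[leLHS]ger0_norm ?(ltW a0) // -sqrtr_sqr ler_wsqrtr //.
Qed.

(** The discriminant is nonnegative on two ranges of a^2, below its smaller root and above its
    larger one. The zero of m lies strictly between the roots, so m > 0 selects the lower range. *)
Lemma a_max_iff : (a <= a_max r b) <-> 0 < m /\ 0 <= Q_disc r b a.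
Proof.
rewrite a_max_le rS.
have k20 : 0 < k ^+ 2 by rewrite exprn_gt0.
have s0 : 0 < 4 * t * S by do 2 apply: mulr_gt0 => //.
have d0 : 0 < t * k ^+ 2 by rewrite mulr_gt0.
pose A' := (1 + t - b) / (t * (b * t + 2 * b - 1)).
have mE : m = (A' - A) * (t * (b * t + 2 * b - 1)).
  by rewrite mulrBl divfK ?gt_eqF.
have A'0 : 0 < A' by rewrite divr_gt0 ?subr_gt0.
(* the discriminant is negative at the value [A'] of [a^2] where [m] vanishes *)
have key : `|NN - t * k ^+ 2 * A'| < Num.sqrt (4 * t * S).
  rewrite -sqrtr_sqr ltr_sqrt // -subr_lt0.
  have -> : (NN - t * k ^+ 2 * A') ^+ 2 - 4 * t * S =
     k ^+ 2 * ((1 + t - b - A' * (t * (b * t + 2 * b - 1))) ^+ 2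
      + 4 * (t + t ^+ 2) * ((1 - b) * A' * (b * A' * t + (b - 1)))).
    by rewrite /NN /k /S /t; ring.
  rewrite divfK ?gt_eqF // subrr expr0n add0r pmulr_rlt0 // pmulr_rlt0; last first.
    by rewrite mulr_gt0 // addr_gt0 // exprn_gt0.
  rewrite -mulrA nmulr_rlt0 ?subr_lt0 // mulr_gt0 // addr_gt0 ?subr_gt0 //.
  by do 2 apply: mulr_gt0 => //.
split=> [h|[m0 d]].
  have d : 0 <= Q_disc r b a.
    rewrite -(pmulr_rge0 _ k20) disc_k subr_ge0 -[leLHS](sqr_sqrtr (ltW s0)).
    by rewrite ler_pXn2r // ?qualifE /= ?sqrtr_ge0 // (le_trans _ h) // sqrtr_ge0.
  split=> //; rewrite ltNge; apply/negP => m0.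
  have A'A : A' <= A.
    by move: m0; rewrite mE pmulr_lle0 // subr_le0.
  have := key; rewrite ltr_norml => /andP[_].
  by have := ler_wpM2l (ltW d0) A'A; lra.
have A'A : A < A' by move: m0; rewrite mE pmulr_lgt0 // subr_gt0.
have := key; rewrite ltr_norml => /andP[h _].
move: d; rewrite -(pmulr_rge0 _ k20) disc_k subr_ge0 => d.
have : Num.sqrt (4 * t * S) <= `|NN - t * k ^+ 2 * A| by rewrite -sqrtr_sqr ler_wsqrtr.
rewrite ler_normr => /orP[//|].
have := ltr_pM2l d0 A A'; rewrite A'A => h2; lra.
Qed.

(** In the shifted variable the discriminant is m^2 + 4 (t + t^2) c with c < 0, so its root is
    smaller than m and both solutions y are positive: this is why either value of Q is allowed. *)
Lemma admissible_gt1 Q : admissible r b a Q <->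
  a <= a_max r b /\ (Q = Q_plus r b a \/ Q = Q_minus r b a).
Proof.
split=> [[_ Q0 al0 E]|[/a_max_iff[m0 d] QE]].
  have [d QE] := star_det_roots r0 E; split=> //.
  by apply/a_max_iff; split=> //; apply: shift_m_gt0 E.
have [_ a1] := m_gt0_bounds m0.
have k0' : 0 < r ^+ 4 + r ^+ 2 by rewrite addr_gt0 ?exprn_gt0.
have dm : Num.sqrt (Q_disc r b a) < m.
  rewrite -[ltRHS]ger0_norm ?(ltW m0) // -sqrtr_sqr ltr_sqrt ?exprn_gt0 //.
  rewrite disc_shift gtrDl pmulr_rlt0 //.
  by apply: mulr_gt0 => //; apply: addr_gt0 => //; apply: exprn_gt0.
have s0 := sqrtr_ge0 (Q_disc r b a).
have al0 : 0 < 1 - b + Q * r ^+ 2.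
  have h : 0 < 2 * (1 + t) by apply: mulr_gt0.
  rewrite -(pmulr_lgt0 _ h).
  have k0'' : r ^+ 4 + r ^+ 2 = t * (1 + t) by rewrite /t; ring.
  have -> : (1 - b + Q * r ^+ 2) * (2 * (1 + t)) =
      Q * (2 * (r ^+ 4 + r ^+ 2)) - 2 * (b - 1) * (1 + t).
    by rewrite k0'' -/t; ring.
  case: QE => ->; rewrite /Q_plus /Q_minus divfK ?gt_eqF ?mulr_gt0 // lin_shift; lra.
have b1' := b1.
split=> //; first by rewrite a0.
- by rewrite -(pmulr_lgt0 _ t0); move: al0; rewrite -/t; lra.
exact: roots_star_det.
Qed.

End GreaterThanOne.

(** The absence of poles in the annulus gives only a <= 1; the value a = 1 is excluded by the
    determinant. *)
Lemma admissible_of_le1 r b a Q : 0 < r < 1 -> 0 < b -> 0 < a <= 1 -> 0 < Q ->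
  0 < 1 - b + Q * r ^+ 2 -> star_det r b a Q = 0 -> admissible r b a Q.
Proof.
move=> r01 b0 /andP[a0 a1] Q0 al0 E; split=> //; rewrite a0 /=.
have [b1|b1|bE] := ltgtP 1 b.
- by have [] := m_gt0_bounds r01 b1 a0 (shift_m_gt0 r01 b1 a0 al0 E).
- move: a1; rewrite le_eqVlt => /orP[/eqP aE|//].
  (* With t = r^2, the determinant at a = 1 is - (1 - b) Q - b Q t^2 - Q^2 t (1 + t), which is
     negative. *)
  move: E; rewrite aE /star_det expr1n !mulr1 => E.
  have t0 : 0 < r ^+ 2 by rewrite exprn_gt0; case/andP: r01.
  have p1 := mulr_gt0 b0 t0; have p2 := mulr_gt0 Q0 t0; have b1' : 0 < 1 - b by rewrite subr_gt0.
  have p3 := mulr_gt0 p2 p1; have p4 := mulr_gt0 p2 Q0; have p5 := mulr_gt0 p4 t0.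
  have p6 := mulr_gt0 p2 p2.
  have p7 := mulr_gt0 b1' Q0.
  exfalso; move: E p3 p4 p5 p6 p7; move: (r ^+ 2) t0 p1 p2 => t t0 p1 p2; nra.
have t0 : 0 < r ^+ 2 by rewrite exprn_gt0; case/andP: r01.
have : Q * r ^+ 2 * (1 - a ^+ 2 * (1 + r ^+ 2) - Q * (1 + r ^+ 2)) = 0.
  by rewrite -[RHS]E /star_det -bE; ring.
move/eqP; rewrite mulf_eq0 (gt_eqF (mulr_gt0 Q0 t0)) /= => /eqP h.
have p1 := mulr_gt0 Q0 t0; have : a ^+ 2 < 1 by nra.
by rewrite ltNge => h2; rewrite ltNge; apply: contra h2 => ?; rewrite exprn_ege1.
Qed.

End StarParameters.

(** * The model maps *)

Section PolynomialFunctions.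
Variables (K : numClosedFieldType) (n : nat).

Definition poly_fun d (g : 'cV[K]_n -> K) :=
  exists P : mpoly n K, (msize P <= d.+1)%N /\ forall z, peval P z = g z.

Lemma poly_fun_cst c : poly_fun 0 (fun=> c).
Proof.
exists (mpolyC n c); split=> [|z]; last by rewrite /peval mevalC.
by rewrite msizeC; case: (_ != _).
Qed.

Lemma poly_fun_coord i : poly_fun 1 (fun z => z i 0).
Proof.
exists (mpolyX K (mnm1 i)); split=> [|z]; last by rewrite /peval mevalXU.
by rewrite msizeX mdeg1.
Qed.

Lemma poly_funW d e g : (d <= e)%N -> poly_fun d g -> poly_fun e g.
Proof. by move=> de [P [Pd PE]]; exists P; split=> //; apply: leq_trans Pd _. Qed.

Lemma poly_funD d g h : poly_fun d g -> poly_fun d h -> poly_fun d (fun z => g z + h z).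
Proof.
move=> [P [Pd PE]] [Q [Qd QE]]; exists (P + Q); split=> [|z].
  by apply: leq_trans (msizeD_le _ _) _; rewrite geq_max Pd.
by rewrite -PE -QE /peval mevalD.
Qed.

Lemma poly_funM d e g h : poly_fun d g -> poly_fun e h ->
  poly_fun (d + e) (fun z => g z * h z).
Proof.
move=> [P [Pd PE]] [Q [Qd QE]]; exists (P * Q); split=> [|z]; last first.
  by rewrite -PE -QE /peval mevalM.
have [->|P0] := eqVneq P 0; first by rewrite mul0r msize0.
have [->|Q0] := eqVneq Q 0; first by rewrite mulr0 msize0.
rewrite msizeM //; move: (mmeasure _ P) (mmeasure _ Q) Pd Qd => a b; lia.
Qed.

Lemma poly_funX d g k : poly_fun d g -> poly_fun (d * k) (fun z => g z ^+ k).
Proof.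
move=> hg; elim: k => [|k IH].
  by rewrite muln0; apply: (poly_fun_cst 1).
rewrite mulnS; under eq_fun do rewrite exprS; exact: poly_funM.
Qed.

Lemma poly_fun_prod (I : Type) (s : seq I) (d : I -> nat) (g : I -> 'cV[K]_n -> K) :
  (forall i, poly_fun (d i) (g i)) ->
  poly_fun (\sum_(i <- s) d i) (fun z => \prod_(i <- s) g i z).
Proof.
move=> hg; elim: s => [|i s IH].
  have -> : (fun z => \prod_(i <- [::]) g i z) = fun=> 1.
    by apply/funext => z; rewrite big_nil.
  by rewrite big_nil; apply: poly_fun_cst.
have -> : (fun z => \prod_(j <- i :: s) g j z) = fun z => g i z * \prod_(j <- s) g j z.
  by apply/funext => z; rewrite big_cons.
by rewrite big_cons; apply: poly_funM.
Qed.

Lemma poly_funZ d c g : poly_fun d g -> poly_fun d (fun z => c * g z).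
Proof. by move=> hg; rewrite -[d]add0n; apply: (poly_funM (poly_fun_cst c) hg). Qed.

Lemma poly_fun_linear k (l : 'M[K]_(k, n)) j : poly_fun 1 (fun z => (l *m z) j 0).
Proof.
have -> : (fun z : 'cV[K]_n => (l *m z) j 0) = (fun z => \sum_i l j i * z i 0).
  by apply/funext => z; rewrite mxE.
have cl i : poly_fun 1 (fun z : 'cV[K]_n => l j i * z i 0).
  by apply: poly_funZ; apply: poly_fun_coord.
have [P hP] := fin_all_exists cl.
exists (\sum_i P i); split=> [|z]; last first.
  by rewrite /peval raddf_sum; apply: eq_bigr => i _; apply: (hP i).2.
apply: leq_trans (msize_sum _ _ _) _; apply/bigmax_leqP => i _; exact: (hP i).1.
Qed.

Lemma poly_fun_on_lines m (g : 'cV[K]_n -> 'cV[K]_m) :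
  (forall j, poly_fun 2 (fun z => g z j 0)) -> quadratic_on_lines g.
Proof.
move=> /fin_all_exists[P hP]; have [F FE] := quadmap_mpoly (fun j => (hP j).1).
have gE z : g z = qeval F z.
  by rewrite FE; apply/matrixP => i j; rewrite !ord1 [RHS]mxE; have [_ ->] := hP i.
move=> z v; have [A0 [A1 [A2 E]]] := qeval_on_lines F z v; exists A0, A1, A2 => t.
by rewrite gE.
Qed.

End PolynomialFunctions.

Section UnitaryNormalForm.
Variables (K : numClosedFieldType) (n N M : nat).

Lemma kernel_eq_of_norm (p : 'cV[K]_n -> 'cV[K]_N) (g : 'cV[K]_n -> 'cV[K]_M) :
  quadratic_on_lines p -> quadratic_on_lines g ->
  (forall z, dot (p z) (p z) = dot (g z) (g z)) ->
  forall z w, dot (p z) (p w) = dot (g z) (g w).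
Proof.
move=> hp hg E z w; apply/eqP; rewrite -subr_eq0; apply/eqP.
apply: (polarization (H := fun z w => dot (p z) (p w) - dot (g z) (g w))).
  move=> x y; have := kernel_on_linesD (kernel_on_lines_dot hp hp)
    (kernel_on_linesZ (-1) (kernel_on_lines_dot hg hg)).
  by move=> /(_ x y)[c cE]; exists c => s t; rewrite -cE mulN1r.
by move=> x; rewrite E subrr.
Qed.

Lemma quadratic_on_lines_mulmx m (g : 'cV[K]_n -> 'cV[K]_m) (V : 'M[K]_n) :
  quadratic_on_lines g -> quadratic_on_lines (fun z => g (V *m z)).
Proof.
move=> hg z v; have [A0 [A1 [A2 E]]] := hg (V *m z) (V *m v).
by exists A0, A1, A2 => t; rewrite -E mulmxDr -scalemxAr.
Qed.

End UnitaryNormalForm.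

Section ListMaps.
Variables (R : realType) (n : nat).
Local Notation C := (R[i] : numClosedFieldType).

Definition seq_map M (G : seq C -> seq C) (z : 'cV[C]_n) : 'cV[C]_M :=
  col_of_seq M (G (coords z)).

(** A linear functional on lists. The weights are indexed by all of [nat], so that concatenation
    only shifts them and no casts between finite index types arise. *)
Definition wsum (w : nat -> C) (s : seq C) := \sum_(j < size s) w j * s`_j.

Lemma wsum_cat w s1 s2 : wsum w (s1 ++ s2) = wsum w s1 + wsum (fun j => w (size s1 + j)%N) s2.
Proof.
rewrite /wsum size_cat big_split_ord /=; congr (_ + _); apply: eq_bigr => j _.
  by rewrite nth_cat ltn_ord.
by rewrite nth_cat ltnNge leq_addr /= addKn.
Qed.

Lemma wsum_map w c s : wsum w [seq c * x | x <- s] = c * wsum w s.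
Proof.
rewrite /wsum size_map mulr_sumr; apply: eq_bigr => j _.
by rewrite (nth_map 0) // mulrCA.
Qed.

Lemma dot_seq_map M G (z : 'cV[C]_n) : size (G (coords z)) = M ->
  dot (seq_map M G z) (seq_map M G z) = \sum_(x <- G (coords z)) x * Num.conj x.
Proof.
move=> sz; rewrite /dot (big_nth 0) big_mkord sz; apply: eq_bigr => j _.
by rewrite mxE.
Qed.

Definition conj_coef M (w : 'cV[C]_M) (j : nat) : C :=
  if insub j is Some i then Num.conj (w i 0) else 0.

Lemma wsum_seq_map M G (w : 'cV[C]_M) (z : 'cV[C]_n) : size (G (coords z)) = M ->
  dot (seq_map M G z) w = wsum (conj_coef w) (G (coords z)).
Proof.
move=> sz; rewrite /wsum sz; apply: eq_bigr => j _.
by rewrite mxE /conj_coef valK mulrC.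
Qed.

Lemma seq_map_eq0 M (w : 'cV[C]_M) :
  (forall j, (j < M)%N -> conj_coef w j = 0) -> w = 0.
Proof.
move=> H; apply/matrixP => i j; rewrite ord1 mxE.
by have := H i (ltn_ord i); rewrite /conj_coef valK => /eqP; rewrite conjC_eq0 => /eqP.
Qed.

Lemma coords_col_of_seq (xs : seq C) : size xs = n -> coords (col_of_seq n xs) = xs.
Proof.
move=> sz; apply: (@eq_from_nth _ 0); first by rewrite size_coords.
move=> i; rewrite size_coords => ni; rewrite (nth_map (Ordinal ni)) ?size_enum_ord //.
by rewrite mxE nth_enum_ord.
Qed.

Lemma coords_nth (z : 'cV[C]_n) (i : 'I_n) : (coords z)`_i = z i 0.
Proof. by rewrite (nth_map i) ?size_enum_ord // nth_ord_enum. Qed.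

Lemma dot_coords (z : 'cV[C]_n) : dot z z = \sum_(x <- coords z) x * Num.conj x.
Proof. by rewrite big_map big_enum. Qed.

Lemma poly_fun_Hseq d k (xs : 'cV[C]_n -> seq C) j :
  (forall z, size (xs z) = k) -> (forall i, poly_fun 1 (fun z => (xs z)`_i)) ->
  poly_fun d (fun z => (Hseq d (xs z))`_j).
Proof.
move=> sz hx; have [js|js] := ltnP j #|multi_index k d|; last first.
  apply: (@poly_funW _ _ 0) => //.
  have -> : (fun z => (Hseq d (xs z))`_j) = fun=> 0; last exact: poly_fun_cst.
  by apply/funext => z; rewrite (HseqE d (sz z)) nth_default // size_map -cardE.
pose al := nth [tuple of nseq k ord0] (enum (multi_index k d)) j.
have alE : (\sum_(i < k) tnth al i)%N = d.
  have : al \in multi_index k d by rewrite -mem_enum mem_nth // -cardE.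
  by rewrite inE big_tuple => /eqP.
have -> : (fun z => (Hseq d (xs z))`_j) =
    fun z => (Num.sqrt (d`!%:R / (\prod_(i <- al) i`!)%N%:R))%:C *
       \prod_(i < k) (xs z)`_i ^+ tnth al i.
  apply/funext => z; rewrite (HseqE d (sz z)) (nth_map [tuple of nseq k ord0]) //.
  by rewrite -cardE.
apply: poly_funZ; rewrite -{1}alE.
have := @poly_fun_prod _ n _ (index_enum 'I_k) (fun i => tnth al i : nat)
  (fun i (z : 'cV[C]_n) => (xs z)`_i ^+ tnth al i); apply => i.
by rewrite -[X in poly_fun X]mul1n; apply: poly_funX.
Qed.

Lemma poly_fun_coords i : poly_fun 1 (fun z : 'cV[C]_n => (coords z)`_i).
Proof.
have [ni|ni] := ltnP i n.
  have -> : (fun z : 'cV[C]_n => (coords z)`_i) = fun z => z (Ordinal ni) 0.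
    by apply/funext => z; rewrite -(coords_nth z (Ordinal ni)).
  exact: poly_fun_coord.
apply: (@poly_funW _ _ 0) => //.
have -> : (fun z : 'cV[C]_n => (coords z)`_i) = fun=> 0; last exact: poly_fun_cst.
by apply/funext => z; rewrite nth_default // size_coords.
Qed.

Lemma wsum_Hseq_eq0 d w : (forall zs, size zs = n -> wsum w (Hseq d zs) = 0) ->
  forall j, (j < #|multi_index n d|)%N -> w j = 0.
Proof. exact: Hseq_independent. Qed.

Lemma poly_scale_eq0 (c0 c1 c2 : C) :
  (forall t : C, c0 + t * c1 + t ^+ 2 * c2 = 0) -> [/\ c0 = 0, c1 = 0 & c2 = 0].
Proof.
move=> H; have e0 := H 0; have e1 := H 1; have e2 := H (-1).
have n2 : (2 : C) != 0 by rewrite pnatr_eq0.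
rewrite expr0n !mul0r !addr0 in e0; rewrite e0 !add0r in e1 e2 *.
have c20 : c2 = 0.
  apply: (mulfI n2); transitivity ((1 * c1 + 1 ^+ 2 * c2) + (-1 * c1 + (-1) ^+ 2 * c2)).
    by ring.
  by rewrite e1 e2; ring.
by split=> //; move: e1; rewrite c20 mulr0 addr0 mul1r.
Qed.

End ListMaps.

Section Models.
Variable R : realType.
Local Notation C := (R[i] : numClosedFieldType).

Lemma conj_real (x : R) : Num.conj (x%:C : R[i]) = x%:C.
Proof. exact: conjc_real. Qed.

Lemma sum_norm_scale (c : C) (s : seq C) :
  \sum_(x <- [seq c * w | w <- s]) x * Num.conj x =
  c * Num.conj c * \sum_(x <- s) x * Num.conj x.
Proof.
by rewrite big_map mulr_sumr; apply: eq_bigr => x _; rewrite rmorphM /=; ring.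
Qed.

Lemma sqr_real_sqrt (x : R) : 0 <= x -> (Num.sqrt x)%:C ^+ 2 = x%:C :> R[i].
Proof. by move=> x0; rewrite -rmorphXn /= sqr_sqrtr. Qed.

Lemma card_multi_index k d : (0 < k)%N -> #|multi_index k d| = 'C(k.-1 + d, d).
Proof. by move=> k0; rewrite cardE -(size_map (fun=> 0 : R[i])) -[in RHS](size_nseq k (0 : R[i])) -size_Hseq ?size_nseq // /Hseq !size_map size_nseq. Qed.

Lemma size_HseqE k d (xs : seq C) : size xs = k -> size (Hseq d xs) = #|multi_index k d|.
Proof. by move=> sz; rewrite (HseqE d sz) size_map -cardE. Qed.

Section Juxtaposition.
Variables (t : R).

Lemma juxtaposition_norm (zs : seq C) : 0 <= t <= 1 ->
  \sum_(x <- juxtaposition_seq t zs) x * Num.conj x =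
  (1 - t)%:C * (\sum_(x <- zs) x * Num.conj x) + t%:C * (\sum_(x <- zs) x * Num.conj x) ^+ 2.
Proof.
move=> /andP[t0 t1]; rewrite /juxtaposition_seq big_cat /= !sum_norm_scale !Hseq_norm.
by rewrite !conj_real -!expr2 !sqr_real_sqrt ?subr_ge0 // expr1.
Qed.

(** Replacing z by s z separates the components of degree 1 from those of degree 2; within one
    degree the monomials are independent. *)
Lemma juxtaposition_spanning n M : (0 < n)%N -> M = ('C(n.+1, 2) + n)%N -> 0 < t < 1 ->
  spanning (@seq_map R n M (juxtaposition_seq t)).
Proof.
move=> n0 ME /andP[t0 t1] w Hw; apply: seq_map_eq0 => j jM.
move: Hw; move: (jM) => _ Hw; pose W := conj_coef w; rewrite -/W.
have sz (z : 'cV[C]_n) : size (juxtaposition_seq t (coords z)) = M.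
  by rewrite size_juxtaposition_seq size_coords.
have key zs : size zs = n -> wsum W (juxtaposition_seq t zs) = 0.
  move=> zn; rewrite -(coords_col_of_seq zn) -wsum_seq_map ?sz //.
  exact: Hw.
pose W2 j := W (#|multi_index n 1| + j)%N.
have key2 zs : size zs = n -> wsum W (Hseq 1 zs) = 0 /\ wsum W2 (Hseq 2 zs) = 0.
  move=> zn.
  have [_ e1 e2] : [/\ (0 : C) = 0, (Num.sqrt (1 - t))%:C * wsum W (Hseq 1 zs) = 0
     & (Num.sqrt t)%:C * wsum W2 (Hseq 2 zs) = 0].
    apply: poly_scale_eq0 => s; rewrite add0r.
    have zsn : size [seq s * x | x <- zs] = n by rewrite size_map.
    rewrite -[RHS](key _ zsn) /juxtaposition_seq wsum_cat !wsum_map.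
    have HZ d : Hseq d [seq s * x | x <- zs] = [seq s ^+ d * x | x <- Hseq d zs].
      rewrite (HseqE d zsn) (HseqE d zn) -map_comp; apply/eq_in_map => al.
      rewrite mem_enum inE big_tuple => /eqP alE /=.
      have -> : s ^+ d = \prod_(i < n) s ^+ tnth al i by rewrite prodrXr alE.
      rewrite mulrCA; congr (_ * _); rewrite -big_split; apply: eq_bigr => i _.
      by rewrite (nth_map 0) ?zn // exprMn.
    rewrite !HZ !wsum_map expr1 size_map size_map (size_HseqE 1 zn).
    by rewrite mulrCA [X in _ + X]mulrCA.
  split; apply/eqP.
    move/eqP: e1; rewrite mulf_eq0 => /orP[|//]; rewrite (inj_eq (@complexI R) _ 0).
    by rewrite gt_eqF // sqrtr_gt0 subr_gt0.
  move/eqP: e2; rewrite mulf_eq0 => /orP[|//]; rewrite (inj_eq (@complexI R) _ 0).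
  by rewrite gt_eqF // sqrtr_gt0.
have c1 : #|multi_index n 1| = n by rewrite card_multi_index // bin1 addn1 prednK.
have c2 : #|multi_index n 2| = 'C(n.+1, 2) by rewrite card_multi_index // addn2 prednK.
have [jn|jn] := ltnP j n.
  by apply: (wsum_Hseq_eq0 (fun zs zn => (key2 zs zn).1)); rewrite c1.
have -> : j = (#|multi_index n 1| + (j - n))%N by rewrite c1 subnKC.
apply: (wsum_Hseq_eq0 (w := W2) (fun zs zn => (key2 zs zn).2)).
by rewrite c2 ltn_subLR // addnC -ME.
Qed.

End Juxtaposition.

Lemma Hmap2_spanning n M : (0 < n)%N -> M = 'C(n.+1, 2) ->
  spanning (@seq_map R n M (Hseq 2)).
Proof.
move=> n0 ME w Hw; apply: seq_map_eq0 => j jM.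
move: Hw; move: (jM) => _ Hw; pose W := conj_coef w; rewrite -/W.
have c2 : #|multi_index n 2| = 'C(n.+1, 2) by rewrite card_multi_index // addn2 prednK.
apply: (wsum_Hseq_eq0 (n := n) (d := 2) (w := W)); last by rewrite c2 -ME.
move=> zs zn; rewrite -(coords_col_of_seq zn) -wsum_seq_map ?Hw //.
by rewrite (size_HseqE 2 (size_coords _)) c2.
Qed.

Section Star.
Variables (r b a Q : R).

Let al := 1 - b + Q * r ^+ 2.
Let be := b * a ^+ 2 + Q.
Let ga := b - Q * (1 + r ^+ 2).
Let de := b * a ^+ 2 + 2 * Q - b ^+ 2 * a ^+ 2 / ga.

Definition star_den (zs : seq C) : C := 1 + a%:C * head 0 zs.

Definition star_num (zs : seq C) : seq C :=
  let z1 := head 0 zs in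
  let z' := behead zs in
  [:: (Num.sqrt al)%:C + ((1 - b) * a / Num.sqrt al)%:C * z1;
      (Num.sqrt be)%:C * z1 ^+ 2 + (b * a / Num.sqrt be)%:C * z1]
  ++ [seq ((Num.sqrt ga)%:C + (b * a / Num.sqrt ga)%:C * z1) * w | w <- z']
  ++ [seq (Num.sqrt de)%:C * z1 * w | w <- z']
  ++ [seq (Num.sqrt Q)%:C * w | w <- Hseq 2 z'].

Lemma star_seqE zs : star_seq r b a Q zs = [seq x / star_den zs | x <- star_num zs].
Proof.
rewrite /star_seq /star_num !map_cat; congr (_ ++ (_ ++ (_ ++ _)));
  by rewrite -[RHS]map_comp; apply: eq_map => w /=; rewrite -mulrA [_^-1 * w]mulrC mulrA.
Qed.

Lemma size_star_num zs : (2 <= size zs)%N ->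
  size (star_num zs) = ('C((size zs).+1, 2) + size zs)%N.
Proof. by move=> h; rewrite -(size_star_seq r b a Q h) star_seqE size_map. Qed.

Hypotheses (r01 : 0 < r < 1) (b0 : 0 < b) (adm : admissible r b a Q).

Let a0 : 0 < a. Proof. by case: adm => /andP[]. Qed.
Let Q0 : 0 < Q. Proof. by case: adm. Qed.
Let al0 : 0 < al. Proof. by case: adm. Qed.
Let be0 : 0 < be. Proof. by apply: addr_gt0 => //; apply: mulr_gt0 => //; rewrite exprn_gt0. Qed.
Let ga0 : 0 < ga. Proof. exact: admissible_ga_gt0 adm. Qed.
Let de0 : 0 < de. Proof. exact: admissible_de_gt0 adm. Qed.

(** Expanded in z_1, its conjugate and the sum X of the other |z_j|^2, the coefficients agree by the
    choice of the radicands, with one exception: that of |z_1|^2 is the equation [e4], which is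
    exactly the vanishing of [star_det]. *)
Lemma star_num_norm zs : (0 < size zs)%N ->
  \sum_(x <- star_num zs) x * Num.conj x =
  let x := \sum_(x <- zs) x * Num.conj x in
  (1 - b%:C + b%:C * x) * (star_den zs * Num.conj (star_den zs))
  + Q%:C * (1 - x) * (r%:C ^+ 2 - x).
Proof.
case: zs => // u z' _.
pose sal := Num.sqrt al; pose sbe := Num.sqrt be; pose sga := Num.sqrt ga.
pose h := (1 - b) * a / sal; pose k2 := b * a / sbe; pose k3 := b * a / sga.
have sal0 : sal != 0 by rewrite gt_eqF // sqrtr_gt0.
have sbe0 : sbe != 0 by rewrite gt_eqF // sqrtr_gt0.
have sga0 : sga != 0 by rewrite gt_eqF // sqrtr_gt0.
have e1 : h * sal = (1 - b) * a by rewrite divfK.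
have e2 : k2 * sbe = b * a by rewrite divfK.
have e3 : k3 * sga = b * a by rewrite divfK.
have e4 : h ^+ 2 + k2 ^+ 2 = (1 - b) * a ^+ 2 + ga.
  rewrite !exprMn !exprVn !sqr_sqrtr ?(ltW al0) ?(ltW be0) //.
  have [_ _ _ E] := adm.
  apply/eqP; rewrite -subr_eq0; apply/eqP.
  transitivity (- Q * star_det r b a Q / (al * be)); last by rewrite E mulr0 mul0r.
  rewrite /star_det; move: (gt_eqF al0) (gt_eqF be0); rewrite /al /be /ga => n1 n2.
  by field; rewrite n1 n2.
have e5 : k3 ^+ 2 + de = b * a ^+ 2 + 2 * Q.
  rewrite !exprMn !exprVn !sqr_sqrtr ?(ltW ga0) // /de.
  by field; rewrite gt_eqF.
have {}e1 : h%:C * sal%:C = ((1 - b) * a)%:C :> R[i] by rewrite -e1 [RHS]rmorphM.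
have {}e2 : k2%:C * sbe%:C = (b * a)%:C :> R[i] by rewrite -e2 [RHS]rmorphM.
have {}e3 : k3%:C * sga%:C = (b * a)%:C :> R[i] by rewrite -e3 [RHS]rmorphM.
have {}e4 : h%:C ^+ 2 + k2%:C ^+ 2 = ((1 - b) * a ^+ 2 + ga)%:C :> R[i].
  by rewrite -e4 [RHS]rmorphD; congr (_ + _); rewrite [RHS]rmorphXn.
have {}e5 : k3%:C ^+ 2 + de%:C = (b * a ^+ 2 + 2 * Q)%:C :> R[i].
  by rewrite -e5 [RHS]rmorphD; congr (_ + _); rewrite [RHS]rmorphXn.
have s1 := sqr_real_sqrt (ltW al0); have s2 := sqr_real_sqrt (ltW be0).
have s3 := sqr_real_sqrt (ltW ga0); have s4 := sqr_real_sqrt (ltW de0).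
have s5 := sqr_real_sqrt (ltW Q0); rewrite -/sal -/sbe -/sga in s1 s2 s3.
rewrite /star_num /star_den /= !big_cons !big_cat /= -/sal -/sbe -/sga -/h -/k2 -/k3.
clearbody h k2 k3; clear sal0 sbe0 sga0; clearbody sal sbe sga.
rewrite !sum_norm_scale Hseq_norm.
set X := \sum_(x <- z') _.
rewrite !(rmorphD, rmorphM, rmorphXn) /= !conj_real ?rmorph1.
set v := Num.conj u.
transitivity (sal%:C ^+ 2 + (h%:C * sal%:C) * (u + v) + (h%:C ^+ 2 + k2%:C ^+ 2) * (u * v)
  + sbe%:C ^+ 2 * (u * v) ^+ 2 + (k2%:C * sbe%:C) * (u * v) * (u + v)
  + (sga%:C ^+ 2 + (k3%:C * sga%:C) * (u + v)
     + (k3%:C ^+ 2 + (Num.sqrt de)%:C ^+ 2) * (u * v)) * X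
  + (Num.sqrt Q)%:C ^+ 2 * X ^+ 2).
  by ring.
rewrite s1 s2 s3 s4 s5 e1 e2 e3 e4 e5 /al /be /ga.
rewrite !(rmorphXn, rmorphM, rmorphB, rmorphD, rmorph_nat, rmorph1) /=.
by ring.
Qed.

End Star.
End Models.

Section StarModel.
Variable R : realType.
Local Notation C := (R[i] : numClosedFieldType).

Lemma wsum_eq0 k (w : nat -> C) : (forall zs : seq C, size zs = k -> wsum w zs = 0) ->
  forall j, (j < k)%N -> w j = 0.
Proof.
move=> H j jk; rewrite -[RHS](H (mkseq (fun i => (i == j)%:R) k)) ?size_mkseq //.
rewrite /wsum size_mkseq (bigD1 (Ordinal jk)) //= nth_mkseq // eqxx mulr1.
rewrite big1 ?addr0 // => i ij; rewrite nth_mkseq //.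
by move: ij; rewrite -val_eqE /= => /negPf ->; rewrite mulr0.
Qed.

Lemma wsum2 w (x y : C) : wsum w [:: x; y] = w 0%N * x + w 1%N * y.
Proof. by rewrite /wsum !big_ord_recl big_ord0 addr0. Qed.


Variables (r b a Q : R).

Let al := 1 - b + Q * r ^+ 2.
Let be := b * a ^+ 2 + Q.
Let ga := b - Q * (1 + r ^+ 2).
Let de := b * a ^+ 2 + 2 * Q - b ^+ 2 * a ^+ 2 / ga.

Hypotheses (r01 : 0 < r < 1) (b0 : 0 < b) (adm : admissible r b a Q).

Let a0 : 0 < a. Proof. by case: adm => /andP[]. Qed.
Let a1 : a < 1. Proof. by case: adm => /andP[]. Qed.
Let Q0 : 0 < Q. Proof. by case: adm. Qed.
Let al0 : 0 < al. Proof. by case: adm. Qed.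
Let be0 : 0 < be. Proof. by apply: addr_gt0 => //; apply: mulr_gt0 => //; rewrite exprn_gt0. Qed.
Let ga0 : 0 < ga. Proof. exact: admissible_ga_gt0 adm. Qed.
Let de0 : 0 < de. Proof. exact: admissible_de_gt0 adm. Qed.
Let r0 : 0 < r. Proof. by case/andP: r01. Qed.

Lemma sqrt_neq0 (x : R) : 0 < x -> (Num.sqrt x)%:C != 0 :> R[i].
Proof. by move=> x0; rewrite (inj_eq (@complexI R) _ 0) gt_eqF // sqrtr_gt0. Qed.

(** Scaling z_2, ..., z_n by s separates the blocks by their degree in these variables, and powers
    of z_1 separate further. The multiple of the denominator is included because affine hyperplanes
    containing the image are relations <p, w> = c q; c = 0 gives spanning. *)
Lemma star_num_independent m (w : nat -> C) (c : C) : (0 < m)%N ->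
  (forall zs, size zs = m.+1 -> wsum w (star_num r b a Q zs) = c * star_den a zs) ->
  forall j, (j < 'C(m.+2, 2) + m.+1)%N -> w j = 0.
Proof.
move=> m0 H.
pose sal := (Num.sqrt al)%:C : R[i]; pose sbe := (Num.sqrt be)%:C : R[i].
pose sga := (Num.sqrt ga)%:C : R[i]; pose sde := (Num.sqrt de)%:C : R[i].
pose h := ((1 - b) * a / Num.sqrt al)%:C : R[i].
pose k2 := (b * a / Num.sqrt be)%:C : R[i]; pose k3 := (b * a / Num.sqrt ga)%:C : R[i].
pose w2 j := w (2 + j)%N; pose w3 j := w2 (m + j)%N; pose w4 j := w3 (m + j)%N.
have key u z : size z = m ->
    [/\ w 0%N * (sal + h * u) + w 1%N * (sbe * u ^+ 2 + k2 * u) - c * (1 + a%:C * u) = 0,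
        (sga + k3 * u) * wsum w2 z + sde * u * wsum w3 z = 0
      & (Num.sqrt Q)%:C * wsum w4 (Hseq 2 z) = 0].
  move=> zm; apply: poly_scale_eq0 => s.
  have szm : size [seq s * x | x <- z] = m by rewrite size_map.
  have HZ : Hseq 2 [seq s * x | x <- z] = [seq s ^+ 2 * x | x <- Hseq 2 z].
    rewrite (HseqE 2 szm) (HseqE 2 zm) -map_comp; apply/eq_in_map => x.
    rewrite mem_enum inE big_tuple => /eqP alE /=.
    have -> : s ^+ 2 = \prod_(i < m) s ^+ tnth x i by rewrite prodrXr alE.
    rewrite mulrCA; congr (_ * _); rewrite -big_split; apply: eq_bigr => i _.
    by rewrite (nth_map 0) ?zm // exprMn.
  have := H (u :: [seq s * x | x <- z]); rewrite [size _]/= szm => /(_ erefl)/eqP.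
  have -> : star_num r b a Q (u :: [seq s * x | x <- z]) =
    [:: sal + h * u; sbe * u ^+ 2 + k2 * u] ++
    ([seq (sga + k3 * u) * x | x <- [seq s * x | x <- z]] ++
    ([seq sde * u * x | x <- [seq s * x | x <- z]] ++
     [seq (Num.sqrt Q)%:C * x | x <- Hseq 2 [seq s * x | x <- z]])) by [].
  rewrite -subr_eq0 => /eqP <-.
  rewrite !wsum_cat !wsum_map HZ !wsum_map !size_map zm.
  rewrite wsum2 /star_den /=.
  rewrite -[wsum w2 z]/(wsum (fun j => w (2 + j)%N) z).
  rewrite -[wsum w3 z]/(wsum (fun j => w (2 + (m + j))%N) z).
  rewrite -[wsum w4 _]/(wsum (fun j => w (2 + (m + (m + j)))%N) (Hseq 2 z)).
  by ring.
have [z0 z0m] : exists z0 : seq C, size z0 = m by exists (nseq m 0); rewrite size_nseq.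
have [e0 e1 e2] : [/\ w 0%N * sal - c = 0, w 0%N * h + w 1%N * k2 - c * a%:C = 0 & w 1%N * sbe = 0].
  apply: poly_scale_eq0 => u; have [E _ _] := key u z0 z0m.
  by rewrite -[RHS]E; ring.
have w1E : w 1%N = 0.
  by move/eqP: e2; rewrite mulf_eq0 (negPf (sqrt_neq0 be0)) orbF => /eqP.
have w0E : w 0%N = 0.
  have cE : c = w 0%N * sal by move/eqP: e0; rewrite subr_eq0 => /eqP.
  (* The first component would be a multiple of the denominator only if (1 - b) a = al a, and the
     difference of the two sides is - a Q r^2, which is nonzero. *)
  have : w 0%N * (- a * Q * r ^+ 2 / Num.sqrt al)%:C = 0.
    rewrite -[RHS]e1 w1E mul0r addr0 cE -[w 0%N * sal * _]mulrA -[RHS]mulrBr.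
    congr (_ * _); rewrite /h /sal -rmorphM -rmorphB /=; congr (_%:C).
    have s0 : Num.sqrt al != 0 by rewrite gt_eqF // sqrtr_gt0.
    apply: (mulIf s0); rewrite divfK // mulrBl divfK //.
    have -> : Num.sqrt al * a * Num.sqrt al = Num.sqrt al ^+ 2 * a by ring.
    by rewrite sqr_sqrtr ?(ltW al0) // /al; ring.
  move/eqP; rewrite mulf_eq0 (inj_eq (@complexI R) _ 0) => /orP[/eqP//|].
  rewrite lt_eqF // !mulNr oppr_lt0; apply: divr_gt0; last by rewrite sqrtr_gt0.
  by rewrite !mulr_gt0 ?exprn_gt0.
have lin z : size z = m -> wsum w2 z = 0 /\ wsum w3 z = 0.
  move=> zm.
  have [f0 f1 _] : [/\ sga * wsum w2 z = 0, k3 * wsum w2 z + sde * wsum w3 z = 0 & (0 : C) = 0].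
    by apply: poly_scale_eq0 => u; have [_ E _] := key u z zm; rewrite -[RHS]E; ring.
  have g0 : wsum w2 z = 0.
    by move/eqP: f0; rewrite mulf_eq0 (negPf (sqrt_neq0 ga0)) => /eqP.
  split=> //; move/eqP: f1; rewrite g0 mulr0 add0r mulf_eq0.
  by rewrite (negPf (sqrt_neq0 de0)) => /eqP.
have quad z : size z = m -> wsum w4 (Hseq 2 z) = 0.
  move=> zm; have [_ _ /eqP] := key 0 z zm.
  by rewrite mulf_eq0 (negPf (sqrt_neq0 Q0)) => /eqP.
case=> [|[|j]] // jM.
have [jm|jm] := ltnP j m; first by apply: (wsum_eq0 (w := w2)) jm => z /lin[].
rewrite -(subnKC jm); have [jm2|jm2] := ltnP (j - m) m.
  by apply: (wsum_eq0 (w := w3)) jm2 => z /lin[].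
rewrite -(subnKC jm2); apply: (wsum_Hseq_eq0 (w := w4) quad).
rewrite card_multi_index // addn2 prednK //.
by move: jM jm jm2; rewrite binS bin1 -!subnDA; clear -m j; lia.
Qed.

End StarModel.

Section PolyFunSeq.
Variables (R : realType) (n : nat).
Local Notation C := (R[i] : numClosedFieldType).

Lemma poly_fun_cat d k (s1 s2 : 'cV[C]_n -> seq C) : (forall z, size (s1 z) = k) ->
  (forall j, poly_fun d (fun z => (s1 z)`_j)) -> (forall j, poly_fun d (fun z => (s2 z)`_j)) ->
  forall j, poly_fun d (fun z => (s1 z ++ s2 z)`_j).
Proof.
move=> sz h1 h2 j; have [jk|jk] := ltnP j k.
  have -> : (fun z => (s1 z ++ s2 z)`_j) = (fun z => (s1 z)`_j); last exact: h1.
  by apply/funext => z; rewrite nth_cat sz jk.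
have -> : (fun z => (s1 z ++ s2 z)`_j) = (fun z => (s2 z)`_(j - k)); last exact: h2.
by apply/funext => z; rewrite nth_cat sz ltnNge jk.
Qed.

Lemma poly_fun_map d e (g : 'cV[C]_n -> C) (s : 'cV[C]_n -> seq C) :
  poly_fun d g -> (forall j, poly_fun e (fun z => (s z)`_j)) ->
  forall j, poly_fun (d + e) (fun z => [seq g z * w | w <- s z]`_j).
Proof.
move=> hg hs j; have -> : (fun z => [seq g z * w | w <- s z]`_j) = fun z => g z * (s z)`_j.
  apply/funext => z; have [js|js] := ltnP j (size (s z)); first by rewrite (nth_map 0).
  by rewrite !nth_default ?mulr0 // size_map.
exact: poly_funM.
Qed.

End PolyFunSeq.

Section StarMap.
Variables (R : realType) (m : nat) (r b a Q : R).
Local Notation C := (R[i] : numClosedFieldType).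
Local Notation n := m.+1.
Local Notation M := ('C(n.+1, 2) + n)%N.
Hypotheses (m0 : (0 < m)%N) (r01 : 0 < r < 1) (b0 : 0 < b) (adm : admissible r b a Q).

Let al := 1 - b + Q * r ^+ 2.
Let be := b * a ^+ 2 + Q.
Let ga := b - Q * (1 + r ^+ 2).
Let de := b * a ^+ 2 + 2 * Q - b ^+ 2 * a ^+ 2 / ga.
Let a0 : 0 < a. Proof. by case: adm => /andP[]. Qed.
Let a1 : a < 1. Proof. by case: adm => /andP[]. Qed.
Let Q0 : 0 < Q. Proof. by case: adm. Qed.
Let be0 : 0 < be. Proof. by apply: addr_gt0 => //; apply: mulr_gt0 => //; rewrite exprn_gt0. Qed.
Let r0 : 0 < r. Proof. by case/andP: r01. Qed.

Lemma coords_cons (z : 'cV[C]_n) : head 0 (coords z) = z 0 0.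
Proof. by rewrite -nth0 (coords_nth z ord0). Qed.

Definition star_p (z : 'cV[C]_n) : 'cV[C]_M := seq_map M (star_num r b a Q) z.
Definition star_q (z : 'cV[C]_n) : C := star_den a (coords z).

Lemma star_qE z : star_q z = 1 + a%:C * z 0 0.
Proof. by rewrite /star_q /star_den coords_cons. Qed.

Lemma star_mapE z : star_map M r b a Q z = (star_q z)^-1 *: star_p z.
Proof.
apply/matrixP => i j; rewrite !mxE star_seqE (nth_map 0) 1?mulrC //.
by rewrite size_star_num size_coords.
Qed.

Lemma size_star_num_coords (z : 'cV[C]_n) : size (star_num r b a Q (coords z)) = M.
Proof. by rewrite size_star_num size_coords. Qed.

Lemma star_p_norm z : dot (star_p z) (star_p z) =
  (1 - b%:C + b%:C * dot z z) * (star_q z * Num.conj (star_q z))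
  + Q%:C * (1 - dot z z) * (r%:C ^+ 2 - dot z z).
Proof.
rewrite dot_seq_map ?size_star_num_coords // (star_num_norm r01 b0 adm) ?size_coords //.
by rewrite -dot_coords.
Qed.

Lemma star_p_poly j : poly_fun 2 (fun z => star_p z j 0).
Proof.
have -> : (fun z => star_p z j 0) = fun z => (star_num r b a Q (coords z))`_j.
  by apply/funext => z; rewrite mxE.
have h0 : poly_fun 1 (fun z : 'cV[C]_n => head 0 (coords z)).
  have -> : (fun z : 'cV[C]_n => head 0 (coords z)) = fun z => (coords z)`_0.
    by apply/funext => z; rewrite nth0.
  exact: poly_fun_coords.
have hc c : poly_fun 1 (fun=> c : C) by apply: (@poly_funW _ _ 0) => //; apply: poly_fun_cst.
have hb i : poly_fun 1 (fun z : 'cV[C]_n => (behead (coords z))`_i).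
  have -> : (fun z : 'cV[C]_n => (behead (coords z))`_i) = fun z => (coords z)`_i.+1.
    by apply/funext => z; rewrite nth_behead.
  exact: poly_fun_coords.
have szb (z : 'cV[C]_n) : size (behead (coords z)) = m by rewrite size_behead size_coords.
rewrite /star_num; apply: (@poly_fun_cat _ _ _ 2) => //; last first.
  apply: (@poly_fun_cat _ _ _ m); first by move=> z; rewrite size_map.
    apply: (@poly_fun_map _ _ 1 1) => //; apply: poly_funD => //.
    exact: poly_funZ.
  apply: (@poly_fun_cat _ _ _ m); first by move=> z; rewrite size_map.
    by apply: (@poly_fun_map _ _ 1 1) => //; apply: poly_funZ.
  apply: (@poly_fun_map _ _ 0 2); first exact: poly_fun_cst.
  by move=> i; apply: (@poly_fun_Hseq R n 2 m _ i szb hb).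
case=> [|[|i]] /=.
- by apply: (@poly_funW _ _ 1) => //; apply: poly_funD => //; apply: poly_funZ.
- apply: poly_funD; first by apply: poly_funZ; apply: (@poly_funX _ _ 1 _ 2).
  by apply: (@poly_funW _ _ 1) => //; apply: poly_funZ.
under eq_fun do rewrite nth_nil.
by apply: (@poly_funW _ _ 1).
Qed.

Lemma star_p_on_lines : quadratic_on_lines star_p.
Proof. exact: poly_fun_on_lines star_p_poly. Qed.

Lemma star_p_independent (w : 'cV[C]_M) c :
  (forall z, dot (star_p z) w = c * star_q z) -> w = 0.
Proof.
move=> H; apply: seq_map_eq0.
apply: (star_num_independent r01 b0 adm (c := c) m0) => zs zsn.
have := H (col_of_seq n zs); rewrite wsum_seq_map ?size_star_num_coords //.
by rewrite /star_q coords_col_of_seq.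
Qed.

Lemma star_p_spanning : spanning star_p.
Proof.
by move=> w H; apply: (@star_p_independent w 0) => z; rewrite H mul0r.
Qed.

Lemma sqr_normc_star_q z : star_q z * Num.conj (star_q z) =
  (1 + 2 * a * complex.Re (z 0 0) + a ^+ 2 * (complex.Re (z 0 0) ^+ 2 + complex.Im (z 0 0) ^+ 2))%:C.
Proof.
rewrite star_qE; case: (z 0 0) => x y; apply/eqP; rewrite eq_complex /=.
by apply/andP; split; apply/eqP; ring.
Qed.

Definition star_qn (z : 'cV[C]_n) : R :=
  1 + 2 * a * complex.Re (z 0 0) + a ^+ 2 * (complex.Re (z 0 0) ^+ 2 + complex.Im (z 0 0) ^+ 2).

Lemma sqnorm_star_p z : sqnorm (star_p z) =
  (1 - b + b * sqnorm z) * star_qn z + Q * (1 - sqnorm z) * (r ^+ 2 - sqnorm z).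
Proof.
apply: (@complexI R); rewrite -dot_sqnorm star_p_norm sqr_normc_star_q dot_sqnorm.
rewrite -/(star_qn z) [in RHS]rmorphD; congr (_ + _).
  by rewrite [in RHS]rmorphM [in RHS]rmorphD [in RHS]rmorphB [in RHS]rmorphM.
by rewrite [in RHS]rmorphM [in RHS]rmorphM 2![in RHS]rmorphB rmorphXn.
Qed.

Lemma Re_coord_sqnorm k (z : 'cV[C]_k) i :
  complex.Re (z i 0) ^+ 2 + complex.Im (z i 0) ^+ 2 <= sqnorm z.
Proof.
rewrite /sqnorm (bigD1 i) //= lerDl.
by apply: sumr_ge0 => j _; rewrite addr_ge0 ?sqr_ge0.
Qed.

Lemma star_qn_ge z : sqnorm z <= 1 -> (1 - a) ^+ 2 <= star_qn z.
Proof.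
move=> z1; have := Re_coord_sqnorm z 0; rewrite /star_qn.
move: (complex.Re _) (complex.Im _) => x y h.
have x1 : -1 <= x by have := sqr_ge0 y; nra.
have h0 : 0 <= 1 - a by rewrite subr_ge0 ltW.
have h1 : 1 - a <= 1 + a * x by have := ler_wpM2l (ltW a0) x1; lra.
have : (1 - a) ^+ 2 <= (1 + a * x) ^+ 2 by rewrite ler_pXn2r // ?qualifE //= (le_trans h0 h1).
have : 0 <= a ^+ 2 * y ^+ 2 by rewrite mulr_ge0 ?sqr_ge0.
by move=> p q; apply: le_trans q _; rewrite -subr_ge0; move: p; congr (0 <= _); ring.
Qed.

Lemma star_qn_gt0 z : sqnorm z <= 1 -> 0 < star_qn z.
Proof. by move=> /star_qn_ge; apply: lt_le_trans; rewrite exprn_gt0 // subr_gt0. Qed.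

Lemma star_q_neq0 z : sqnorm z <= 1 -> star_q z != 0.
Proof.
move=> /star_qn_gt0 q0; apply/eqP => E; have := sqr_normc_star_q z.
rewrite E mul0r -/(star_qn z) => /(@complexI R 0)/esym/eqP.
by rewrite gt_eqF.
Qed.

Lemma sqnorm_star_map z : sqnorm z <= 1 -> sqnorm (star_map M r b a Q z) =
  1 - b + b * sqnorm z + Q * (1 - sqnorm z) * (r ^+ 2 - sqnorm z) / star_qn z.
Proof.
move=> z1; have q0 := star_qn_gt0 z1.
apply: (mulIf (lt0r_neq0 q0)); rewrite mulrDl divfK ?gt_eqF // -sqnorm_star_p.
apply: (@complexI R); rewrite rmorphM /= -!dot_sqnorm star_mapE dotZl dotZr.
rewrite -sqr_normc_star_q fmorphV /=.
have qn0 := star_q_neq0 z1; field; rewrite qn0 andbT.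
by rewrite conjC_eq0.
Qed.

(** This makes the cofactor in [star_map_norm_gt] positive. It follows from [admissible_range] at u
    = Re z_1, because |z|^2 >= u^2. *)
Lemma star_gap z : 0 < sqnorm z <= 1 -> Q * (1 - sqnorm z) < b * star_qn z.
Proof.
move=> /andP[z0 z1]; rewrite -subr_gt0.
have := admissible_range r01 b0 adm (complex.Re (z 0 0)) ; rewrite -/be.
have := Re_coord_sqnorm z 0; rewrite /star_qn.
move: (complex.Re _) (complex.Im _) => x y h h2; apply: lt_le_trans h2 _.
rewrite -subr_ge0 /be.
have -> : b * (1 + 2 * a * x + a ^+ 2 * (x ^+ 2 + y ^+ 2)) - Q * (1 - sqnorm z)
  - (b - Q + 2 * (a * b) * x + (b * a ^+ 2 + Q) * x ^+ 2) =
  b * (a ^+ 2 * y ^+ 2) + Q * (sqnorm z - x ^+ 2) by ring.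
apply: addr_ge0; apply: mulr_ge0; try exact: ltW.
  by rewrite mulr_ge0 ?sqr_ge0.
by rewrite subr_ge0; apply: le_trans h; rewrite lerDl sqr_ge0.
Qed.

End StarMap.

Section AnnulusPoints.
Variables (R : realType) (n : nat) (r : R).
Local Notation C := (R[i] : numClosedFieldType).
Hypothesis r01 : 0 < r < 1.
Let r0 : 0 < r. Proof. by case/andP: r01. Qed.

Lemma annulus_point (u : 'cV[C]_n) : sqnorm u = 1 -> forall s : R, r < s < 1 ->
  annulus r (s%:C *: u).
Proof.
move=> u1 s /andP[s1 s2]; apply/annulusE => //.
have s0 := lt_trans r0 s1.
rewrite sqnormZ u1 mulr1 /= expr0n addr0 sqr_lt1 // andbT.
by rewrite ltr_pXn2r ?qualifE /= ?(ltW r0) ?(ltW s0).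
Qed.

Lemma sqnorm_line (z d : 'cV[C]_n) : exists c : R, forall t : R,
  sqnorm (z + t%:C *: d) = sqnorm z + t * c + t ^+ 2 * sqnorm d.
Proof.
exists (\sum_i 2 * (complex.Re (z i 0) * complex.Re (d i 0) +
                    complex.Im (z i 0) * complex.Im (d i 0))) => t.
rewrite /sqnorm !mulr_sumr -!big_split; apply: eq_bigr => i _ /=; rewrite !mxE.
by case: (z i 0) (d i 0) => [x y] [u v] /=; ring.
Qed.

Lemma sqnorm_delta (i : 'I_n) : sqnorm (delta_mx i 0 : 'cV[C]_n) = 1.
Proof.
rewrite /sqnorm (bigD1 i) //= mxE eqxx /= big1 => [|j /negPf ij]; first by ring.
by rewrite mxE ij /= expr0n addr0.
Qed.

Lemma annulus_nonempty : (0 < n)%N -> exists z : 'cV[C]_n, annulus r z.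
Proof.
move=> n0; exists (((1 + r) / 2)%:C *: delta_mx (Ordinal n0) 0); apply/annulusE => //.
rewrite sqnormZ sqnorm_delta mulr1 /= expr0n addr0.
by case/andP: r01 => ra rb; apply/andP; split; nra.
Qed.

(* restrict to the complex line through [v] and a point of the annulus *)
Lemma mpoly_annulus_eq0 (p : mpoly n C) : (0 < n)%N ->
  (forall z, annulus r z -> peval p z = 0) -> p = 0.
Proof.
move=> n0 H; apply: meval_eq0 => v.
have [z0 /annulusE -/(_ r0)/andP[zr z1]] := annulus_nonempty n0.
pose z : 'cV[C]_n := \col_i v i.
have [P PE] := peval_line p z0 (z - z0).
have [c cE] := sqnorm_line z0 (z - z0).
(* The margin e and the slope bound k keep the points of parameter t in (0, d], d = e / k, inside
   the annulus; infinitely many of them then annihilate the restricted polynomial. *)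
pose e := Num.min (sqnorm z0 - r ^+ 2) (1 - sqnorm z0).
pose k := `|c| + sqnorm (z - z0) + 1.
have e0 : 0 < e by rewrite lt_min !subr_gt0 zr.
have k1 : 1 <= k by rewrite lerDr addr_ge0 ?sqnorm_ge0.
have k0 : 0 < k by apply: lt_le_trans k1.
pose d := e / k.
have d0 : 0 < d by rewrite divr_gt0.
have [e1 e2] : e <= sqnorm z0 - r ^+ 2 /\ e <= 1 - sqnorm z0.
  by rewrite !ge_min !lexx orbT.
have d1 : d <= 1.
  rewrite ler_pdivrMr // mul1r (le_trans _ k1) // (le_trans e2) // lerBlDr lerDl.
  exact: sqnorm_ge0.
have ann t : 0 < t <= d -> annulus r (z0 + t%:C *: (z - z0)).
  move=> /andP[t0 td]; apply/annulusE => //; rewrite cE.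
  have tk : t * k <= e by rewrite -ler_pdivlMr.
  have t1 : t <= 1 by apply: le_trans d1.
  have s0 := sqnorm_ge0 (z - z0).
  have : `|t * c + t ^+ 2 * sqnorm (z - z0)| < e.
    apply: lt_le_trans tk; apply: le_lt_trans (ler_normD _ _) _.
    rewrite !normrM (ger0_norm (ltW t0)) (ger0_norm s0).
    have : t ^+ 2 * sqnorm (z - z0) <= t * sqnorm (z - z0).
      by rewrite ler_wpM2r // expr2 ler_piMl // ltW.
    by rewrite /k !mulrDr mulr1; lra.
  rewrite ltr_norml => /andP[h1 h2]; apply/andP; split; lra.
pose f (i : nat) : C := (d / i.+1%:R)%:C.
have finj : injective f.
  move=> i j /(@complexI R)/(mulfI (lt0r_neq0 d0))/invr_inj/eqP.
  by rewrite eqr_nat eqSS => /eqP.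
have P0 : P = 0.
  apply: (poly_inj_eq0 finj) => i; rewrite -PE; apply: H; apply: ann.
  by rewrite divr_gt0 ?ltr0n //= ler_piMr ?(ltW d0) // invf_le1 ?ltr0n // ler1n.
have := PE 1; rewrite P0 horner0 => <-; apply: meval_eq => i.
by rewrite scale1r addrC subrK mxE.
Qed.

End AnnulusPoints.

Section StarProper.
Variables (R : realType) (m : nat) (r rho b a Q : R).
Local Notation C := (R[i] : numClosedFieldType).
Local Notation n := m.+1.
Local Notation M := ('C(n.+1, 2) + n)%N.
Let f : 'cV[C]_n -> 'cV[C]_M := @star_map R n M r b a Q.
Hypotheses (m0 : (0 < m)%N) (r01 : 0 < r < 1) (rho01 : 0 < rho < 1).
Hypotheses (b0 : 0 < b) (rhoE : rho ^+ 2 = 1 - b * (1 - r ^+ 2)).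
Hypothesis (adm : admissible r b a Q).

Let a0 : 0 < a. Proof. by case: adm => /andP[]. Qed.
Let a1 : a < 1. Proof. by case: adm => /andP[]. Qed.
Let Q0 : 0 < Q. Proof. by case: adm. Qed.
Let r0 : 0 < r. Proof. by case/andP: r01. Qed.
Let rho0 : 0 < rho. Proof. by case/andP: rho01. Qed.
Let be0 : 0 < b * a ^+ 2 + Q.
Proof. by apply: addr_gt0 => //; apply: mulr_gt0 => //; rewrite exprn_gt0. Qed.

Lemma star_map_continuous (z : 'cV[C]_n) : annulus r z ->
  f @ z --> f z.
Proof.
move=> /annulusE -/(_ r0)/andP[_ z1].
have [P hP] := fin_all_exists (star_p_poly (m := m) r b a Q).
have [q hq] : exists q : mpoly n C, forall z, peval q z = star_q a z.
  have h : poly_fun 1 (star_q a : 'cV[C]_n -> C).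
    have -> : (star_q a : 'cV[C]_n -> C) = fun z => 1 + a%:C * z 0 0.
      by apply/funext => x; rewrite star_qE.
    apply: poly_funD; first by apply: (@poly_funW _ _ 0) => //; apply: poly_fun_cst.
    by apply: poly_funZ; apply: poly_fun_coord.
  by have [q [_ qE]] := h; exists q.
apply: cvg_matrix => i j; rewrite ord1 {j}.
have E x : f x i 0 = (peval q x)^-1 * peval (P i) x.
  by rewrite /f star_mapE // mxE hq (hP i).2.
have -> : (fun x => f x i 0) = (fun x => (peval q x)^-1 * peval (P i) x).
  by apply/funext => x; rewrite E.
rewrite E; apply: (@cvg_mul C _ z (fun x => (peval q x)^-1) (fun x => peval (P i) x)).
  apply: (@cvgV C _ _ (nbhs_filter z) (fun x => peval q x)); last exact: continuous_peval.
  by rewrite hq; apply: (star_q_neq0 adm); apply: ltW.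
exact: continuous_peval.
Qed.

(** At each boundary sphere the norm identity factors: the distance of |f|^2 to the boundary value
    is that of |z|^2 times a cofactor. The cofactors give both the range of the map and its
    properness. *)
Lemma star_map_norm_lt1 (z : 'cV[C]_n) : r ^+ 2 < sqnorm z < 1 ->
  1 - sqnorm (star_map M r b a Q z) =
  (1 - sqnorm z) * (b + Q * (sqnorm z - r ^+ 2) / star_qn a z).
Proof.
move=> /andP[_ z1]; rewrite (sqnorm_star_map m0 r01 b0 adm) ?(ltW z1) //.
have q0 := star_qn_gt0 adm (ltW z1).
by field; rewrite gt_eqF.
Qed.

Lemma star_map_norm_gt (z : 'cV[C]_n) : r ^+ 2 < sqnorm z < 1 ->
  sqnorm (star_map M r b a Q z) - rho ^+ 2 =
  (sqnorm z - r ^+ 2) * (b - Q * (1 - sqnorm z) / star_qn a z).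
Proof.
move=> /andP[_ z1]; rewrite (sqnorm_star_map m0 r01 b0 adm) ?(ltW z1) // rhoE.
have q0 := star_qn_gt0 adm (ltW z1).
by field; rewrite gt_eqF.
Qed.

Lemma star_map_proper : proper_map (annulus r) (annulus rho) (@star_map R n M r b a Q).
Proof.
have rr0 : 0 < r ^+ 2 by rewrite exprn_gt0.
apply: proper_map_annuli => //.
- exact: star_map_continuous.
- move=> z /annulusE -/(_ r0) zA; apply/annulusE => //.
  have /andP[z1 z2] := zA; have q0 := star_qn_gt0 adm (ltW z2).
  rewrite -subr_gt0 star_map_norm_gt // -[X in _ && X]subr_gt0 star_map_norm_lt1 //.
  apply/andP; split; apply: mulr_gt0; rewrite ?subr_gt0 //.
    rewrite ltr_pdivrMr //; apply: (star_gap r01 b0 adm).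
    by rewrite (lt_trans rr0 z1) ltW.
  apply: addr_gt0 => //; apply: divr_gt0 => //; apply: mulr_gt0 => //.
  by rewrite subr_gt0.
move=> m1 m2 hm1 hm2.
have aa0 : 0 < (1 - a) ^+ 2 by rewrite exprn_gt0 // subr_gt0.
pose k := b + Q / (1 - a) ^+ 2.
have k0 : 0 < k by apply: addr_gt0 => //; apply: divr_gt0.
(* The bounds invert |f|^2 - rho^2 <= b (|z|^2 - r^2) and 1 - |f|^2 <= k (1 - |z|^2), where k uses
   |1 + a z_1| >= 1 - a. *)
exists (r ^+ 2 + (m1 - rho ^+ 2) / b), (1 - (1 - m2) / k); split.
- by rewrite ltrDl divr_gt0 // subr_gt0.
- by rewrite ltrBlDr ltrDl divr_gt0 // subr_gt0.
move=> z /annulusE -/(_ r0) zA /andP[f1 f2]; have /andP[z1 z2] := zA.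
have q0 := star_qn_gt0 adm (ltW z2); have qa := star_qn_ge adm (ltW z2).
apply/andP; split.
  rewrite -lerBrDl ler_pdivrMr //.
  apply: le_trans (_ : sqnorm (star_map M r b a Q z) - rho ^+ 2 <= _).
    by rewrite lerD2r.
  rewrite star_map_norm_gt // ler_pM2l ?subr_gt0 // lerBlDr lerDl.
  by rewrite divr_ge0 ?(ltW q0) // mulr_ge0 ?(ltW Q0) // subr_ge0 ltW.
rewrite lerBrDr -lerBrDl ler_pdivrMr //.
apply: le_trans (_ : 1 - sqnorm (star_map M r b a Q z) <= _).
  by rewrite lerD2l lerN2.
rewrite star_map_norm_lt1 // ler_pM2l ?subr_gt0 // /k lerD2l.
apply: ler_pM => //; first by rewrite mulr_ge0 ?(ltW Q0) // subr_ge0 ltW.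
- by rewrite invr_ge0 ltW.
- by rewrite -[leRHS]mulr1 ler_pM2l // lerBlDr (le_trans (ltW z2)) // lerDl ltW.
by rewrite lef_pV2 ?posrE.
Qed.

Lemma star_map_embedding : embedding_dim (annulus r) (@star_map R n M r b a Q) M.
Proof.
apply: embedding_dim_full => w c H.
have E (z : 'cV[C]_n) : annulus r z -> dot (star_p r b a Q z) w - c * star_q a z = 0.
  move=> Az; have /annulusE -/(_ r0)/andP[_ z1] := Az.
  have q0 : star_q a z != 0 by apply: (star_q_neq0 adm); apply: ltW.
  by rewrite -(H z Az) star_mapE // dotZl; field.
have [P hP] := fin_all_exists (star_p_poly (m := m) r b a Q).
pose p : mpoly n C := \sum_i mpolyC n (Num.conj (w i 0)) * P i
  - mpolyC n c * (mpolyC n 1 + mpolyC n a%:C * mpolyX C (mnm1 ord0)).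
have pE z : peval p z = dot (star_p r b a Q z) w - c * star_q a z.
  rewrite /peval mevalB !mevalM mevalD mevalM !mevalC mevalXU star_qE raddf_sum /=.
  congr (_ - _); apply: eq_bigr => i _.
  by rewrite mevalM mevalC mulrC -(hP i).2.
suff p0 : p = 0.
  apply: (star_p_independent m0 r01 b0 adm (c := c)) => z.
  by apply/eqP; rewrite -subr_eq0 -pE p0 /peval meval0.
by apply: (mpoly_annulus_eq0 r01) => // z Az; rewrite pE E.
Qed.

(** A nonconstant common divisor would be a constant multiple of the affine denominator, hence zero
    at z = (- 1/a, 0, ..., 0), where the numerator of the second component does not vanish. The same
    component, with its z_1^2 term, makes the degree 2. *)
Lemma star_map_lowest_terms :
  rational_of_degree (annulus r) (@star_map R n M r b a Q) 2.
Proof.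
have [P hP] := fin_all_exists (star_p_poly (m := m) r b a Q).
pose U : multinom n := mnm1 ord0.
pose q : mpoly n C := mpolyC n 1 + mpolyC n a%:C * mpolyX C U.
have qE z : peval q z = star_q a z.
  by rewrite /q /peval mevalD mevalM !mevalC mevalXU star_qE.
have aC : a%:C != 0 :> R[i] by rewrite (inj_eq (@complexI R) _ 0) gt_eqF.
have U0 : U != mnm0 by rewrite -mdeg_eq0 mdeg1.
have qU : mcoeff U q = a%:C.
  by rewrite /q mcoeffD mcoeffC (negPf U0) mulr0 add0r mcoeffCM mcoeffX eqxx mulr1.
have q0 : q != 0 by apply/eqP => q0; move: aC; rewrite -qU q0 mcoeff0 eqxx.
have szq : msize q = 2.
  apply/eqP; rewrite eqn_leq; apply/andP; split.
    apply: leq_trans (msizeD_le _ _) _; rewrite geq_max; apply/andP; split.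
      by rewrite msizeC; case: (_ != _).
    rewrite mul_mpolyC; apply: leq_trans (msizeZ_le _ _) _.
    by rewrite msizeX mdeg1.
  rewrite ltnNge; apply/negP => h; have := msize_mdeg_ge (m := U) (p := q).
  by rewrite mdeg1 => /(_ h); rewrite -mcoeff_eq0 qU (negPf aC).
have M2 : (1 < M)%N by apply: ltn_addl.
pose i1 : 'I_M := Ordinal M2.
pose sbe := (Num.sqrt (b * a ^+ 2 + Q))%:C : R[i].
pose k2 := (b * a / Num.sqrt (b * a ^+ 2 + Q))%:C : R[i].
have sbe0 : sbe != 0 by apply: sqrt_neq0.
have P1E z : peval (P i1) z = sbe * z ord0 0 ^+ 2 + k2 * z ord0 0.
  by rewrite (hP i1).2 mxE /= coords_cons.
have P1p : P i1 = mpolyC n sbe * mpolyX C (mnm_add U U) + mpolyC n k2 * mpolyX C U.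
  apply/eqP; rewrite -subr_eq0; apply/eqP/meval_eq0 => v.
  pose z : 'cV[C]_n := \col_i v i.
  have vz x : meval v x = peval x z by apply: meval_eq => i; rewrite mxE.
  rewrite vz /peval mevalB mevalD !mevalM !mevalC mpolyXD mevalM mevalXU.
  by rewrite -/(peval (P i1) z) P1E expr2 subrr.
have szP1 : msize (P i1) = 3.
  apply/eqP; rewrite eqn_leq (hP i1).1 ltnNge; apply/negP => h.
  have := msize_mdeg_ge (m := mnm_add U U) (p := P i1).
  rewrite mdegD mdeg1 => /(_ h); rewrite -mcoeff_eq0 P1p mcoeffD !mcoeffCM !mcoeffX eqxx.
  have -> : (U == mnm_add U U) = false.
    by apply/eqP => /(congr1 (@mdeg _)); rewrite mdegD mdeg1.
  by rewrite mulr0 addr0 mulr1 (negPf sbe0).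
exists P, q; split.
- split=> // d q' p' qd Pd.
  rewrite leqNgt; apply/negP => d2.
  have d0 : d != 0 by apply/eqP => d0; move: q0; rewrite qd d0 mul0r eqxx.
  have q'0 : q' != 0 by apply/eqP => q'0; move: q0; rewrite qd q'0 mulr0 eqxx.
  have := szq; rewrite qd msizeM // => sz.
  have q'1 : (msize q' <= 1)%N by move: d2 sz; set x := mmeasure _ d; set y := mmeasure _ q'; clearbody x y; clear; lia.
  have q'E := msize1_polyC q'1.
  have c0 : mcoeff mnm0 q' != 0.
    by apply/eqP => c0; move: q'0; rewrite q'E c0 mpolyC0 eqxx.
  pose z : 'cV[C]_n := - (a%:C)^-1 *: delta_mx ord0 0.
  have z0 : z ord0 0 = - (a%:C)^-1 by rewrite !mxE /= mulr1.
  have : peval q z = 0 by rewrite qE star_qE z0 mulrN divff // subrr.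
  rewrite qd /peval mevalM q'E mevalC => /eqP.
  rewrite mulf_eq0 (negPf c0) orbF => /eqP dz.
  have : peval (P i1) z = 0 by rewrite Pd /peval mevalM dz mul0r.
  rewrite P1E z0 => /(congr1 (fun x => sbe * x * a%:C ^+ 2)); rewrite mulr0 mul0r.
  have cancel (s k x : R[i]) : x != 0 ->
      s * (s * (- x^-1) ^+ 2 + k * - x^-1) * x ^+ 2 = s ^+ 2 - (s * k) * x.
    by move=> x0; field.
  rewrite (cancel _ _ _ aC).
  (* After clearing factors, the value of the second numerator at the pole is b a^2 + Q - b a^2 = Q
     > 0. *)
  have sk : sbe * k2 = (b * a)%:C.
    by rewrite /sbe /k2 -rmorphM /= mulrC divfK // gt_eqF // sqrtr_gt0.
  rewrite sk /sbe sqr_real_sqrt ?(ltW be0) // -rmorphM -rmorphB /= => /(@complexI R _ 0)/eqP.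
  have -> : b * a ^+ 2 + Q - b * a * a = Q by ring.
  by rewrite gt_eqF.
- move=> z /annulusE -/(_ r0)/andP[_ z1].
  have qz : star_q a z != 0 by apply: (star_q_neq0 adm); apply: ltW.
  split=> [|j]; first by rewrite qE.
  by rewrite qE star_mapE // mxE mulrC (hP j).2.
rewrite szq /=; apply/esym/eqP; rewrite eqn_leq geq_max /=; apply/andP; split.
  by apply/bigmax_leqP => i _; have := (hP i).1; case: (mmeasure _ (P i)).
apply: leq_trans (leq_maxr _ _).
by have := @leq_bigmax _ (fun j => (msize (P j)).-1) i1; rewrite szP1.
Qed.

Lemma star_map_proper_rational :
  proper_rational_deg2 r rho (@star_map R n M r b a Q).
Proof.
split; [exact: star_map_proper | exact: star_map_lowest_terms | exact: star_map_embedding].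
Qed.

End StarProper.

(** * Normal form of a proper rational map of degree 2 *)

Section Scaling.
Variables (K : numClosedFieldType) (n m : nat).

(** It turns the inner sphere into the unit sphere, so that [sphere_defect] covers both
    boundaries. *)
Definition dilate (s : K) (F : quadmap K n m) : quadmap K n m :=
  QuadMap (qcst F) (s *: qlin F) (fun j => s ^+ 2 *: qform F j).

Lemma qeval_dilate s F z : qeval (dilate s F) z = qeval F (s *: z).
Proof.
rewrite qevalZ /qeval /=; congr (_ + _ + _); first by rewrite -scalemxAl.
apply/matrixP => i j; rewrite [LHS]mxE [RHS]mxE [X in _ = _ * X]mxE.
by rewrite -scalemxAr -scalemxAl mxE.
Qed.

Definition qscale (k : K) (F : quadmap K n m) : quadmap K n m :=
  QuadMap (k *: qcst F) (k *: qlin F) (fun j => k *: qform F j).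

Lemma qeval_qscale k F z : qeval (qscale k F) z = k *: qeval F z.
Proof.
rewrite /qeval !scalerDr /=; congr (_ + _ + _); first by rewrite -scalemxAl.
apply/matrixP => i j; rewrite [LHS]mxE [RHS]mxE [X in _ = _ * X]mxE.
by rewrite -scalemxAr -scalemxAl mxE.
Qed.

End Scaling.

Section BoundarySpheres.
Variables (R : realType) (n : nat) (r : R).
Local Notation C := (R[i] : numClosedFieldType).
Hypothesis r01 : 0 < r < 1.
Let r0 : 0 < r. Proof. by case/andP: r01. Qed.

Lemma continuous_scale (u : 'cV[C]_n) :
  continuous (fun s : R => (s%:C *: u : 'cV[C]_n)).
Proof.
move=> s; apply: (@cvg_matrix _ s C n 1 (fun s : R => (s%:C *: u : 'cV[C]_n)) (s%:C *: u : 'cV[C]_n)) => i j.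
rewrite ord1 {j}; have E (x : R) : (x%:C *: u) i 0 = Complex (x * complex.Re (u i 0)) (x * complex.Im (u i 0)) :> C.
  by rewrite mxE; case: (u i 0) => a b; rewrite /GRing.mul /= !mul0r subr0 addr0.
have -> : (fun x : R => (x%:C *: u) i 0) =
    (fun x : R => Complex (x * complex.Re (u i 0)) (x * complex.Im (u i 0)) : C).
  by apply/funext => x; rewrite E.
rewrite E.
apply: (@continuous_comp _ _ _ (fun x : R => (x * complex.Re (u i 0), x * complex.Im (u i 0)))
  (fun y : R * R => Complex y.1 y.2 : C)); last exact: continuous_Complex.
have c1 (x : R) : (fun y : R => y * x) @ s --> s * x.
  by apply: (@cvg_mul R _ s (fun y => y) (fun=> x)); [exact: cvg_id | exact: cvg_cst].
exact: (cvg_pair (c1 (complex.Re (u i 0))) (c1 (complex.Im (u i 0)))).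
Qed.

Lemma closure_annulus (u : 'cV[C]_n) (t : R) : sqnorm u = 1 -> r <= t <= 1 ->
  closure (annulus r : set 'cV[C]_n) (t%:C *: u).
Proof.
move=> u1 /andP[rt t1] U /(continuous_scale (u := u) (x := t)).
rewrite nbhs_simpl /= => /nbhs_ballP[e /= e0 eU].
(* The point is moved radially towards the middle radius c by the fraction h, which is below both 1
   and e. *)
pose c := (1 + r) / 2; pose h := e / (e + 1).
have e10 : 0 < e + 1 by rewrite addr_gt0.
have h0 : 0 < h by rewrite divr_gt0.
have h1 : h < 1 by rewrite ltr_pdivrMr // mul1r ltrDl.
have he : h < e by rewrite ltr_pdivrMr // ltr_pMr // ltrDr.
have /andP[ra rb] := r01.
exists ((t + h * (c - t))%:C *: u); split.
  by apply: annulus_point => //; rewrite /c; apply/andP; split; nra.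
apply: eU; rewrite /ball /= opprD addrA subrr sub0r normrN normrM ger0_norm ?(ltW h0) //.
have : `|c - t| <= 1 by rewrite ler_norml /c; apply/andP; split; lra.
by move=> h2; apply: le_lt_trans he; rewrite ler_piMr // ltW.
Qed.

Lemma sphere_notin_annulus (u : 'cV[C]_n) (t : R) : sqnorm u = 1 -> t = 1 \/ t = r ->
  ~ annulus r (t%:C *: u).
Proof.
move=> u1 tE /annulusE -/(_ r0); rewrite sqnormZ u1 mulr1 /= expr0n addr0.
by case: tE => ->; rewrite ?expr1n ltxx ?andbF.
Qed.

End BoundarySpheres.

Section Forward.
Variables (R : realType) (n N : nat) (r rho : R).
Local Notation C := (R[i] : numClosedFieldType).
Variable f : 'cV[C]_n -> 'cV[C]_N.
Hypotheses (n2 : (2 <= n)%N) (r01 : 0 < r < 1) (rho01 : 0 < rho < 1).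
Hypothesis fP : proper_map (annulus r) (annulus rho) f.

Let r0 : 0 < r. Proof. by case/andP: r01. Qed.
Let rho0 : 0 < rho. Proof. by case/andP: rho01. Qed.
Let b := (1 - rho ^+ 2) / (1 - r ^+ 2).

Lemma rational_norm_form (p' : 'I_N -> mpoly n C) (q' : mpoly n C) :
  (forall j, msize (p' j) <= 3)%N -> (msize q' <= 3)%N ->
  (forall z, annulus r z -> peval q' z != 0 /\ forall j, f z j 0 = peval (p' j) z / peval q' z) ->
  exists (k : C) (p : quadmap C n N) (l : 'rV[C]_n) (Q : R),
  [/\ k != 0, 0 <= Q,
      forall z, peval q' z = k * (1 + (l *m z) 0 0),
      forall z j, peval (p' j) z = k * qeval p z j 0
    & forall z, dot (qeval p z) (qeval p z) =
      (1 - b%:C + b%:C * dot z z) * ((1 + (l *m z) 0 0) * Num.conj (1 + (l *m z) 0 0))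
      + Q%:C * (1 - dot z z) * (r%:C ^+ 2 - dot z z)].
Proof.
move=> p3 q3 fpq.
have [F FE] := quadmap_mpoly p3.
have [G GE] := quadmap_mpoly (fun _ : 'I_1 => q3).
have FE' z j : peval (p' j) z = qeval F z j 0 by rewrite FE mxE.
have GE' z : peval q' z = qeval G z 0 0 by rewrite GE mxE.
have Fc (z : 'cV[C]_n) : qeval F @ z --> qeval F z.
  apply: cvg_matrix => i j; rewrite ord1 {j} -FE'.
  have -> : (fun x => qeval F x i 0) = peval (p' i) by apply/funext => x; rewrite FE'.
  exact: continuous_peval.
have Gc (z : 'cV[C]_n) : qeval G @ z --> qeval G z.
  apply: cvg_matrix => i j; rewrite !ord1 -GE'.
  have -> : (fun x => qeval G x 0 0) = peval q' by apply/funext => x; rewrite GE'.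
  exact: continuous_peval.
have fFG (z : 'cV[C]_n) : annulus r z -> qeval G z != 0 /\ f z = (qeval G z 0 0)^-1 *: qeval F z.
  move=> Az; have [q0 fE] := fpq z Az; split.
    by apply: contraNneq q0 => G0; rewrite GE' G0 mxE.
  by apply/matrixP => i j; rewrite ord1 fE FE' GE' [RHS]mxE mulrC.
have one (u : 'cV[C]_n) : dot u u = 1 -> sqnorm u = 1.
  by rewrite dot_sqnorm => /(@complexI R _ 1).
pose rho2 : C := (rho ^+ 2)%:C.
have bv (t : R) u : dot u u = 1 -> t = 1 \/ t = r ->
   (dot (qeval F (t%:C *: u)) (qeval F (t%:C *: u)) -
     1 * dot (qeval G (t%:C *: u)) (qeval G (t%:C *: u))) *
   (dot (qeval F (t%:C *: u)) (qeval F (t%:C *: u)) -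
     rho2 * dot (qeval G (t%:C *: u)) (qeval G (t%:C *: u))) = 0.
  move=> u1 tE; have [ra rb] := andP r01.
  have tr : r <= t <= 1 by case: tE => ->; rewrite lexx ltW.
  have := boundary_values rho01 (Fc (t%:C *: u)) (Gc (t%:C *: u)) fP
     (closure_annulus r01 (one u u1) tr) (sphere_notin_annulus r01 (one u u1) tE) fFG.
  rewrite !dot_sqnorm => -[] ->.
    by rewrite /rho2 rmorphM subrr mulr0.
  by rewrite mul1r subrr mul0r.
have split1 : exists c1 : C, (c1 = 1 \/ c1 = rho2) /\ forall v, dot v v = 1 ->
    dot (qeval F v) (qeval F v) = c1 * dot (qeval G v) (qeval G v).
  have [|H|H] := @sphere_defect _ n N F G 1 rho2.
  - by move=> u u1; have := bv 1 u u1 (or_introl erefl); rewrite rmorph1 scale1r.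
  - by exists 1; split; [left | move=> v /H/eqP; rewrite subr_eq0 => /eqP].
  by exists rho2; split; [right | move=> v /H/eqP; rewrite subr_eq0 => /eqP].
have splitr : exists cr : C, (cr = 1 \/ cr = rho2) /\ forall v, dot v v = 1 ->
    dot (qeval F (r%:C *: v)) (qeval F (r%:C *: v)) = cr * dot (qeval G (r%:C *: v)) (qeval G (r%:C *: v)).
  have [|H|H] := @sphere_defect _ n N (dilate r%:C F) (dilate r%:C G) 1 rho2.
  - by move=> u u1; rewrite !qeval_dilate; apply: bv u1 _; right.
  - exists 1; split; [by left | move=> v /H/eqP].
    by rewrite !qeval_dilate subr_eq0 => /eqP.
  exists rho2; split; [by right | move=> v /H/eqP].
  by rewrite !qeval_dilate subr_eq0 => /eqP.
have [c1 [c1E outer]] := split1; have [cr [crE inner]] := splitr.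
have rC : 0 < (r%:C : C) < 1 by rewrite -(rmorph0 (real_complex R)) -(rmorph1 (real_complex R)) !ltcR.
have rhoC : 0 < rho2 < 1.
  rewrite -(rmorph0 (real_complex R)) -(rmorph1 (real_complex R)) !ltcR exprn_gt0 //=.
  by apply: sqr_lt1 => //; case/andP: rho01.
have annC (z : 'cV[C]_n) : r%:C ^+ 2 < dot z z < 1 -> annulus r z.
  rewrite dot_sqnorm -rmorphXn -(rmorph1 (real_complex R)) !ltcR => zA.
  by apply/annulusE.
have hne z : r%:C ^+ 2 < dot z z < 1 ->
     rho2 * dot (qeval G z) (qeval G z) < dot (qeval F z) (qeval F z)
     < dot (qeval G z) (qeval G z).
  move=> /annC Az; have [G0 fE] := fFG z Az.
  have Gp : 0 < sqnorm (qeval G z) by rewrite lt_def sqnorm_eq0 G0 sqnorm_ge0.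
  have /annulusE -/(_ rho0) : annulus rho (f z) by case: fP => _ h _; apply: h; exists z.
  rewrite fE sqnorm_quotient // ltr_pdivlMr // ltr_pdivrMr // mul1r.
  by rewrite !dot_sqnorm /rho2 -rmorphM !ltcR.
have neq := sphere_constants_neq n2 rC rhoC c1E crE outer inner hne.
have [G0 G2] := sphere_denominator n2 rC rhoC c1E crE outer inner neq (fun z Az => (fFG z (annC z Az)).1).
(* All relations are homogeneous in the pair (p, q), so both may be divided by k = q(0), nonzero by
   [sphere_denominator]; k is returned to recover the given polynomials. *)
pose k := qcst G 0 0.
have k0 : k != 0.
  by apply: contraNneq G0 => k0; apply/eqP/matrixP => i j; rewrite !ord1 -/k k0 mxE.
pose p := qscale k^-1 F; pose l := k^-1 *: qlin G.
pose q := QuadMap (const_mx 1) l (fun _ : 'I_1 => 0).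
have qG z : qeval q z = k^-1 *: qeval G z.
  rewrite /qeval G2 /= addr0 scalerDr -scalemxAl.
  have -> : qhom2 q z = 0 by apply/matrixP => i j; rewrite [LHS]mxE mulmx0 mul0mx !mxE.
  rewrite addr0; congr (_ + _); apply/matrixP => i j; rewrite !ord1 !mxE.
  by rewrite -/k mulVf.
have pF z : qeval p z = k^-1 *: qeval F z by rewrite qeval_qscale.
have outer' v : dot v v = 1 -> dot (qeval p v) (qeval p v) = c1 * dot (qeval q v) (qeval q v).
  by move=> v1; rewrite pF qG !dotZl !dotZr outer //; ring.
have inner' v : dot v v = 1 -> dot (qeval p (r%:C *: v)) (qeval p (r%:C *: v)) =
   cr * dot (qeval q (r%:C *: v)) (qeval q (r%:C *: v)).
  by move=> v1; rewrite !pF !qG !dotZl !dotZr inner //; ring.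
have q20 z : qhom2 q z = 0 by apply/matrixP => i j; rewrite [LHS]mxE mulmx0 mul0mx !mxE.
have [_ [Q [Q0 KE]]] := sphere_normal_form n2 rC rhoC c1E crE outer' inner' neq erefl q20.
have QR : Q = (complex.Re Q)%:C by rewrite RRe_real // ger0_real.
exists k, p, l, (complex.Re Q); split=> //.
- by rewrite -ler0c -QR.
- move=> z; rewrite GE'; have -> : 1 + (l *m z) 0 0 = qeval q z 0 0.
    by rewrite /qeval q20 addr0 [RHS]mxE [X in _ = X + _]mxE.
  rewrite qG; move: (qeval G z) => x.
  by rewrite [X in _ = k * X]mxE mulrA divff // mul1r.
- by move=> z j; rewrite FE' pF [X in _ = k * X]mxE mulrA divff // mul1r.
move=> z; rewrite KE -QR.
have -> : dot (qeval q z) (qeval q z) = (1 + (l *m z) 0 0) * Num.conj (1 + (l *m z) 0 0).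
  have -> : 1 + (l *m z) 0 0 = qeval q z 0 0.
    by rewrite /qeval q20 addr0 [RHS]mxE [X in _ = X + _]mxE.
  by rewrite /dot big_ord1.
have -> : (1 - rho2) / (1 - r%:C ^+ 2) = b%:C :> C.
  by rewrite /b /rho2 fmorph_div /= !rmorphB /= !rmorphXn rmorph1.
by [].
Qed.

End Forward.

Section NormalForm.
Variables (R : realType) (n N : nat) (r rho : R).
Local Notation C := (R[i] : numClosedFieldType).
Variable f : 'cV[C]_n -> 'cV[C]_N.
Hypotheses (n2 : (2 <= n)%N) (r01 : 0 < r < 1) (rho01 : 0 < rho < 1).

Let r0 : 0 < r. Proof. by case/andP: r01. Qed.
Let n0 : (0 < n)%N. Proof. exact: ltnW. Qed.
Let b := (1 - rho ^+ 2) / (1 - r ^+ 2).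

Definition kernel_form (l : 'rV[C]_n) (Q : R) (z w : 'cV[C]_n) : C :=
  (1 - b%:C + b%:C * dot z w) * ((1 + (l *m z) 0 0) * Num.conj (1 + (l *m w) 0 0))
  + Q%:C * (1 - dot z w) * (r%:C ^+ 2 - dot z w).

Lemma kernel_polarized (p : quadmap C n N) l Q :
  (forall z, dot (qeval p z) (qeval p z) = kernel_form l Q z z) ->
  forall z w, dot (qeval p z) (qeval p w) = kernel_form l Q z w.
Proof.
move=> H z w; apply/eqP; rewrite -subr_eq0; apply/eqP.
apply: (polarization (H := fun z w => dot (qeval p z) (qeval p w) - kernel_form l Q z w));
  last by move=> x; rewrite H subrr.
pose q (z : 'cV[C]_n) : 'cV[C]_1 := const_mx (1 + (l *m z) 0 0).
pose zq (z : 'cV[C]_n) : 'cV[C]_n := (1 + (l *m z) 0 0) *: z.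
pose one (z : 'cV[C]_n) : 'cV[C]_1 := const_mx 1.
have lD (x v : 'cV[C]_n) t : (l *m (x + t *: v)) 0 0 = (l *m x) 0 0 + t * (l *m v) 0 0.
  by rewrite mulmxDr -scalemxAr [LHS]mxE [X in _ + X]mxE.
have hq : quadratic_on_lines q.
  move=> x v; exists (q x), (const_mx ((l *m v) 0 0)), 0 => t.
  by rewrite /q lD; apply/matrixP => i j; rewrite !mxE; ring.
have hzq : quadratic_on_lines zq.
  move=> x v; exists (zq x), ((1 + (l *m x) 0 0) *: v + (l *m v) 0 0 *: x), ((l *m v) 0 0 *: v) => t.
  rewrite /zq lD; move: ((l *m v) 0 0) ((l *m x) 0 0) => lv lx.
  by apply/matrixP => i j; rewrite !mxE; ring.
have hone : quadratic_on_lines one.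
  by move=> x v; exists (one x), 0, 0 => t; rewrite !scaler0 !addr0.
have hid : quadratic_on_lines (fun z : 'cV[C]_n => z).
  by move=> x v; exists x, v, 0 => t; rewrite scaler0 addr0.
have hsq : kernel_on_lines (fun z w : 'cV[C]_n => dot z w ^+ 2).
  move=> x v; pose A := dot x x; pose B := dot v x; pose D := dot x v; pose E := dot v v.
  (* These are the coefficients of the square of A + s B + t' D + s t' E, where t' is the conjugate
     of t. *)
  exists (fun i j => nth 0 (nth [::] [:: [:: A ^+ 2; 2 * A * D; D ^+ 2];
    [:: 2 * A * B; 2 * A * E + 2 * B * D; 2 * D * E]; [:: B ^+ 2; 2 * B * E; E ^+ 2]] i) j) => s t.
  rewrite !big_ord_recr !big_ord0 /= !(dotDl, dotDr, dotZl, dotZr) -/A -/B -/D -/E.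
  by ring.
have K1 := kernel_on_linesZ (- (1 - b%:C : C)) (kernel_on_lines_dot hq hq).
have K2 := kernel_on_linesZ (- (b%:C : C)) (kernel_on_lines_dot hzq hzq).
have K3 := kernel_on_linesZ (- (Q%:C * r%:C ^+ 2 : C)) (kernel_on_lines_dot hone hone).
have K4 := kernel_on_linesZ (Q%:C * (1 + r%:C ^+ 2) : C) (kernel_on_lines_dot hid hid).
have K5 := kernel_on_linesZ (- (Q%:C) : C) hsq.
have K6 := kernel_on_lines_dot (qeval_on_lines p) (qeval_on_lines p).
have := kernel_on_linesD K6 (kernel_on_linesD K1 (kernel_on_linesD K2
  (kernel_on_linesD K3 (kernel_on_linesD K4 K5)))).
congr kernel_on_lines; apply/funext => x; apply/funext => y.
rewrite /q /zq /one !dot_scalar rmorph1 dotZl dotZr /kernel_form.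
move: (dot x y) (Num.conj _) => d lc.
by ring.
Qed.

Lemma deg2_normal_form : proper_rational_deg2 r rho f ->
  exists (p : quadmap C n N) (l : 'rV[C]_n) (Q : R),
  [/\ 0 < Q, forall z w, dot (qeval p z) (qeval p w) = kernel_form l Q z w,
      forall z, annulus r z -> 1 + (l *m z) 0 0 != 0 /\ f z = (1 + (l *m z) 0 0)^-1 *: qeval p z,
      polynomial_on (annulus r) f <-> l = 0
    & forall w c, (forall z, dot (qeval p z) w = c * (1 + (l *m z) 0 0)) -> w = 0].
Proof.
move=> [fP [p' [q' [[q'0 lowest] fpq deg2]]] fN].
have q3 : (msize q' <= 3)%N.
  have := leq_maxl (msize q').-1 (\max_(j < N) (msize (p' j)).-1).
  by rewrite -deg2; case: (mmeasure _ q').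
have p3 j : (msize (p' j) <= 3)%N.
  have := leq_trans (@leq_bigmax _ (fun j => (msize (p' j)).-1) j)
    (leq_maxr (msize q').-1 (\max_(j < N) (msize (p' j)).-1)).
  by rewrite -deg2; case: (mmeasure _ (p' j)).
have [k [p [l [Q [k0 Q0 qE pE KE]]]]] := rational_norm_form n2 r01 rho01 fP p3 q3 fpq.
have ker := kernel_polarized KE.
(* If q' divides every p', it is itself a common divisor, so lowest terms makes it constant. This
   serves both for Q > 0 and for the criterion that f is polynomial. *)
have divides (A : 'I_N -> mpoly n C) : (forall j, p' j = q' * A j) -> l = 0.
  move=> pA; have q1 : (msize q' <= 1)%N.
    by apply: (lowest q' 1 A) => //; rewrite mulr1.
  have lz (z : 'cV[C]_n) : (l *m z) 0 0 = 0.
    have cst : peval q' z = peval q' 0 by rewrite (msize1_polyC q1) /peval !mevalC.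
    move: cst; rewrite !qE mulmx0 [(0 : 'M_1) _ _]mxE => /(mulfI k0)/addrI.
    by [].
  apply/matrixP => i j; rewrite ord1; have := lz (delta_mx j 0).
  by rewrite -colE !mxE.
have lpoly : poly_fun 1 (fun z : 'cV[C]_n => (l *m z) 0 0) by apply: poly_fun_linear.
have Qpos : 0 < Q.
  rewrite lt_def Q0 andbT; apply/eqP => Q00.
  (* without [Q] the kernel makes [p / (1 + l)] affine *)
  have fact z : qeval p z = (1 + (l *m z) 0 0) *:
      (2^-1 *: (qeval p z - qeval p (- z)) + (1 - (l *m z) 0 0) *: qeval p 0).
    set lz := (l *m z) 0 0.
    (* If p = (1 + l) g with g affine, then (1 - lz) p(z) + (1 + lz) p(-z) = 2 (1 - lz^2) p(0). The
       vector x is half the difference of the two sides, and for Q = 0 the kernel gives <x, x> =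
       0. *)
    pose x := (1 - lz) / 2 *: qeval p z + (1 + lz) / 2 *: qeval p (- z)
       - (1 + lz) * (1 - lz) *: qeval p 0.
    have lN : (l *m - z) 0 0 = - lz by rewrite mulmxN mxE.
    have l0 : (l *m (0 : 'cV[C]_n)) 0 0 = 0 by rewrite mulmx0 mxE.
    have : dot x x = 0.
      have K2 : Num.conj (2 : C) = 2 by rewrite rmorph_nat.
      have := (ker z z, ker z (- z), ker z 0, (ker (- z) z, ker (- z) (- z), ker (- z) 0),
        (ker 0 z, ker 0 (- z), ker 0 0)).
      rewrite /x; clear x; move: (qeval p z) (qeval p (- z)) (qeval p 0) => u v w E.
      rewrite !(dotDl, dotDr, dotNl, dotNr, dotZl, dotZr) !E /kernel_form Q00 rmorph0.
      rewrite !(dotNl, dotNr, dot0l, dot0r) lN l0 -?/lz; clear lN l0 E; clearbody lz.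
      move: (b%:C) (dot z z) => B d.
      rewrite !(fmorph_div, rmorphM, rmorphD, rmorphB, rmorphN, rmorph1, rmorph0) /= ?K2.
      move: (Num.conj lz) => lc.
      by field.
    move/eqP; rewrite dot_eq0 => /eqP x0.
    apply/eqP; rewrite -subr_eq0 -[X in _ == X]x0 /x; apply/eqP.
    move: (qeval p z) (qeval p (- z)) (qeval p 0) => u v w.
    by apply/matrixP => i j; rewrite !mxE; field.
  have aff j : poly_fun 1 (fun z =>
      (2^-1 *: (qeval p z - qeval p (- z)) + (1 - (l *m z) 0 0) *: qeval p 0) j 0).
    set g := (X in poly_fun _ X); have -> : g = (fun z => (qlin p *m z) j 0 + (qeval p 0 j 0 + (- qeval p 0 j 0) * (l *m z) 0 0)).
      apply/funext => z; rewrite /g.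
      have -> : qeval p z - qeval p (- z) = 2 *: (qlin p *m z).
        have -> : - z = (-1) *: z by rewrite scaleN1r.
        rewrite qevalZ /qeval; apply/matrixP => i' j'; rewrite !mxE; ring.
      rewrite scalerA mulVf ?pnatr_eq0 // scale1r [LHS]mxE; congr (_ + _).
      by rewrite [LHS]mxE; ring.
    apply: poly_funD; first exact: poly_fun_linear.
    apply: poly_funD; first by apply: (@poly_funW _ _ 0) => //; apply: poly_fun_cst.
    exact: poly_funZ.
  have [A hA] := fin_all_exists aff.
  have pA j : p' j = q' * A j.
    apply/eqP; rewrite -subr_eq0; apply/eqP/meval_eq0 => v.
    pose z : 'cV[C]_n := \col_i v i.
    have vz x : meval v x = peval x z by apply: meval_eq => i; rewrite mxE.
    rewrite mevalB mevalM !vz pE qE (hA j).2 {1}fact [X in k * X - _]mxE mulrA.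
    exact: subrr.
  have l0 := divides A pA.
  have q'c : q' = mpolyC n k.
    apply/eqP; rewrite -subr_eq0; apply/eqP/meval_eq0 => v.
    pose z : 'cV[C]_n := \col_i v i.
    have vz x : meval v x = peval x z by apply: meval_eq => i; rewrite mxE.
    by rewrite mevalB vz qE l0 mul0mx mxE addr0 mulr1 mevalC subrr.
  have : (maxn (msize q').-1 (\max_(j < N) (msize (p' j)).-1) <= 1)%N.
    rewrite geq_max; apply/andP; split; first by rewrite q'c msizeC; case: (_ != _).
    apply/bigmax_leqP => j _; rewrite pA q'c mul_mpolyC msizeZ //.
    by have := (hA j).1; case: (mmeasure _ (A j)) => [|[|]].
  by rewrite -deg2.
have fE z : annulus r z -> 1 + (l *m z) 0 0 != 0 /\ f z = (1 + (l *m z) 0 0)^-1 *: qeval p z.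
  move=> Az; have [q0 fj] := fpq z Az; rewrite qE mulf_eq0 negb_or k0 /= in q0.
  split=> //; apply/matrixP => i j; rewrite ord1 fj pE qE [RHS]mxE.
  by field; rewrite q0.
exists p, l, Q; split=> //.
- split=> [[P fPj]|l0].
    apply: (divides P) => j; apply/eqP; rewrite -subr_eq0; apply/eqP.
    apply: (mpoly_annulus_eq0 r01 n0) => z Az.
    have [q0 fj] := fpq z Az.
    by rewrite /peval mevalB mevalM -!/(peval _ _) -(fPj z Az) fj mulrC divfK // subrr.
  exists (fun j => mpolyC n k^-1 * p' j) => z Az j.
  rewrite (fE z Az).2 l0 mul0mx [(0 : 'M_1) _ _]mxE addr0 invr1 scale1r.
  by rewrite /peval mevalM mevalC -/(peval _ _) pE mulrA mulVf // mul1r.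
move=> w c H; apply: (embedding_dim_hyperplane (annulus_nonempty r01 n0) fN (c := c)) => z Az.
have [q0 ->] := fE z Az; rewrite dotZl H mulrC.
exact: mulfK.
Qed.

End NormalForm.

(** Gram-Schmidt applied to the matrix all of whose rows are u: u is c times the first row of the
    result, c >= 0, and the unit norms give c = 1. *)
Lemma unitary_first_row (K : numClosedFieldType) n (u : 'rV[K]_n.+1) :
  dot u^T u^T = 1 ->
  exists2 V : 'M[K]_n.+1, V \is unitarymx & forall z : 'cV_n.+1, (V *m z) 0 0 = (u *m z) 0 0.
Proof.
move=> u1; pose A : 'M[K]_n.+1 := \matrix_(i, j) u 0 j.
have A0 : row 0 A = u by apply/rowP => j; rewrite !mxE.
have Vu : schmidt A \is unitarymx by apply: schmidt_unitarymx.
have rowdot (x y : 'rV[K]_n.+1) : dotmx x y = dot x^T y^T.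
  by rewrite dotmxE [LHS]mxE; apply: eq_bigr => i _; rewrite !mxE.
set V := schmidt A in Vu *; exists V => //.
have := row_schmidt_sub A 0; rewrite A0 -/V (bigD1 ord0) //= big1 ?addsmx0; last first.
  by move=> i /andP[i0 /negP[]]; move: i0; rewrite leqn0.
rewrite genmxE => /sub_rVP[c uE].
have V1 : dot (row 0 V)^T (row 0 V)^T = 1.
  by rewrite -rowdot; have /row_unitarymxP -> := Vu; rewrite eqxx.
have c0 : 0 <= c.
  have := form1_row_schmidt A 0.
  by rewrite A0 -/V rowdot uE linearZ /= dotZl V1 mulr1.
have c1 : c = 1.
  move: u1; rewrite uE linearZ /= dotZl dotZr V1 mulr1 => cc.
  have : c ^+ 2 == 1 by rewrite expr2 -[X in _ * X](conj_Creal (ger0_real c0)) cc.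
  by rewrite sqrp_eq1 // => /eqP.
by move=> z; rewrite uE c1 scale1r -row_mul [RHS]mxE.
Qed.

Section LinearForm.
Variable R : realType.
Local Notation C := (R[i] : numClosedFieldType).

Lemma linear_form_dot n (l : 'rV[C]_n) : l != 0 ->
  exists (a : R) (e : 'cV[C]_n), [/\ 0 < a, dot e e = 1 &
    forall z : 'cV_n, (l *m z) 0 0 = a%:C * dot z e].
Proof.
move=> l0.
pose v : 'cV[C]_n := \col_i Num.conj (l 0 i).
have lv (z : 'cV[C]_n) : (l *m z) 0 0 = dot z v.
  by rewrite mxE; apply: eq_bigr => i _; rewrite mxE conjCK mulrC.
have v0 : v != 0.
  apply: contra l0 => /eqP vE; apply/eqP/rowP => i; rewrite mxE.
  by have /matrixP/(_ i 0) := vE; rewrite !mxE => /eqP; rewrite fmorph_eq0 => /eqP.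
have s0 : 0 < sqnorm v by rewrite lt_def sqnorm_ge0 sqnorm_eq0 v0.
have a0 : 0 < Num.sqrt (sqnorm v) by rewrite sqrtr_gt0.
pose a : C := (Num.sqrt (sqnorm v))%:C.
have aE : a ^+ 2 = dot v v by rewrite dot_sqnorm sqr_real_sqrt // ltW.
have an0 : a != 0 by rewrite -sqrf_eq0 aE dot_sqnorm (inj_eq (@complexI R) _ 0) gt_eqF.
have ac : Num.conj a^-1 = a^-1 by rewrite fmorphV /= /a conj_real.
exists (Num.sqrt (sqnorm v)), (a^-1 *: v); split=> // [|z].
  by rewrite dotZl dotZr -aE ac; field.
by rewrite dotZr ac lv -/a mulrA divff // mul1r.
Qed.

End LinearForm.

Section Forward.
Variables (R : realType) (n N : nat) (r rho : R).
Local Notation C := (R[i] : numClosedFieldType).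
Local Notation b := ((1 - rho ^+ 2) / (1 - r ^+ 2)).
Variables (p : quadmap C n N) (l : 'rV[C]_n) (Q : R).
Hypotheses (n2 : (2 <= n)%N) (r01 : 0 < r < 1) (rho01 : 0 < rho < 1) (Q0 : 0 < Q).
Hypothesis ker : forall z w, dot (qeval p z) (qeval p w) = kernel_form r rho l Q z w.
Hypothesis indep : forall w c, (forall z, dot (qeval p z) w = c * (1 + (l *m z) 0 0)) -> w = 0.

Lemma ratio_gt0 : 0 < b.
Proof.
case/andP: r01 => ra rb; case/andP: rho01 => rhoa rhob.
by rewrite divr_gt0 // subr_gt0; apply: sqr_lt1.
Qed.

Lemma ratioE : rho ^+ 2 = 1 - b * (1 - r ^+ 2).
Proof.
case/andP: r01 => ra rb; have h : 1 - r ^+ 2 != 0 by rewrite gt_eqF // subr_gt0; apply: sqr_lt1.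
by rewrite divfK //; ring.
Qed.

Lemma alpha_norm : dot (qeval p 0) (qeval p 0) = (1 - b + Q * r ^+ 2)%:C.
Proof.
rewrite ker /kernel_form !dot0l mulmx0 [(0 : 'M_1) _ _]mxE addr0 rmorph1.
by move: b => B; rewrite !(rmorphM, rmorphD, rmorphN, rmorphXn, rmorph1) /=; ring.
Qed.

Lemma alpha_ge0 : 0 <= 1 - b + Q * r ^+ 2.
Proof. by rewrite -lecR -alpha_norm dot_ge0. Qed.

Lemma alpha_eq0 : 1 - b + Q * r ^+ 2 = 0 -> qeval p 0 = 0.
Proof. by move=> h; apply/eqP; rewrite -dot_eq0 alpha_norm h. Qed.

(** For l = 0 the function <p z, p 0> is constant, so minimality of the target gives p(0) = 0, that
    is, Q r^2 = b - 1. The bound on b is the nonnegativity of |p(e) - p(-e)|^2 = 4 (b - Q (1 +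
    r^2)). *)
Lemma linear_part_gamma : l = 0 -> Q * r ^+ 2 = b - 1 /\ b <= 1 + r ^+ 2.
Proof.
move=> l0; have lz (z : 'cV[C]_n) : (l *m z) 0 0 = 0 by rewrite l0 mul0mx mxE.
have al0 : 1 - b + Q * r ^+ 2 = 0.
  apply: (@complexI R); rewrite -alpha_norm.
  suff -> : qeval p 0 = 0 by rewrite dot0l.
  apply: (indep (c := (1 - b + Q * r ^+ 2)%:C)) => z.
  rewrite ker /kernel_form !lz dot0r addr0 rmorph1.
  by move: b => B; rewrite !(rmorphM, rmorphD, rmorphN, rmorphXn, rmorph1) /=; ring.
have QE : Q * r ^+ 2 = b - 1 by move: al0; lra.
split=> //.
have [e ee _] := linear_unit0 l n2.
have h : 0 <= b - Q * (1 + r ^+ 2).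
  have : 0 <= dot (qeval p e - qeval p (- e)) (qeval p e - qeval p (- e)) by apply: dot_ge0.
  have -> : dot (qeval p e - qeval p (- e)) (qeval p e - qeval p (- e)) =
      (4 * (b - Q * (1 + r ^+ 2)))%:C.
    have dotE (u v : 'cV[C]_N) : dot (u - v) (u - v) = dot u u - dot u v - (dot v u - dot v v).
      by rewrite dotBl !dotBr.
    rewrite dotE !ker /kernel_form !lz !(dotNl, dotNr) ee addr0 rmorph1.
    move: b => B; rewrite !(rmorphM, rmorphD, rmorphN, rmorphXn, rmorph1, rmorph_nat) /=; ring.
  by rewrite lecR pmulr_rge0.
have t0 : 0 < r ^+ 2 by rewrite exprn_gt0; case/andP: r01.
have := mulr_ge0 h (ltW t0); have := QE; move: (r ^+ 2) t0 => t t0; move: b => B; nra.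
Qed.

Section Pole.
Variables (a : R) (e : 'cV[C]_n).
Hypotheses (a0 : 0 < a) (ee : dot e e = 1).
Hypothesis le : forall z : 'cV[C]_n, (l *m z) 0 0 = a%:C * dot z e.

(* [p] is quadratic on the line through [e], so [p 0], [p e] and [p (- e)]
   determine the vectors [v0, v1, v2] with
   [<p z, p 0 + c v1 + c^2 v2> = K z (c e)]; their Gram matrix is singular because
   [1 + l] is not in the span of the functions [<p z, w>]. *)
Lemma pole_star_det : star_det r b a Q = 0.
Proof.
have b_def := erefl b; move: {-1}b b_def => B BE.
(* The Gram matrix of v0, v1, v2 is tridiagonal, with diagonal [al], [k], [be] and off-diagonal
   entries [h], [m]. Cramer's rule gives x, y, t for which x v0 + y v1 + t v2 pairs with p z to the
   determinant times 1 + l z, and the determinant is Q times [star_det]. The vector w is this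
   combination rewritten in p(0), p(e), p(-e). *)
pose h := (1 - B) * a; pose m := B * a; pose be := B * a ^+ 2 + Q.
pose al := 1 - B + Q * r ^+ 2; pose k := (1 - B) * a ^+ 2 + B - Q * (1 + r ^+ 2).
pose x := k * be - m ^+ 2 - a * h * be; pose y := - (h * be) + a * al * be.
pose t := h * m - a * al * m.
pose w := (x - t)%:C *: qeval p 0 + ((t + y) / 2)%:C *: qeval p e + ((t - y) / 2)%:C *: qeval p (- e).
have wE z : dot (qeval p z) w = (Q * star_det r B a Q)%:C * (1 + (l *m z) 0 0).
  have dotE (u u0 u1 u2 : 'cV[C]_N) x0 x1 x2 : dot u (x0 *: u0 + x1 *: u1 + x2 *: u2) =
      Num.conj x0 * dot u u0 + Num.conj x1 * dot u u1 + Num.conj x2 * dot u u2.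
    by rewrite !dotDr !dotZr.
  rewrite /w dotE !conj_real !ker /kernel_form BE !le !(dotNr, dotNl) ee dot0r dot0l.
  move: (dot z e) => s.
  rewrite /x /y /t /k /al /be /m /h /star_det.
  have conjE (c : R) : Num.conj (1 + a%:C * c%:C : C) = 1 + a%:C * c%:C.
    by rewrite -rmorphM -[1 : R[i]](rmorph1 (real_complex R)) -rmorphD conj_real.
  have := (conjE 0, conjE 1, conjE (-1)); rewrite rmorph0 rmorph1 rmorphN1 => cE.
  rewrite !cE !(rmorphM (real_complex R), rmorphD (real_complex R), rmorphN (real_complex R),
    rmorphXn (real_complex R), rmorph1 (real_complex R), rmorph_nat (real_complex R),
    fmorphV (real_complex R)) /=.
  by field.
have := wE 0; rewrite (indep wE) dot0r mulmx0 [(0 : 'M_1) _ _]mxE addr0 mulr1.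
move/esym/(@complexI R _ 0)/eqP; rewrite mulf_eq0 gt_eqF //= => /eqP.
by [].
Qed.

(** If the radicand were 0, then p(0) = 0 and the kernel at (e, 0) would vanish. Comparing the two
    equations gives (1 - b) a = 0, hence b = 1 and Q r^2 = 0. *)
Lemma pole_alpha_gt0 : 0 < 1 - b + Q * r ^+ 2.
Proof.
rewrite lt_def alpha_ge0 andbT; apply/eqP => h.
have := ker e 0; rewrite (alpha_eq0 h) dot0r /kernel_form !le ee !dot0r dot0l.
move: h; move: b => B h.
have -> : Num.conj (1 + a%:C * 0 : C) = 1 by rewrite mulr0 addr0 rmorph1.
move=> E; have : (1 - B) * (1 + a) + Q * r ^+ 2 = 0.
  apply: (@complexI R); rewrite !(rmorphM, rmorphD, rmorphN, rmorphXn, rmorph1, rmorph0) /=.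
  rewrite [RHS]E; ring.
have -> : (1 - B) * (1 + a) + Q * r ^+ 2 = (1 - B) * a + (1 - B + Q * r ^+ 2) by ring.
rewrite h addr0 => /eqP; rewrite mulf_eq0 (gt_eqF a0) orbF => /eqP B1.
move: h; rewrite B1 add0r; apply/eqP; rewrite gt_eqF // mulr_gt0 // exprn_gt0 //.
by case/andP: r01.
Qed.

(** For a > 1 the pole hyperplane is at distance 1/a < 1 from the origin. From its nearest point one
    moves along a unit vector e' orthogonal to e until the squared norm is midway between 1 and the
    larger of r^2 and 1/a^2; the point reached is a pole in the annulus. *)
Lemma pole_le1 : (forall z : 'cV[C]_n, annulus r z -> 1 + (l *m z) 0 0 != 0) -> a <= 1.
Proof.
move=> nz; rewrite leNgt; apply/negP => a1.
have [e' e'e' le'] := linear_unit0 l n2.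
have r0 : 0 < r by case/andP: r01.
have r2 : r ^+ 2 < 1 by apply: sqr_lt1 => //; case/andP: r01.
have ia0 : 0 < a^-1 by rewrite invr_gt0.
have ia : a^-1 ^+ 2 < 1 by apply: sqr_lt1; rewrite // invf_lt1.
pose M := Num.max (r ^+ 2) (a^-1 ^+ 2).
have M1 : M < 1 by rewrite gt_max r2 ia.
have Mr : r ^+ 2 <= M by rewrite le_max lexx.
have Ma : a^-1 ^+ 2 <= M by rewrite le_max lexx orbT.
pose c := Num.sqrt ((1 + M) / 2 - a^-1 ^+ 2).
have c2 : c ^+ 2 = (1 + M) / 2 - a^-1 ^+ 2 by rewrite sqr_sqrtr //; move: Ma M1; lra.
have aC : a%:C != 0 :> R[i] by rewrite (inj_eq (@complexI R) _ 0) gt_eqF.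
have e'e : dot e' e = 0.
  have := le e'; rewrite le' mxE => /esym/eqP; rewrite mulf_eq0 (negPf aC) => /eqP.
  by [].
have ee' : dot e e' = 0 by rewrite dotC e'e rmorph0.
pose z : 'cV[C]_n := (- a^-1)%:C *: e + c%:C *: e'.
suff Az : annulus r z.
  have /negP[] := nz z Az.
  rewrite le dotDl !dotZl ee e'e rmorphN fmorphV /= mulr1 mulr0 addr0 mulrN divff //.
  by rewrite subrr.
apply/annulusE => //.
suff -> : sqnorm z = (1 + M) / 2 by move: M1 Mr; lra.
apply: (@complexI R); rewrite -dot_sqnorm dotDl !dotDr !dotZl !dotZr !conj_real ee e'e' e'e ee'.
have -> : (1 + M) / 2 = c ^+ 2 + a^-1 ^+ 2 by rewrite c2; ring.
by rewrite rmorphD !rmorphXn rmorphN /=; ring.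
Qed.

Lemma pole_admissible : (forall z : 'cV[C]_n, annulus r z -> 1 + (l *m z) 0 0 != 0) ->
  admissible r b a Q.
Proof.
move=> nz; apply: admissible_of_le1; rewrite ?ratio_gt0 ?a0 //.
- exact: pole_le1.
- exact: pole_alpha_gt0.
- exact: pole_star_det.
Qed.

End Pole.
End Forward.

(** * Unitary equivalence and uniqueness *)

Section Congruence.
Variables (R : realType) (n : nat).
Local Notation C := (R[i] : numClosedFieldType).

Lemma same_norm_dim N M (p : 'cV[C]_n -> 'cV[C]_N) (g : 'cV[C]_n -> 'cV[C]_M) :
  quadratic_on_lines p -> quadratic_on_lines g -> spanning p -> spanning g ->
  (forall z, dot (p z) (p z) = dot (g z) (g z)) -> N = M.
Proof.
move=> pl gl ps gs /(kernel_eq_of_norm pl gl) E.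
apply/eqP; rewrite eqn_leq (isometric_spanning_le ps E) /=.
by apply: (isometric_spanning_le (h := p) gs) => s t; rewrite E.
Qed.

Lemma spanning_mulmx M (g : 'cV[C]_n -> 'cV[C]_M) (V : 'M[C]_n) : V \is unitarymx ->
  spanning g -> spanning (fun z => g (V *m z)).
Proof.
move=> Vu gs w H; apply: gs => z; rewrite -[z](mulKVmx (unitarymx_unit Vu)); exact: H.
Qed.

Lemma sqnorm_unitary m (V : 'M[C]_m) (z : 'cV[C]_m) : V \is unitarymx ->
  sqnorm (V *m z) = sqnorm z.
Proof. by move=> Vu; apply: (@complexI R); rewrite -!dot_sqnorm dot_unitary. Qed.

Lemma unitarily_equivalent_sqnorm N (A : set 'cV[C]_n) (g h : 'cV[C]_n -> 'cV[C]_N) :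
  unitarily_equivalent A g h ->
  exists2 V : 'M[C]_n, V \is unitarymx & forall z, A z -> sqnorm (g z) = sqnorm (h (V *m z)).
Proof.
move=> [V [W [Vu Wu E]]]; exists V => // z Az.
by rewrite (E z Az) (sqnorm_unitary _ Wu).
Qed.

End Congruence.

Section StarEquivalence.
Variables (R : realType) (m N : nat) (r rho : R).
Local Notation C := (R[i] : numClosedFieldType).
Local Notation n := m.+1.
Local Notation M := ('C(n.+1, 2) + n)%N.
Local Notation b := ((1 - rho ^+ 2) / (1 - r ^+ 2)).
Variables (f : 'cV[C]_n -> 'cV[C]_N) (p : quadmap C n N) (l : 'rV[C]_n) (Q a : R) (e : 'cV[C]_n).
Hypotheses (m0 : (0 < m)%N) (r01 : 0 < r < 1) (rho01 : 0 < rho < 1).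
Hypothesis ker : forall z w, dot (qeval p z) (qeval p w) = kernel_form r rho l Q z w.
Hypothesis fE : forall z, annulus r z ->
  1 + (l *m z) 0 0 != 0 /\ f z = (1 + (l *m z) 0 0)^-1 *: qeval p z.
Hypothesis indep : forall w c, (forall z, dot (qeval p z) w = c * (1 + (l *m z) 0 0)) -> w = 0.
Hypotheses (ee : dot e e = 1) (le : forall z : 'cV[C]_n, (l *m z) 0 0 = a%:C * dot z e).
Hypothesis adm : admissible r b a Q.

(** A unitary V whose first coordinate is z -> <z, e> turns 1 + l into the denominator of the star
    map. The numerators then have equal norms, and both span, so the target dimensions agree and a
    unitary W relates them. *)
Lemma star_equivalence : N = M /\
  unitarily_equivalent (annulus r) f (@star_map R n N r b a Q).
Proof.
have b0 := ratio_gt0 r01 rho01.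
pose u : 'rV[C]_n := \row_j Num.conj (e j 0).
have ue (z : 'cV[C]_n) : (u *m z) 0 0 = dot z e.
  by rewrite mxE; apply: eq_bigr => i _; rewrite mxE mulrC.
have u1 : dot u^T u^T = 1.
  by rewrite -ee; apply: eq_bigr => i _; rewrite !mxE conjCK mulrC.
have [V Vu Vz] := unitary_first_row u1.
have qV z : star_q a (V *m z) = 1 + (l *m z) 0 0 by rewrite star_qE Vz ue le.
have ps : spanning (qeval p).
  by move=> w H; apply: (indep (c := 0)) => z; rewrite H mul0r.
have gs : spanning (fun z => star_p r b a Q (V *m z) : 'cV[C]_M).
  by apply: spanning_mulmx => //; apply: star_p_spanning.
have gl := quadratic_on_lines_mulmx V (@star_p_on_lines R m r b a Q).
have norms z : dot (qeval p z) (qeval p z) =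
    dot (star_p r b a Q (V *m z)) (star_p r b a Q (V *m z)).
  by rewrite ker star_p_norm // qV dot_unitary.
have NM := same_norm_dim (qeval_on_lines p) gl ps gs norms; split=> //.
clear rho01 u1; subst N.
have [W Wu WE] := isometric_unitary ps (kernel_eq_of_norm (qeval_on_lines p) gl norms).
exists V, W; split=> // z Az; rewrite (fE Az).2 star_mapE // qV WE.
by rewrite scalemxAr.
Qed.

End StarEquivalence.

Section StarUnique.
Variables (R : realType) (m : nat) (r b : R).
Local Notation C := (R[i] : numClosedFieldType).
Local Notation n := m.+1.
Local Notation M := ('C(n.+1, 2) + n)%N.
Hypotheses (m0 : (0 < m)%N) (r01 : 0 < r < 1) (b0 : 0 < b).

(** The vector v is chosen with V v = e_1; averaging over v and - v at two radii gives Q = Q' and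
    a^2 = a'^2 k with k = |(V' v)_1|^2 <= 1. Hence only a <= a' follows, and exchanging the two maps
    gives the other inequality. *)
Lemma star_unique_le (f : 'cV[C]_n -> 'cV[C]_M) a Q a' Q' :
  admissible r b a Q -> admissible r b a' Q' ->
  unitarily_equivalent (annulus r) f (@star_map R n M r b a Q) ->
  unitarily_equivalent (annulus r) f (@star_map R n M r b a' Q') ->
  Q = Q' /\ a <= a'.
Proof.
move=> adm adm' /unitarily_equivalent_sqnorm[V Vu E] /unitarily_equivalent_sqnorm[V' Vu' E'].
have r0 : 0 < r by case/andP: r01.
have key (z : 'cV[C]_n) : annulus r z ->
    Q * star_qn a' (V' *m z) = Q' * star_qn a (V *m z).
  move=> Az.
  have /andP[z1 z2] := (annulusE z r0).1 Az.
  have v1 := sqnorm_unitary z Vu; have v2 := sqnorm_unitary z Vu'.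
  have s1 : sqnorm (V *m z) <= 1 by rewrite v1 ltW.
  have s2 : sqnorm (V' *m z) <= 1 by rewrite v2 ltW.
  have q1 := star_qn_gt0 adm s1; have q2 := star_qn_gt0 adm' s2.
  have := E' z Az; rewrite (E z Az) (sqnorm_star_map m0 r01 b0 adm s1).
  rewrite (sqnorm_star_map m0 r01 b0 adm' s2) v1 v2 => /addrI.
  rewrite -!mulrA => h; apply/eqP; rewrite eq_sym -subr_eq0.
  have k0 : (1 - sqnorm z) * (r ^+ 2 - sqnorm z) != 0.
    by rewrite mulf_neq0 // subr_eq0 ?(gt_eqF z2) // lt_eqF.
  have : (Q' * star_qn a (V *m z) - Q * star_qn a' (V' *m z))
      * ((1 - sqnorm z) * (r ^+ 2 - sqnorm z)) = 0.
    transitivity ((Q' * ((1 - sqnorm z) * ((r ^+ 2 - sqnorm z) / star_qn a' (V' *m z)))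
      - Q * ((1 - sqnorm z) * ((r ^+ 2 - sqnorm z) / star_qn a (V *m z))))
      * (star_qn a' (V' *m z) * star_qn a (V *m z))).
      by field; rewrite !gt_eqF.
    by rewrite h subrr mul0r.
  by move/eqP; rewrite mulf_eq0 (negPf k0) orbF.
pose e1 : 'cV[C]_n := delta_mx 0 0.
pose v := invmx V *m e1.
have Vv : V *m v = e1 by rewrite mulKVmx // unitarymx_unit.
have v1 : sqnorm v = 1 by rewrite -(sqnorm_unitary v Vu) Vv sqnorm_delta.
pose k := complex.Re ((V' *m v) 0 0) ^+ 2 + complex.Im ((V' *m v) 0 0) ^+ 2.
have k1 : k <= 1 by rewrite -v1 -(sqnorm_unitary v Vu'); apply: Re_coord_sqnorm.
have even s : r < s < 1 -> Q * (1 + a' ^+ 2 * k * s ^+ 2) = Q' * (1 + a ^+ 2 * s ^+ 2).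
  move=> rs.
  have h1 := key _ (annulus_point r01 v1 rs).
  have v1' : sqnorm (- v) = 1 by rewrite -scaleN1r sqnormZ v1 /=; ring.
  have h2 := key _ (annulus_point r01 v1' rs).
  move: h1 h2; rewrite -!scalemxAr !mulmxN Vv /star_qn /k.
  have scE (x : 'cV[C]_n) : (s%:C *: x) 0 0 = s%:C * x 0 0 by rewrite [LHS]mxE.
  have oE (x : 'cV[C]_n) : (- x) 0 0 = - x 0 0 by rewrite [LHS]mxE.
  have e1E : e1 0 0 = 1 by rewrite mxE.
  move: (V' *m v) (e1) e1E => w d dE.
  rewrite !scE !oE dE; case: (w 0 0) => x y; rewrite /=.
  by move=> h1 h2; lra.
have [ra rb] := andP r01.
pose s1 := (1 + 2 * r) / 3; pose s2 := (2 + r) / 3.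
have h1 : r < s1 < 1 by rewrite /s1; lra.
have h2 : r < s2 < 1 by rewrite /s2; lra.
have s12 : s1 < s2 by rewrite /s1 /s2; lra.
have s12' : s2 ^+ 2 - s1 ^+ 2 != 0.
  by rewrite gt_eqF // subr_gt0 ltr_pXn2r // ?qualifE /= /s1 /s2; lra.
have QQ : Q * (a' ^+ 2 * k) = Q' * a ^+ 2.
  by apply: (mulfI s12'); have := even _ h1; have := even _ h2; lra.
have QE : Q = Q'.
  have := even _ h1; have := congr1 (fun x => x * s1 ^+ 2) QQ; lra.
have Q0 : 0 < Q by case: adm.
have aa : a' ^+ 2 * k = a ^+ 2.
  by apply: (@mulfI _ Q); [rewrite gt_eqF | rewrite QQ QE].
split=> //.
have [a0 a0'] : 0 < a /\ 0 < a' by case: adm => /andP[-> _] _ _ _; case: adm' => /andP[-> _].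
have : a ^+ 2 <= a' ^+ 2 by rewrite -aa ler_piMr // sqr_ge0.
by rewrite ler_pXn2r // nnegrE ltW.
Qed.

Lemma star_unique (f : 'cV[C]_n -> 'cV[C]_M) a Q a' Q' :
  admissible r b a Q -> admissible r b a' Q' ->
  unitarily_equivalent (annulus r) f (@star_map R n M r b a Q) ->
  unitarily_equivalent (annulus r) f (@star_map R n M r b a' Q') ->
  a = a' /\ Q = Q'.
Proof.
move=> adm adm' E E'; have [QQ aa] := star_unique_le adm adm' E E'.
have [_ aa'] := star_unique_le adm' adm E' E.
by split=> //; apply/eqP; rewrite eq_le aa.
Qed.

End StarUnique.

Section Polynomial.
Variables (R : realType) (n N : nat).
Local Notation C := (R[i] : numClosedFieldType).
Local Notation M := ('C(n.+1, 2) + n)%N.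
Hypothesis n0 : (0 < n)%N.

Lemma Hseq_on_lines d : (d <= 2)%N -> forall M', quadratic_on_lines (@seq_map R n M' (Hseq d)).
Proof.
move=> d2 M'; apply: poly_fun_on_lines => j.
have -> : (fun z : 'cV[C]_n => seq_map M' (Hseq d) z j 0) = fun z => (Hseq d (coords z))`_j.
  by apply/funext => z; rewrite mxE.
apply: (poly_funW d2); apply: (@poly_fun_Hseq R n d n _ j) => [z|i]; first exact: size_coords.
exact: poly_fun_coords.
Qed.

Lemma juxtaposition_on_lines t : quadratic_on_lines (@juxtaposition R n N t).
Proof.
have hc i : poly_fun 1 (fun z : 'cV[C]_n => (coords z)`_i) by apply: poly_fun_coords.
apply: poly_fun_on_lines => j.
have -> : (fun z : 'cV[C]_n => juxtaposition N t z j 0)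
    = fun z => (juxtaposition_seq t (coords z))`_j.
  by apply/funext => z; rewrite mxE.
apply: (@poly_fun_cat _ _ _ #|multi_index n 1|) => [z|i|i].
- by rewrite size_map (size_HseqE 1 (size_coords z)).
- apply: (@poly_fun_map _ _ 1 1) => [|k].
    by apply: (@poly_funW _ _ 0) => //; apply: poly_fun_cst.
  by apply: (@poly_fun_Hseq R n 1 n) => // z; rewrite size_coords.
apply: (@poly_fun_map _ _ 0 2) => [|k]; first exact: poly_fun_cst.
by apply: (@poly_fun_Hseq R n 2 n) => // z; rewrite size_coords.
Qed.

Lemma juxtaposition_dot t (z : 'cV[C]_n) : N = M -> 0 <= t <= 1 ->
  dot (juxtaposition N t z) (juxtaposition N t z) =
  (1 - t)%:C * dot z z + t%:C * dot z z ^+ 2.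
Proof.
move=> NM t01; rewrite dot_seq_map ?juxtaposition_norm // -?dot_coords //.
by rewrite size_juxtaposition_seq size_coords.
Qed.

Lemma Hmap2_dot (z : 'cV[C]_n) : N = 'C(n.+1, 2) ->
  dot (Hmap N 2 z) (Hmap N 2 z) = dot z z ^+ 2.
Proof.
move=> NM; rewrite dot_seq_map ?Hseq_norm -?dot_coords //.
by rewrite size_Hseq ?size_coords // addn2 prednK.
Qed.

End Polynomial.

Section PolynomialEquivalence.
Variables (R : realType) (n N : nat).
Local Notation C := (R[i] : numClosedFieldType).
Local Notation M := ('C(n.+1, 2) + n)%N.
Hypothesis n0 : (0 < n)%N.
Variables (f : 'cV[C]_n -> 'cV[C]_N) (p : quadmap C n N) (A : set 'cV[C]_n) (t : R).
Hypothesis norm_p : forall z, dot (qeval p z) (qeval p z) =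
  (1 - t)%:C * dot z z + t%:C * dot z z ^+ 2.
Hypothesis fE : forall z, A z -> f z = qeval p z.
Hypothesis ps : spanning (qeval p).

(** The model is a family over all target dimensions, because N = M' becomes known only inside the
    proof. *)
Lemma polynomial_equivalence (g : forall N', 'cV[C]_n -> 'cV[C]_N') M' :
  (forall N', quadratic_on_lines (g N')) -> spanning (g M') ->
  (forall z, dot (g M' z) (g M' z) = (1 - t)%:C * dot z z + t%:C * dot z z ^+ 2) ->
  N = M' /\ unitarily_equivalent A f (g N).
Proof.
move=> gl gs gn; have NM : N = M'.
  by apply: (same_norm_dim (qeval_on_lines p) (gl M') ps gs) => z; rewrite norm_p gn.
split=> //; rewrite -NM in gs gn.
have norms z : dot (qeval p z) (qeval p z) = dot (g N z) (g N z) by rewrite norm_p gn.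
have [W Wu WE] := isometric_unitary ps (kernel_eq_of_norm (qeval_on_lines p) (gl N) norms).
exists 1%:M, W; split=> // [|z Az]; last by rewrite fE // WE mul1mx.
by apply/unitarymxP; rewrite trmx1 map_mx1 mul1mx.
Qed.

Lemma juxtaposition_equivalence : 0 < t < 1 ->
  N = M /\ unitarily_equivalent A f (@juxtaposition R n N t).
Proof.
move=> t01; apply: (polynomial_equivalence (g := fun N' => @juxtaposition R n N' t)).
- by move=> N'; apply: juxtaposition_on_lines.
- exact: juxtaposition_spanning.
- by move=> z; rewrite juxtaposition_dot //; case/andP: t01 => ? ?; rewrite !ltW.
Qed.

Lemma Hmap2_equivalence : t = 1 ->
  N = 'C(n.+1, 2) /\ unitarily_equivalent A f (@Hmap R n N 2).
Proof.
move=> t1; apply: (polynomial_equivalence (g := fun N' => @Hmap R n N' 2)).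
- by move=> N'; apply: Hseq_on_lines.
- exact: Hmap2_spanning.
- by move=> z; rewrite Hmap2_dot // t1 subrr mul0r add0r mul1r.
Qed.

End PolynomialEquivalence.

(** With x = |z|^2 the squared norm of the map is x - t x (1 - x), and unitary matrices preserve x;
    one point of the annulus determines t. *)
Lemma juxtaposition_unique (R : realType) n (r t t' : R)
    (f : 'cV[R[i] : numClosedFieldType]_n -> 'cV[R[i] : numClosedFieldType]_('C(n.+1, 2) + n)) :
  (0 < n)%N -> 0 < r < 1 -> 0 < t < 1 -> 0 < t' < 1 ->
  unitarily_equivalent (annulus r) f (juxtaposition _ t) ->
  unitarily_equivalent (annulus r) f (juxtaposition _ t') -> t = t'.
Proof.
move=> n0 r01 t01 t01' /unitarily_equivalent_sqnorm[V Vu E].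
move=> /unitarily_equivalent_sqnorm[V' Vu' E'].
have [z Az] := annulus_nonempty r01 n0.
have r0 : 0 < r by case/andP: r01.
have /andP[z1 z2] := (annulusE z r0).1 Az.
have norm (s : R) (w : 'cV[R[i]]_n) : 0 < s < 1 ->
    sqnorm (juxtaposition ('C(n.+1, 2) + n) s w) = (1 - s) * sqnorm w + s * sqnorm w ^+ 2.
  move=> hs; have s01 : 0 <= s <= 1 by case/andP: hs => ? ?; rewrite !ltW.
  apply: (@complexI R).
  rewrite -dot_sqnorm (juxtaposition_dot n0 w erefl s01) dot_sqnorm.
  by rewrite [RHS]rmorphD !rmorphM.
have h := E' z Az.
rewrite (E z Az) (norm t _ t01) (norm t' _ t01') (sqnorm_unitary _ Vu) (sqnorm_unitary _ Vu') in h.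
have x0 : 0 < sqnorm z by apply: lt_trans z1; rewrite exprn_gt0.
have k : sqnorm z * (1 - sqnorm z) != 0 by rewrite gt_eqF // mulr_gt0 // subr_gt0.
by apply: (mulIf k); lra.
Qed.

(** * The polynomial and nonpolynomial cases, and the comparison of radii with b *)

Section Classification.
Variables (R : realType) (m : nat) (r rho : R).
Local Notation C := (R[i] : numClosedFieldType).
Local Notation n := m.+1.
Local Notation M := ('C(n.+1, 2) + n)%N.
Local Notation b := ((1 - rho ^+ 2) / (1 - r ^+ 2)).
Hypotheses (m0 : (0 < m)%N) (r01 : 0 < r < 1) (rho01 : 0 < rho < 1).

Lemma classification N (f : 'cV[C]_n -> 'cV[C]_N) : proper_rational_deg2 r rho f ->
  (polynomial_on (annulus r) f /\
   exists t : R, [/\ 0 < t, t * r ^+ 2 = b - 1, b <= 1 + r ^+ 2,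
     t < 1 -> N = M /\ unitarily_equivalent (annulus r) f (@juxtaposition R n N t)
   & t = 1 -> N = 'C(n.+1, 2) /\ unitarily_equivalent (annulus r) f (@Hmap R n N 2)]) \/
  [/\ ~ polynomial_on (annulus r) f, N = M & exists a Q : R, admissible r b a Q /\
      unitarily_equivalent (annulus r) f (@star_map R n N r b a Q)].
Proof.
have n2 : (2 <= n)%N by [].
move=> fP; have [p [l [Q [Q0 ker fE poly indep]]]] := deg2_normal_form n2 r01 rho01 fP.
have ps : spanning (qeval p).
  by move=> w H; apply: (indep _ 0) => z; rewrite H mul0r.
have [l0|l0] := eqVneq l 0.
  left; split; first exact/poly.
  have [QE bE] := linear_part_gamma n2 r01 ker indep l0.
  have lz (z : 'cV[C]_n) : (l *m z) 0 0 = 0 by rewrite l0 mul0mx mxE.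
  have fp z : annulus r z -> f z = qeval p z.
    by move=> /fE[_ ->]; rewrite lz addr0 invr1 scale1r.
  have norm_p z : dot (qeval p z) (qeval p z) =
      (1 - Q)%:C * dot z z + Q%:C * dot z z ^+ 2.
    rewrite ker /kernel_form lz addr0 rmorph1.
    have -> : b = 1 + Q * r ^+ 2 by rewrite QE; ring.
    by rewrite rmorphD rmorphM rmorphB rmorphXn rmorph1 /=; ring.
  exists Q; split=> // Q1.
    by apply: (juxtaposition_equivalence _ norm_p fp ps) => //; rewrite Q0.
  exact: (Hmap2_equivalence _ norm_p fp ps).
right; have [a [e [a0 ee le]]] := linear_form_dot l0.
have adm : admissible r b a Q.
  by apply: (pole_admissible n2 r01 rho01 Q0 ker indep a0 ee le) => z /fE[].
have [NM E] := star_equivalence m0 r01 rho01 ker fE indep ee le adm.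
by split=> //; [move/poly/eqP; rewrite (negPf l0) | exists a, Q].
Qed.

Let r0 : 0 < r. Proof. by case/andP: r01. Qed.
Let rho0 : 0 < rho. Proof. by case/andP: rho01. Qed.
Let b0 := ratio_gt0 r01 rho01.
Let d0 : 0 < 1 - r ^+ 2.
Proof. by rewrite subr_gt0; apply: sqr_lt1; case/andP: r01. Qed.
Let sqr_lt (x y : R) : 0 < x -> 0 < y -> (x ^+ 2 < y ^+ 2) = (x < y).
Proof. by move=> x0 y0; rewrite ltr_pXn2r // nnegrE ltW. Qed.

Lemma ratio_gt1 : (1 < b) = (rho < r).
Proof. by rewrite ltr_pdivlMr // mul1r ltrD2l ltrN2 sqr_lt. Qed.

Lemma ratio_lt1 : (b < 1) = (r < rho).
Proof. by rewrite ltr_pdivrMr // mul1r ltrD2l ltrN2 sqr_lt. Qed.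

Lemma ratio_lt : (b < 1 + r ^+ 2) = (r ^+ 2 < rho).
Proof.
rewrite ltr_pdivrMr // -[RHS]sqr_lt ?exprn_gt0 //.
have -> : (1 + r ^+ 2) * (1 - r ^+ 2) = 1 - (r ^+ 2) ^+ 2 by ring.
by rewrite ltrD2l ltrN2.
Qed.

Lemma ratio_eq : rho = r ^+ 2 -> b = 1 + r ^+ 2.
Proof. by move=> ->; field; exact: lt0r_neq0. Qed.

Lemma ratio_gt1_admissible a Q : r ^+ 2 < rho < r -> 0 < a ->
  admissible r b a Q <-> a <= a_max r b /\ (Q = Q_plus r b a \/ Q = Q_minus r b a).
Proof.
rewrite -ratio_lt -ratio_gt1 => /andP[h1 h2] a0; apply: admissible_gt1 => //.
(* The last factor under the inner root of [a_max] is rho^2, so it is positive. *)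
have -> : b * r ^+ 2 - b + 1 = rho ^+ 2 by rewrite [RHS](ratioE rho r01); ring.
by rewrite exprn_gt0.
Qed.

Lemma admissible_ratio a Q : admissible r b a Q -> r ^+ 2 < rho.
Proof.
case=> /andP[a0 _] Q0 al0 E; have [b1|b1] := ltP 1 b.
  by rewrite -ratio_lt; have [] := m_gt0_bounds r01 b1 a0 (shift_m_gt0 r01 b1 a0 al0 E).
by rewrite -ratio_lt; apply: le_lt_trans b1 _; rewrite ltrDl exprn_gt0.
Qed.

Lemma star_existence a Q : admissible r b a Q -> [/\ 0 <= Q_disc r b a, star_defined r b a Q
  & proper_rational_deg2 r rho (@star_map R n M r b a Q)].
Proof.
move=> adm; split; first by case: adm => _ _ _ E; have [] := star_det_roots r0 E.
  exact: admissible_star_defined.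
by apply: star_map_proper_rational => //; apply: ratioE.
Qed.

End Classification.

Theorem theorem6p1 (R : realType) (n : nat) (r rho : R) :
  (2 <= n)%N -> 0 < r < 1 -> 0 < rho < 1 ->
  let b := (1 - rho ^+ 2) / (1 - r ^+ 2) in
  let M := ('C(n.+1, 2) + n)%N in
  let a_Q_nonpoly (a Q : R) :=
    [/\ 0 < a, a <= a_max r b & Q = Q_plus r b a \/ Q = Q_minus r b a] in
  let Q_eq (a : R) := 1 / (1 + r ^+ 2) - a ^+ 2 in
  let Q_larger (a : R) := Num.max (Q_plus r b a) (Q_minus r b a) in
  [/\ (forall (N : nat) (f : 'cV[R[i]]_n -> 'cV[R[i]]_N),
         proper_rational_deg2 r rho f -> r ^+ 2 <= rho),
      (rho = r ^+ 2 ->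
       forall (N : nat) (f : 'cV[R[i]]_n -> 'cV[R[i]]_N),
         proper_rational_deg2 r rho f ->
         N = 'C(n.+1, 2) /\
         unitarily_equivalent (annulus r) f (@Hmap R n N 2)),
      (r ^+ 2 < rho < r ->
       (forall (N : nat) (f : 'cV[R[i]]_n -> 'cV[R[i]]_N),
          proper_rational_deg2 r rho f -> polynomial_on (annulus r) f ->
          N = M /\
          exists! t : R, 0 < t < 1 /\
            unitarily_equivalent (annulus r) f (@juxtaposition R n N t)) /\
       (forall (N : nat) (f : 'cV[R[i]]_n -> 'cV[R[i]]_N),
          proper_rational_deg2 r rho f -> ~ polynomial_on (annulus r) f ->
          N = M /\
          exists! aQ : R * R, a_Q_nonpoly aQ.1 aQ.2 /\
            unitarily_equivalent (annulus r) f
              (@star_map R n N r b aQ.1 aQ.2)) /\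
       (forall a Q : R, a_Q_nonpoly a Q ->
          [/\ 0 <= Q_disc r b a, star_defined r b a Q
            & proper_rational_deg2 r rho (@star_map R n M r b a Q)])),
      (rho = r ->
       (forall (N : nat) (f : 'cV[R[i]]_n -> 'cV[R[i]]_N),
          proper_rational_deg2 r rho f ->
          N = M /\
          exists! a : R, 0 < a < 1 / Num.sqrt (1 + r ^+ 2) /\
            unitarily_equivalent (annulus r) f
              (@star_map R n N r b a (Q_eq a))) /\
       (forall a : R, 0 < a < 1 / Num.sqrt (1 + r ^+ 2) ->
          star_defined r b a (Q_eq a) /\
          proper_rational_deg2 r rho (@star_map R n M r b a (Q_eq a))))
    & (r < rho < 1 ->
       (forall (N : nat) (f : 'cV[R[i]]_n -> 'cV[R[i]]_N),
          proper_rational_deg2 r rho f ->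
          N = M /\
          exists! a : R, 0 < a < 1 /\
            unitarily_equivalent (annulus r) f
              (@star_map R n N r b a (Q_larger a))) /\
       (forall a : R, 0 < a < 1 ->
          [/\ 0 <= Q_disc r b a, star_defined r b a (Q_larger a)
            & proper_rational_deg2 r rho (@star_map R n M r b a (Q_larger a))]))].
Proof.
case: n => [|m] // n2 r01 rho01 b M a_Q_nonpoly Q_eq Q_larger.
have m0 : (0 < m)%N by [].
have r0 : 0 < r by case/andP: r01.
have t0 : 0 < r ^+ 2 by rewrite exprn_gt0.
have rt : r ^+ 2 < r by rewrite expr2 gtr_pMr //; case/andP: r01.
have b0 := ratio_gt0 r01 rho01.
have cls := @classification R m r rho m0 r01 rho01.
have exi := @star_existence R m r rho m0 r01 rho01.
have gt1 := ratio_gt1 r01 rho01; have lt1 := ratio_lt1 r01 rho01.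
have bt := ratio_lt r01 rho01.
(* For rho >= r one has b <= 1, while a polynomial map would have t r^2 = b - 1 with t > 0. *)
have nonpoly N (f : 'cV[R[i]]_m.+1 -> 'cV[R[i]]_N) : proper_rational_deg2 r rho f ->
    ~~ (rho < r) -> N = M /\ exists a Q, admissible r b a Q /\
      unitarily_equivalent (annulus r) f (@star_map R m.+1 N r b a Q).
  rewrite -gt1 => /cls[[_ [t [tp tE _ _ _]]]|[_ NM E] _]; last by split.
  by move=> /negP[]; rewrite -subr_gt0 -tE mulr_gt0.
have uniq (f : 'cV[R[i]]_m.+1 -> 'cV[R[i]]_M) := star_unique m0 r01 b0 (f := f).
split.
- move=> N f /cls[[_ [t [_ _ bE _ _]]]|[_ _ [a [Q [adm _]]]]]; last first.
    exact: ltW (admissible_ratio r01 rho01 adm).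
  (* If rho < r^2, then b < 1 + r^2 fails, and b = 1 + r^2 would give rho^2 = r^4. *)
  rewrite leNgt; apply/negP => h; move: bE; rewrite le_eqVlt bt ltNge (ltW h) orbF.
  move=> /eqP bE; have := ratioE rho r01; rewrite bE => rE.
  have : rho ^+ 2 = (r ^+ 2) ^+ 2 by rewrite rE; ring.
  move/eqP; rewrite eqrXn2 ?(ltW t0) //; last by case/andP: rho01 => /ltW.
  by rewrite lt_eqF.
- move=> rhoE N f /cls[[_ [t [_ tE _ _]]]|[_ _ [a [Q [adm _]]]]]; last first.
    by have := admissible_ratio r01 rho01 adm; rewrite rhoE ltxx.
  apply; apply: (mulIf (lt0r_neq0 t0)).
  by rewrite tE (ratio_eq r01 rhoE); ring.
- move=> rrho; have [rrho1 rrho2] := andP rrho; split; [|split].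
  + move=> N f /cls[[_ [t [tp tE _ + _]]]|[np]] // _.
    have t1 : t < 1.
      by rewrite -(ltr_pM2r t0) tE mul1r ltrBlDl bt.
    move=> /(_ t1)[NM E]; split=> //; subst N; exists t; split; [by rewrite tp t1 | move=> t' [t'01 E']].
    by apply: (juxtaposition_unique _ r01 _ t'01 E E') => //; rewrite tp.
  + move=> N f /cls[[pf _] /(_ pf)//|[_ NM [a [Q [adm E]]]] _]; split=> //; subst N.
    have a0 : 0 < a by case: adm => /andP[].
    exists (a, Q); split=> [|[a' Q'] [[/= a'0 a'm QE] E']].
      split=> //; have [am QE] := (ratio_gt1_admissible r01 rho01 Q rrho a0).1 adm.
      by split.
    have adm' : admissible r b a' Q' by apply/(ratio_gt1_admissible r01 rho01).
    by have [-> ->] := uniq f _ _ _ _ adm adm' E E'.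
  move=> a Q [a0 am QE]; apply: exi.
  by apply/(ratio_gt1_admissible r01 rho01).
- move=> rhoE; have b1 : b = 1.
    by rewrite /b rhoE divff // subr_eq0 gt_eqF //; apply: sqr_lt1; case/andP: r01.
  have adm_iff a Q : admissible r b a Q <->
      0 < a < 1 / Num.sqrt (1 + r ^+ 2) /\ Q = Q_eq a by rewrite b1; apply: admissible_eq1.
  split.
    move=> N f /nonpoly; rewrite rhoE ltxx => /(_ isT)[NM [a [Q [adm E]]]].
    split=> //; subst N; have [a01 QE] := (adm_iff a Q).1 adm.
    exists a; split; first by rewrite -QE.
    move=> a' [a'01 E']; have adm' : admissible r b a' (Q_eq a') by apply/adm_iff.
    by have [] := uniq f _ _ _ _ adm adm' E E'.
  move=> a a01; have adm : admissible r b a (Q_eq a) by apply/adm_iff.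
  by have [] := exi _ _ adm.
case/andP=> rrho _.
have b01 : 0 < b < 1 by rewrite b0 lt1.
have adm_iff a Q := @admissible_lt1 R r b a Q r01 b01.
split.
  move=> N f /nonpoly; rewrite -leNgt (ltW rrho) => /(_ isT)[NM [a [Q [adm E]]]].
  split=> //; subst N; have [a01 QE] := (adm_iff a Q).1 adm.
  exists a; split; first by rewrite /Q_larger -QE.
  move=> a' [a'01 E']; have adm' : admissible r b a' (Q_larger a') by apply/adm_iff.
  by have [] := uniq f _ _ _ _ adm adm' E E'.
by move=> a a01; apply: exi; apply/adm_iff.
Qed.
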